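(* Let $f:M\to M$ be a $C^1$ partially hyperbolic diffeomorphism, let $\mu$ be an ergodic $f$-invariant probability measure, and let $\xi\in\mathcal Q^u$. Then for any measurable partition $\alpha$ of $M$ with $H_\mu(\alpha|\xi)<\infty$, $$\lim_{n\to\infty}\frac1nI_\mu(\alpha_0^{n-1}|\xi)(x)=h_\mu(f,\alpha|\xi)\qquad\text{for }\mu\text{-a.e. }x\in M,$$ where $h_\mu(f,\alpha|\xi)=\limsup_{n\to\infty}\frac1nH_\mu(\alpha_0^{n-1}|\xi)$.
   Context: Setting: $M$ is a smooth, connected, compact Riemannian manifold without boundary. A $C^1$ diffeomorphism $f:M\to M$ is partially hyperbolic if there is a nontrivial $Tf$-invariant splitting $TM=E^s\oplus E^c\oplus E^u$ such that, for a suitable Riemannian metric, all unit vectors $v^\sigma\in E^\sigma_x$ ($\sigma=s,c,u$), $x\in M$, satisfy $\|T_xfv^s\|<\|T_xfv^c\|<\|T_xfv^u\|$, and $\|T_xf|_{E^s_x}\|<1$, $\|T_xf^{-1}|_{E^u_x}\|<1$. $W^u$ is the unstable foliation (tangent to $E^u$), with leaf $W^u(x)$ through $x$. $\alpha(x)$ is the element of the partition $\alpha$ containing $x$; $\alpha\ge\beta$ means $\alpha(x)\subset\beta(x)$ for all $x$; $\alpha_0^{n-1}=\bigvee_{i=0}^{n-1}f^{-i}\alpha$. For measurable partitions $\alpha,\xi$, let $\{\mu^\xi_x\}$ be the canonical system of conditional measures of $\mu$ relative to $\xi$; $I_\mu(\alpha|\xi)(x)=-\log\mu^\xi_x(\alpha(x))$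 and $H_\mu(\alpha|\xi)=\int_MI_\mu(\alpha|\xi)\,d\mu$. $\mathcal Q^u$ is the set of measurable partitions $\xi$ of $M$ that are (i) subordinate to unstable manifolds: for $\mu$-a.e. $x$, $\xi(x)\subset W^u(x)$ and $\xi(x)$ contains an open neighborhood of $x$ in $W^u(x)$; (ii) increasing: $f^{-1}\xi\ge\xi$; (iii) generators: $\bigvee_{n=1}^\infty f^{-n}\xi$ is the partition into points up to a set of measure zero. *)

(* Defs.v *)
From HB Require Import structures.
From mathcomp Require Import all_boot all_order all_algebra.
From mathcomp Require Import all_classical all_reals all_analysis.
Set Implicit Arguments.
Unset Strict Implicit.
Unset Printing Implicit Defensive.
Import Order.TTheory GRing.Theory Num.Theory.
Import numFieldNormedType.Exports.
Local Open Scope classical_set_scope.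
Local Open Scope ring_scope.

(* Vectors of R^d are row vectors, so that a differential ['d h p] acts by
   right multiplication by the matrix [jacobian h p], and linear subspaces of
   R^d are row spaces of matrices (scope %MS). *)

(* [Ck k U h]: [h] is of class C^k on the open set [U]; for k > 0 this asks
   that all directional derivatives exist on [U] and are of class C^(k-1), which
   in finite dimension is the usual notion. *)
Fixpoint Ck (R : realType) (V W : normedModType R) (k : nat) (U : set V)
    (h : V -> W) : Prop :=
  (forall p, U p -> {for p, continuous h}) /\
  (if k is k'.+1 then
     forall v, (forall p, U p -> derivable h p v) /\ Ck k' U (derive h ^~ v)
   else True).

Definition Csmooth (R : realType) (V W : normedModType R) (U : set V)
    (h : V -> W) : Prop := forall k, Ck k U h.

(* [cmap] and [cinv] are total functions; only their values on [dom] and on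
   [chart_image] are meaningful. *)
Record chart (R : realType) (M : topologicalType) (d : nat) := Chart {
  dom : set M ;
  cmap : M -> 'rV[R]_d ;
  cinv : 'rV[R]_d -> M }.

Definition chart_image (R : realType) (M : topologicalType) (d : nat)
  (c : chart R M d) : set 'rV[R]_d := cmap c @` dom c.

Record is_chart (R : realType) (M : topologicalType) (d : nat)
    (c : chart R M d) : Prop := IsChart {
  chart_dom_open : open (dom c) ;
  chart_image_open : open (chart_image c) ;
  chart_cancel : forall x, dom c x -> cinv c (cmap c x) = x ;
  chart_continuous : forall x, dom c x -> {for x, continuous (cmap c)} ;
  chart_inv_continuous :
    forall p, chart_image c p -> {for p, continuous (cinv c)} }.

(* A smooth atlas, with a preferred chart around every point: the tangent space
   at [x] is R^d, a tangent vector being written in the chart [chart_at x].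
   Second countability is not listed, as it is automatic in the compact case. *)
Record smooth_structure (R : realType) (M : topologicalType) (d : nat) :=
  SmoothStructure {
  atlas : set (chart R M d) ;
  chart_at : M -> chart R M d ;
  atlas_chart : forall c, atlas c -> is_chart c ;
  chart_at_atlas : forall x, atlas (chart_at x) ;
  chart_at_dom : forall x, dom (chart_at x) x ;
  atlas_smooth : forall c c', atlas c -> atlas c' ->
    Csmooth (cmap c @` (dom c `&` dom c')) (cmap c' \o cinv c) }.

Section tangent.
Context {R : realType} {M : topologicalType} {d : nat}.
Variable S : smooth_structure R M d.

Definition Ck_map (k : nat) (f : M -> M) : Prop :=
  continuous f /\
  forall c c', atlas S c -> atlas S c' ->
    Ck k (cmap c @` (dom c `&` f @^-1` dom c')) (cmap c' \o f \o cinv c).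

Definition C1_diffeomorphism (f finv : M -> M) : Prop :=
  [/\ cancel f finv, cancel finv f, Ck_map 1 f & Ck_map 1 finv].

(* The tangent map T_x f : T_x M -> T_(f x) M. *)
Definition tmap (f : M -> M) (x : M) : 'M[R]_d :=
  jacobian (cmap (chart_at S (f x)) \o f \o cinv (chart_at S x))
           (cmap (chart_at S x) x).

(* For [c] a chart around [x], the coordinates in [c] of a vector v of T_x M
   are [v *m tcoord c x]. *)
Definition tcoord (c : chart R M d) (x : M) : 'M[R]_d :=
  jacobian (cmap c \o cinv (chart_at S x)) (cmap (chart_at S x) x).

(* The inverse change of coordinates, at the point of coordinates [p] in [c]. *)
Definition tcoord_inv (c : chart R M d) (p : 'rV[R]_d) : 'M[R]_d :=
  jacobian (cmap (chart_at S (cinv c p)) \o cinv c) p.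

(* [g x] is the Gram matrix of the inner product of T_x M; its Gram matrix in
   any chart of the atlas must be a smooth function of the coordinates. *)
Record riemannian_metric (g : M -> 'M[R]_d) : Prop := RiemannianMetric {
  metric_sym : forall x, (g x)^T = g x ;
  metric_pos : forall x (v : 'rV[R]_d), v != 0 ->
    0 < (v *m g x *m v^T) ord0 ord0 ;
  metric_smooth : forall c, atlas S c ->
    Csmooth (chart_image c)
      (fun p => tcoord_inv c p *m g (cinv c p) *m (tcoord_inv c p)^T) }.

Definition tnorm (g : M -> 'M[R]_d) (x : M) (v : 'rV[R]_d) : R :=
  Num.sqrt ((v *m g x *m v^T) ord0 ord0).

(* Operator norm of the restriction of T_x f to the subspace [E x]. *)
Definition restr_norm (g : M -> 'M[R]_d) (f : M -> M) (E : M -> 'M[R]_d)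
    (x : M) : R :=
  sup [set tnorm g (f x) (v *m tmap f x) |
       v in [set v : 'rV[R]_d | (v <= E x)%MS /\ tnorm g x v = 1]].

(* [E x], read as a row space, is the fibre at [x] of a continuous subbundle of
   rank [k] of TM: around any point it has a continuous local frame. *)
Definition subbundle (k : nat) (E : M -> 'M[R]_d) : Prop :=
  (forall x, \rank (E x) = k) /\
  forall x0, exists F : M -> 'M[R]_(k, d),
    \forall x \near x0, {for x, continuous F} /\
      (F x == E x *m tcoord (chart_at S x0) x)%MS.

Definition splitting (Es Ec Eu : M -> 'M[R]_d) : Prop :=
  forall x, mxdirect (Es x + Ec x + Eu x) /\
            (Es x + Ec x + Eu x == 1%:M)%MS.

Definition tangent_invariant (f : M -> M) (E : M -> 'M[R]_d) : Prop :=
  forall x, (E x *m tmap f x == E (f x))%MS.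

Record partially_hyperbolic (f finv : M -> M) (Es Ec Eu : M -> 'M[R]_d) : Prop :=
  PartiallyHyperbolic {
  ph_subbundle_s : exists2 k, (0 < k)%N & subbundle k Es ;
  ph_subbundle_c : exists2 k, (0 < k)%N & subbundle k Ec ;
  ph_subbundle_u : exists2 k, (0 < k)%N & subbundle k Eu ;
  ph_splitting : splitting Es Ec Eu ;
  ph_invariant_s : tangent_invariant f Es ;
  ph_invariant_c : tangent_invariant f Ec ;
  ph_invariant_u : tangent_invariant f Eu ;
  ph_metric : exists2 g, riemannian_metric g &
    forall x,
      [/\ forall vs vc vu : 'rV[R]_d,
            [/\ (vs <= Es x)%MS, (vc <= Ec x)%MS & (vu <= Eu x)%MS] ->
            [/\ tnorm g x vs = 1, tnorm g x vc = 1 & tnorm g x vu = 1] ->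
            tnorm g (f x) (vs *m tmap f x) < tnorm g (f x) (vc *m tmap f x) /\
            tnorm g (f x) (vc *m tmap f x) < tnorm g (f x) (vu *m tmap f x),
          restr_norm g f Es x < 1 &
          restr_norm g finv Eu x < 1] }.

End tangent.

(* Foliated chart, with coordinates [leafc] along the leaves and [transc]
   transverse to them; [fbinv] is the inverse homeomorphism, defined on the
   product of the open unit balls. *)
Record flowbox (R : realType) (M : topologicalType) (k c : nat) := Flowbox {
  fbdom : set M ;
  leafc : M -> 'rV[R]_k ;
  transc : M -> 'rV[R]_c ;
  fbinv : 'rV[R]_k * 'rV[R]_c -> M }.

Section foliation.
Context {R : realType} {M : topologicalType} {d : nat}.
Variable S : smooth_structure R M d.

Definition plaque (k c : nat) (b : flowbox R M k c) (x : M) : set M :=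
  [set y | fbdom b y /\ transc b y = transc b x].

(* The slices [fbinv b (_, t)] are C^1 immersions with tangent spaces [E]. *)
Record is_flowbox (k c : nat) (E : M -> 'M[R]_d) (b : flowbox R M k c) : Prop :=
  IsFlowbox {
  fb_open : open (fbdom b) ;
  fb_map : forall x, fbdom b x ->
    ball (0 : 'rV[R]_k) 1 (leafc b x) /\ ball (0 : 'rV[R]_c) 1 (transc b x) ;
  fb_inv_map : forall s t, ball (0 : 'rV[R]_k) 1 s -> ball (0 : 'rV[R]_c) 1 t ->
    fbdom b (fbinv b (s, t)) ;
  fb_cancel : forall x, fbdom b x -> fbinv b (leafc b x, transc b x) = x ;
  fb_inv_cancel :
    forall s t, ball (0 : 'rV[R]_k) 1 s -> ball (0 : 'rV[R]_c) 1 t ->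
    leafc b (fbinv b (s, t)) = s /\ transc b (fbinv b (s, t)) = t ;
  fb_continuous : forall x, fbdom b x ->
    {for x, continuous (leafc b)} /\ {for x, continuous (transc b)} ;
  fb_inv_continuous :
    forall s t, ball (0 : 'rV[R]_k) 1 s -> ball (0 : 'rV[R]_c) 1 t ->
    {for (s, t), continuous (fbinv b)} ;
  fb_tangent : forall t ch, ball (0 : 'rV[R]_c) 1 t -> atlas S ch ->
    let U := [set s | ball (0 : 'rV[R]_k) 1 s /\ dom ch (fbinv b (s, t))] in
    let h := fun s => cmap ch (fbinv b (s, t)) in
    Ck 1 U h /\
    forall s, U s ->
      (jacobian h s == E (fbinv b (s, t)) *m tcoord S ch (fbinv b (s, t)))%MS }.

(* A foliation of M with C^1 leaves tangent to the rank k subbundle [E], given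
   by an atlas of foliated charts.  On overlaps, transverse coordinates locally
   determine each other. *)
Record foliation_tangent_to (k : nat) (E : M -> 'M[R]_d)
    (F : set (flowbox R M k (d - k))) : Prop := FoliationTangentTo {
  fol_rank : forall x, \rank (E x) = k ;
  fol_flowbox : forall b, F b -> is_flowbox E b ;
  fol_cover : forall x, exists2 b, F b & fbdom b x ;
  fol_compatible : forall b b' x, F b -> F b' -> fbdom b x -> fbdom b' x ->
    exists V : set M, [/\ open V, V x, V `<=` fbdom b `&` fbdom b' &
      forall y z, V y -> V z ->
        (transc b y = transc b z <-> transc b' y = transc b' z)] }.

(* The leaf through [x]: points joined to [x] by a finite chain of plaques. *)
Inductive leaf (k c : nat) (F : set (flowbox R M k c)) (x : M) : M -> Prop :=
| leaf_refl : leaf F x x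
| leaf_step b y z : leaf F x y -> F b -> fbdom b y -> plaque b y z ->
    leaf F x z.

(* Open sets of the intrinsic topology of the leaves (finer than the topology
   induced by M): the open subsets of plaques form a basis. *)
Definition leaf_open (k c : nat) (F : set (flowbox R M k c)) (O : set M) : Prop :=
  forall y, O y -> exists b (V : set M),
    [/\ F b, fbdom b y, open V, V y & plaque b y `&` V `<=` O].

End foliation.

Notation borel M := (g_sigma_algebraType (@open M)).

(* A partition [a] is encoded by the map sending a point to its class. *)
Definition is_partition (M : Type) (a : M -> set M) : Prop :=
  (forall x, a x x) /\ (forall x y, a x y -> a y = a x).

Definition finer (M : Type) (a b : M -> set M) : Prop :=
  forall x, a x `<=` b x.

Definition pullback_partition (M : Type) (f : M -> M) (a : M -> set M) :
  M -> set M := fun x => f @^-1` (a (f x)).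

(* a_0^(n-1), the join of the f^(-i) a for i < n. *)
Definition iterated_join (M : Type) (f : M -> M) (a : M -> set M) (n : nat) :
  M -> set M := fun x => \bigcap_(i < n) pullback_partition (iter i f) a x.

Section entropy.
Context {R : realType} {M : ptopologicalType}.
Variable mu : probability (borel M) R.
Local Open Scope ereal_scope.

Definition invariant_measure (f : M -> M) : Prop :=
  forall A : set (borel M), measurable A -> mu (f @^-1` A) = mu A.

Definition ergodic_measure (f : M -> M) : Prop :=
  invariant_measure f /\
  forall A : set (borel M), measurable A -> f @^-1` A = A ->
    mu A = 0 \/ mu A = 1.

(* Rokhlin's definition: up to a null set, the classes are separated by a
   countable family of measurable unions of classes. *)
Definition measurable_partition (a : M -> set M) : Prop :=
  is_partition a /\
  exists (N : set (borel M)) (B : nat -> set (borel M)),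
    [/\ mu.-negligible N, forall n, measurable (B n) &
        forall x y, ~ N x -> ~ N y ->
          (a x y <-> forall n, B n x <-> B n y)].

(* [mux] is a canonical system of conditional measures of mu relative to xi.
   Being essentially constant on classes and measurable, x |-> mux x A is
   measurable for the (completed) sigma-algebra of unions of classes. *)
Definition conditional_system (xi : M -> set M)
    (mux : R.-pker (borel M) ~> (borel M)) : Prop :=
  [/\ exists2 N : set (borel M), mu.-negligible N &
        forall x y, ~ N x -> ~ N y -> xi x y ->
          forall A : set (borel M), measurable A -> mux x A = mux y A,
      {ae mu, forall x, (mux x).-negligible (~` xi x)} &
      forall A : set (borel M), measurable A -> mu A = \int[mu]_x mux x A].

(* The class [a x] is only measurable for the completion of [mux x], for almost
   every x; its completed measure is the outer measure [mu_ext]. *)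
Definition information (mux : R.-pker (borel M) ~> (borel M))
    (a : M -> set M) (x : M) : \bar R := - lne (mu_ext (mux x) (a x)).

Definition cond_entropy (mux : R.-pker (borel M) ~> (borel M))
    (a : M -> set M) : \bar R := \int[mu]_x information mux a x.

Definition dyn_cond_entropy (f : M -> M)
    (mux : R.-pker (borel M) ~> (borel M)) (a : M -> set M) : \bar R :=
  limn_esup (fun n => (n%:R^-1)%:E * cond_entropy mux (iterated_join f a n)).

Definition subordinate (k c : nat) (F : set (flowbox R M k c))
    (xi : M -> set M) : Prop :=
  {ae mu, forall x, xi x `<=` leaf F x /\
    exists O : set M, [/\ leaf_open F O, O x, O `<=` leaf F x & O `<=` xi x]}.

Definition generator (f : M -> M) (xi : M -> set M) : Prop :=
  exists2 N : set (borel M), mu.-negligible N &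
    forall x y, ~ N x -> ~ N y ->
      (forall n, (0 < n)%N -> pullback_partition (iter n f) xi x y) -> y = x.

Record Qu (f : M -> M) (k c : nat) (F : set (flowbox R M k c))
    (xi : M -> set M) : Prop := IsQu {
  Qu_measurable : measurable_partition xi ;
  Qu_subordinate : subordinate F xi ;
  Qu_increasing : finer (pullback_partition f xi) xi ;
  Qu_generator : generator f xi }.

End entropy.

(* Main.v *)
Require Import Defs.
From HB Require Import structures.
From mathcomp Require Import all_boot all_order all_algebra.
From mathcomp Require Import all_classical all_reals all_analysis.
From mathcomp Require Import measurable_realfun zify ring lra.
Set Implicit Arguments.
Unset Strict Implicit.
Unset Printing Implicit Defensive.
Import Order.TTheory GRing.Theory Num.Theory.
Import numFieldNormedType.Exports.
Local Open Scope classical_set_scope.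
Local Open Scope ring_scope.

(** Write [xi_n] for the partition f^-n xi, which refines [xi], and al(a,b) for
    the join of the f^-i alpha with a <= i < b.  The chain rule for conditional
    information gives

      I(al(0,n) | xi) = I(al(0,n) v xi_n | xi) - I(xi_n | xi v al(0,n)),

    and each term on the right is a sum along the orbit: the first of
    I(alpha v xi_1 | xi v al(-i,0)) and the second of
    I(xi_1 | xi v al(-i,n-i)), both evaluated at f^i x for i < n.  So both have
    the form of a sum of g_(i,n-i)(f^i x), where g_(s,t) is the information of
    a fixed partition given what happens between the times -s and t
    ([ae_array_sumE], [window_smb]).

    The averages of such a triangular array converge almost everywhere and in
    mean ([ae_cvg_array_sum], [cvg_integral_array_sum]) because of a single
    inequality: replacing in the product of the n conditional probabilities the
    conditions by coarser ones, and dividing by the original product, gives a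
    function of integral at most 1 ([ratio_integral_le], [cond_info_chain]).
    By Jensen's inequality the entropies decrease when s and t grow; let b be
    their infimum.  By the Borel-Cantelli lemma the sum is at most the one with
    constant windows j, up to o(n), and Birkhoff's theorem bounds the upper
    limit by the entropy of g_(j,j), which is close to b.  For the lower bound,
    along windows whose entropies converge to b fast enough, the functions
    g_(j,j) converge almost everywhere to a function of integral b, and the
    inequality passes to the limit by Fatou's lemma.

    For this both terms must have finite entropy.  The partition alpha is
    assumed to, and for xi_1 given xi it follows from f being Lipschitz in
    charts on a compact manifold: the cell of f x in a grid of small mesh is
    determined by the cell of x and one of K symbols, with K independent of
    the mesh ([codable_Ck_map]).  If gamma is a finite partition coarser than
    xi_1, its names over the times 0, ..., n - 1 are measurable with respect to
    xi_n; guessing them from the codes of the orbit, of which there are at most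
    a constant times K ^ n, bounds the entropy of gamma given xi by
    ln K + ln 2 + 1 ([finite_entropy_le]), and finite partitions increase to
    xi_1 ([step_entropy_fin]).

    Partitions are handled as measurable relations E on M * M, and the measure
    of a class as the mass of a section of E under the conditional measure of
    xi at the point ([class_mass]).  Two facts on these masses are used
    throughout: a pair of points, the second drawn from the conditional measure
    at the first, is exchangeable ([mass_transport]); and the masses transform
    under an invariant map as conditional measures do ([ae_covariance]). *)

(** * The ergodic theorem *)

Lemma invariant_inverse d (T : measurableType d) (R : realType)
    (mu : probability T R) (f g : T -> T) :
  measurable_fun setT g -> cancel f g ->
  (forall A : set T, measurable A -> mu (f @^-1` A) = mu A) ->
  forall A : set T, measurable A -> mu (g @^-1` A) = mu A.
Proof.
move=> mg fK inv A mA; rewrite -(inv (g @^-1` A)).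
  by congr (mu _); apply/seteqP; split => x /=; rewrite fK.
by rewrite -[X in measurable X]setTI; exact: mg.
Qed.

Lemma iter_cancel (T : Type) (f g : T -> T) n :
  cancel f g -> cancel (iter n f) (iter n g).
Proof. by move=> fK; elim: n => // n ih x; rewrite iterSr iterS fK ih. Qed.

Lemma iter_back (T : Type) (f g : T -> T) i n x : cancel g f -> (i < n)%N ->
  iter i f (iter n g x) = iter (n - i.+1).+1 g x.
Proof.
move=> gK ni; rewrite -{1}(subnKC (ltnW ni)) iterD (iter_cancel i gK).
by congr (iter _ g x); lia.
Qed.

Section birkhoff.
Context d (T : measurableType d) (R : realType) (mu : probability T R).
Variable f : T -> T.
Hypothesis mf : measurable_fun setT f.
Hypothesis inv : forall A : set T, measurable A -> mu (f @^-1` A) = mu A.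

Lemma measurable_iter n : measurable_fun setT (iter n f).
Proof.
by elim: n => [|n ih]; [exact: measurable_id|exact: (measurableT_comp mf ih)].
Qed.

Lemma integral_invariant (F : T -> \bar R) : measurable_fun setT F ->
  (forall x, 0 <= F x)%E -> (\int[mu]_x F (f x) = \int[mu]_x F x)%E.
Proof.
move=> mF F0.
have := ge0_integral_pushforward mf mu measurableT mF (fun x _ => F0 x).
rewrite preimage_setT => <-; apply: eq_measure_integral => A mA _.
exact: inv.
Qed.

Lemma integral_iter (F : T -> \bar R) n : measurable_fun setT F ->
  (forall x, 0 <= F x)%E -> (\int[mu]_x F (iter n f x) = \int[mu]_x F x)%E.
Proof.
move=> mF F0; elim: n => // n <-.
rewrite -[RHS](@integral_invariant (F \o iter n f)).
- by apply: eq_integral => x _; rewrite iterSr.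
- exact: (measurableT_comp mF (measurable_iter n)).
- by move=> x; exact: F0.
Qed.

Lemma ae_iter (P : T -> Prop) n : {ae mu, forall x, P x} ->
  {ae mu, forall x, P (iter n f x)}.
Proof.
move=> [N [mN N0 sN]]; exists (iter n f @^-1` N); split.
- by rewrite -[X in measurable X]setTI; exact: measurable_iter.
- elim: n => // n ih.
  rewrite (_ : iter n.+1 f @^-1` N = f @^-1` (iter n f @^-1` N)); last first.
    by apply/seteqP; split => x; rewrite /preimage/= -iterS iterSr.
  by rewrite inv// -[X in measurable X]setTI; exact: measurable_iter.
- by move=> x /= nP; exact: sN.
Qed.

Definition birkhoff_sum (h : T -> R) n x := \sum_(i < n) h (iter i f x).

Lemma measurable_birkhoff_sum h n : measurable_fun setT h ->
  measurable_fun setT (birkhoff_sum h n).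
Proof.
move=> mh; apply: measurable_sum => i.
by apply: measurableT_comp => //; exact: measurable_iter.
Qed.

Lemma birkhoff_sumSl h n x :
  birkhoff_sum h n.+1 x = h x + birkhoff_sum h n (f x).
Proof.
rewrite /birkhoff_sum big_ord_recl/=; congr (_ + _).
by apply: eq_bigr => i _; rewrite -iterS iterSr.
Qed.

(** The maximum of the Birkhoff sums of length at most [n], the empty sum
    included; this form is the recursion that the maximal inequality uses. *)
Fixpoint max_birkhoff (h : T -> R) n x : R :=
  if n is n'.+1 then Num.max 0 (h x + max_birkhoff h n' (f x)) else 0.

Lemma max_birkhoff_ge0 h n x : 0 <= max_birkhoff h n x.
Proof. by case: n => //= n; rewrite le_max lexx. Qed.

Lemma max_birkhoff_ge h n x : birkhoff_sum h n x <= max_birkhoff h n x.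
Proof.
elim: n x => [|n ih] x; first by rewrite /birkhoff_sum big_ord0.
by rewrite birkhoff_sumSl/= le_max lerD2l ih orbT.
Qed.

Lemma max_birkhoff_nd h n x : max_birkhoff h n x <= max_birkhoff h n.+1 x.
Proof.
elim: n x => [|n ih] x; first exact: max_birkhoff_ge0.
rewrite [leRHS]/= [leLHS]/= ge_max !le_max lexx/=.
by rewrite lerD2l ih orbT.
Qed.

Lemma measurable_max_birkhoff h n : measurable_fun setT h ->
  measurable_fun setT (max_birkhoff h n).
Proof.
move=> mh; elim: n => [|n ih]/=; first exact: measurable_cst.
apply: measurable_maxr; first exact: measurable_cst.
by apply: measurable_funD => //; exact: (measurableT_comp ih mf).
Qed.

Section maximal.
Variables u v : T -> R.
Hypotheses (mu_ : measurable_fun setT u) (mv : measurable_fun setT v).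
Hypotheses (u0 : forall x, 0 <= u x) (v0 : forall x, 0 <= v x).
Hypothesis ufin : (\int[mu]_x (u x)%:E < +oo)%E.
Let h x := u x - v x.
Let mh : measurable_fun setT h.
Proof. exact: measurable_funB. Qed.
Let M := max_birkhoff h.
Let mM n : measurable_fun setT (M n).
Proof. exact: measurable_max_birkhoff. Qed.

Let intM n : (\int[mu]_x (M n x)%:E < +oo)%E.
Proof.
elim: n => [|n ih]; first by rewrite integral0.
apply: (@le_lt_trans _ _ (\int[mu]_x ((u x)%:E + (M n (f x))%:E))%E).
  apply: ge0_le_integral => //.
  - by move=> x _; rewrite lee_fin max_birkhoff_ge0.
  - exact/measurable_EFinP.
  - apply: emeasurable_funD; apply/measurable_EFinP => //.
    exact: (measurableT_comp (mM n) mf).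
  - move=> x _; rewrite -EFinD lee_fin ge_max addr_ge0 ?u0 ?max_birkhoff_ge0//=.
    by rewrite lerD2r /h lerBlDr lerDl.
rewrite ge0_integralD//.
- rewrite (@integral_invariant (EFin \o M n)); last 2 first.
  + exact/measurable_EFinP.
  + by move=> x; rewrite lee_fin max_birkhoff_ge0.
  by rewrite lte_add_pinfty.
- by move=> x _; rewrite lee_fin.
- exact/measurable_EFinP.
- by move=> x _; rewrite lee_fin max_birkhoff_ge0.
- by apply/measurable_EFinP; exact: (measurableT_comp (mM n) mf).
Qed.

Let E n := [set x | 0 < M n x].
Let mE n : measurable (E n).
Proof.
rewrite -[X in measurable X]setTI.
have -> : E n = M n @^-1` `]0, +oo[.
  by apply/seteqP; split => x; rewrite /E/= in_itv/= andbT.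
exact: mM.
Qed.

(** Where the maximum is positive it is reached by a nonempty sum, so that it
    is at most [h] plus the maximum at the image point; integrate and cancel
    the two maxima. *)
Let maximal_n n : (\int[mu]_(x in E n) (v x)%:E <= \int[mu]_x (u x)%:E)%E.
Proof.
case: n => [|n].
  rewrite (_ : E 0 = set0); last first.
    by apply/seteqP; split => x //=; rewrite /E/= /M/= ltxx.
  by rewrite integral_set0 integral_ge0// => x _; rewrite lee_fin.
have fM := intM n.+1.
have M0 : (0 <= \int[mu]_x (M n.+1 x)%:E)%E.
  by apply: integral_ge0 => x _; rewrite lee_fin max_birkhoff_ge0.
rewrite -(@leeD2lE _ (\int[mu]_x (M n.+1 x)%:E)%E); last first.
  by rewrite ge0_fin_numE.
rewrite (integral_mkcond (E n.+1)).
have mp : measurable_fun setT ((fun x => (v x)%:E) \_ (E n.+1)).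
  apply/(measurable_restrictT _ _).1 => //; apply/measurable_EFinP.
  exact: measurable_funTS.
have pE x : (((fun x => (v x)%:E) \_ (E n.+1)) x =
    ((v x) * \1_(E n.+1) x)%:E)%E.
  rewrite patchE indicE; case: ifPn => _; rewrite ?mulr1 ?mulr0//.
rewrite -ge0_integralD//; last 3 first.
- by move=> x _; rewrite lee_fin max_birkhoff_ge0.
- exact/measurable_EFinP.
- by move=> x _; rewrite pE lee_fin mulr_ge0.
apply: (@le_trans _ _ (\int[mu]_x ((M n (f x))%:E + (u x)%:E))%E).
  apply: ge0_le_integral => //.
  - move=> x _; rewrite pE -EFinD lee_fin addr_ge0 ?max_birkhoff_ge0//.
    by rewrite mulr_ge0.
  - by apply: emeasurable_funD => //; exact/measurable_EFinP.
  - apply: emeasurable_funD; apply/measurable_EFinP => //.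
    exact: (measurableT_comp (mM n) mf).
  - move=> x _; rewrite pE -!EFinD lee_fin.
    have [xE|xE] := pselect (E n.+1 x).
      rewrite indicE mem_set//= mulr1 /M/=.
      move: xE; rewrite /E/= /M/= lt_max ltxx/= => xE.
      rewrite max_r; last exact: ltW.
      by rewrite {1}/h addrAC subrK addrC.
    rewrite indicE memNset//= mulr0 addr0.
    move: xE => /negP; rewrite -leNgt => xE.
    rewrite (le_trans xE)// addr_ge0//.
    exact: max_birkhoff_ge0.
rewrite ge0_integralD//.
- rewrite (@integral_invariant (EFin \o M n)); last 2 first.
  + exact/measurable_EFinP.
  + by move=> x; rewrite lee_fin max_birkhoff_ge0.
  rewrite leeD2r//; apply: ge0_le_integral => //.
  + by move=> x _; rewrite lee_fin max_birkhoff_ge0.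
  + exact/measurable_EFinP.
  + exact/measurable_EFinP.
  + by move=> x _; rewrite lee_fin max_birkhoff_nd.
- by move=> x _; rewrite lee_fin max_birkhoff_ge0.
- by apply/measurable_EFinP; exact: (measurableT_comp (mM n) mf).
- by move=> x _; rewrite lee_fin.
- exact/measurable_EFinP.
Qed.

Lemma maximal_ergodic :
  {ae mu, forall x, exists k, 0 < birkhoff_sum h k x} ->
  (\int[mu]_x (v x)%:E <= \int[mu]_x (u x)%:E)%E.
Proof.
move=> aeS.
have ndE : nondecreasing_seq E.
  apply/nondecreasing_seqP => n; apply/subsetPset => x.
  by rewrite /E/= => /lt_le_trans; apply; exact: max_birkhoff_nd.
have cvE : (\int[mu]_(x in E n) (v x)%:E @[n --> \oo] -->
    \int[mu]_(x in \bigcup_n E n) (v x)%:E)%E.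
  apply: ge0_nondecreasing_set_cvg_integral => //.
  - by move=> n; exact/measurable_EFinP/measurable_funTS.
  - by move=> n x _; rewrite lee_fin.
have -> : (\int[mu]_x (v x)%:E =
    \int[mu]_(x in \bigcup_n E n) (v x)%:E)%E; last first.
  rewrite -(cvg_lim _ cvE)//; apply: lime_le; first exact: (cvgP _ cvE).
  exact: nearW.
rewrite [RHS]integral_mkcond; apply: ge0_ae_eq_integral => //.
- exact/measurable_EFinP.
- apply/(measurable_restrictT _ _).1 => //.
    exact: bigcup_measurable.
  exact/measurable_EFinP/measurable_funTS.
- by move=> x _; rewrite lee_fin.
- by move=> x _; rewrite patchE; case: ifP => // _; rewrite lee_fin.
- apply: filterS aeS => x [k kx] _.
  rewrite patchE mem_set//; exists k => //.
  by rewrite /E/=; exact: (lt_le_trans kx (max_birkhoff_ge _ _ _)).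
Qed.

End maximal.

Section ergodic.
Hypothesis erg : forall A : set T, measurable A -> f @^-1` A = A ->
  mu A = 0%E \/ mu A = 1%E.

Section upper.
Variables u v : T -> R.
Hypotheses (mu_ : measurable_fun setT u) (mv : measurable_fun setT v).
Hypotheses (u0 : forall x, 0 <= u x) (v0 : forall x, 0 <= v x).
Hypothesis ufin : (\int[mu]_x (u x)%:E < +oo)%E.
Hypothesis ltuv : (\int[mu]_x (u x)%:E < \int[mu]_x (v x)%:E)%E.
Let h x := u x - v x.

(** The points where the upper limit of the averages is positive; stated with
    a rational margin, the set is strictly invariant. *)
Let B := [set x | exists m, forall N, exists2 n, (N <= n)%N &
  n%:R / m.+1%:R < birkhoff_sum h n x].

Let mB : measurable B.
Proof.
have -> : B = \bigcup_m \bigcap_N \bigcup_n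
    [set x | (N <= n)%N /\ n%:R / m.+1%:R < birkhoff_sum h n x].
  apply/seteqP; split => x.
    move=> [m xm]; exists m => // N _; have [n ? ?] := xm N.
    by exists n.
  move=> [m _ xm]; exists m => N; have [n _ [? ?]] := xm N I.
  by exists n.
apply: bigcup_measurable => m _; apply: bigcap_measurable => // N _.
apply: bigcup_measurable => n _.
have [Nn|Nn] := leqP N n; last first.
  rewrite [X in measurable X](_ : _ = set0)//.
  by apply/seteqP; split => x // [].
rewrite [X in measurable X](_ : _ =
    birkhoff_sum h n @^-1` `]n%:R / m.+1%:R, +oo[); last first.
  by apply/seteqP; split => x/=; rewrite in_itv/= andbT// => -[].
rewrite -[X in measurable X]setTI.
by apply: measurable_birkhoff_sum => //; exact: measurable_funB.
Qed.

Let nlarge (c : R) (m : nat) : exists N, forall n, (N <= n)%N ->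
  n%:R / m.*2.+2%:R + c <= n%:R / m.+1%:R :> R.
Proof.
exists (Num.truncn (`|c| * m.*2.+2%:R)).+1 => n hn.
have m0 : 0 < m.*2.+2%:R :> R by [].
have e : m.+1%:R^-1 = 2 / m.*2.+2%:R :> R.
  rewrite -doubleS -muln2 natrM; field.
  by rewrite addrC natr1 pnatr_eq0.
have : `|c| * m.*2.+2%:R <= n%:R.
  rewrite (le_trans (ltW (truncnS_gt _)))// ler_nat//.
rewrite -ler_pdivlMr// => h1.
have h2 := ler_norm c.
rewrite e; move: h1 h2; move: (_^-1) (n%:R) => M k; lra.
Qed.

Let BfB : f @^-1` B = B.
Proof.
have im (m : nat) : m.*2.+2 = (m.*2.+1).+1 by [].
apply/seteqP; split => x.
- move=> [m xm]; exists m.*2.+1 => N.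
  have [N0 hN0] := nlarge (- h x + 1 / m.*2.+2%:R) m.
  have [n hn lt_n] := xm (maxn N N0).
  exists n.+1; first by rewrite (leq_trans _ (leqW hn))// leq_maxl.
  rewrite birkhoff_sumSl.
  have := hN0 n (leq_trans (leq_maxr _ _) hn).
  move: lt_n; rewrite -[n.+1]addn1 natrD mulrDl.
  move: (m.*2.+2%:R^-1) (m.+1%:R^-1) => a b; lra.
- move=> [m xm]; exists m.*2.+1 => N.
  have [N0 hN0] := nlarge (h x) m.
  have [n hn lt_n] := xm (maxn N N0).+1.
  case: n hn lt_n => // n; rewrite ltnS => hn.
  rewrite birkhoff_sumSl => lt_n.
  exists n; first by rewrite (leq_trans _ hn)// leq_maxl.
  have := hN0 n (leq_trans (leq_maxr _ _) hn).
  have : n%:R / m.+1%:R <= n.+1%:R / m.+1%:R :> R.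
    by rewrite ler_wpM2r// ?ler_nat// invr_ge0.
  move: lt_n; move: (m.*2.+2%:R^-1) (m.+1%:R^-1) => a b; lra.
Qed.

(** The exceptional set is invariant, hence null or conull, and the maximal
    inequality excludes the latter when [u] has smaller integral than [v]. *)
Lemma ae_birkhoff_sum_le : {ae mu, forall x, forall m, exists N, forall n,
  (N <= n)%N -> birkhoff_sum h n x <= n%:R / m.+1%:R}.
Proof.
have [B0|B1] := erg mB BfB.
  exists B; split => // x /existsNP[m] xm; exists m => N.
  apply: contrapT => noN; apply: xm; exists N => n Nn.
  by rewrite leNgt; apply/negP => ltn; apply: noN; exists n.
exfalso; move: ltuv; apply/negP; rewrite -leNgt.
apply: maximal_ergodic => //.
exists (~` B); split.
- exact: measurableC.
- by rewrite probability_setC// B1 subee.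
- move=> x /= xS xB; apply: xS; have [m /(_ 0) [n _ lt_n]] := xB.
  exists n; apply: le_lt_trans lt_n.
  by rewrite divr_ge0.
Qed.

End upper.

(** Both bounds come from [ae_birkhoff_sum_le], applied to [g] and to its
    integral shifted by a small constant. *)
Theorem birkhoff (g : T -> R) : measurable_fun setT g ->
  (forall x, 0 <= g x) -> (\int[mu]_x (g x)%:E < +oo)%E ->
  {ae mu, forall x, n%:R^-1 * birkhoff_sum g n x @[n --> \oo] -->
    fine (\int[mu]_x (g x)%:E)%E}.
Proof.
move=> mg g0 gfin.
have ig0 : (0 <= \int[mu]_x (g x)%:E)%E.
  by apply: integral_ge0 => x _; rewrite lee_fin.
have /fineK cE : (\int[mu]_x (g x)%:E)%E \is a fin_num by rewrite ge0_fin_numE.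
set c := fine _ in cE *.
have c0 : 0 <= c by rewrite -lee_fin cE.
have intcst (a : R) : (\int[mu]_x a%:E = a%:E)%E.
  by rewrite integral_cst//= probability_setT mule1.
have ub (m : nat) : {ae mu, forall x, forall k, exists N, forall n, (N <= n)%N ->
    birkhoff_sum (fun x => g x - (c + m.+1%:R^-1)) n x <= n%:R / k.+1%:R}.
  apply: (@ae_birkhoff_sum_le g (cst (c + m.+1%:R^-1))) => //.
  - by move=> x; rewrite addr_ge0// invr_ge0.
  - by rewrite intcst -cE lte_fin ltrDl invr_gt0.
have lb (m : nat) : {ae mu, forall x, forall k, exists N, forall n, (N <= n)%N ->
    birkhoff_sum (fun x => c - (g x + m.+1%:R^-1)) n x <= n%:R / k.+1%:R}.
  apply: (@ae_birkhoff_sum_le (cst c) (fun x => g x + m.+1%:R^-1)) => //.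
  - by apply: measurable_funD.
  - by move=> x; rewrite addr_ge0// invr_ge0.
  - by rewrite intcst ltry.
  - have -> : (\int[mu]_x (g x + m.+1%:R^-1)%:E = (c + m.+1%:R^-1)%:E)%E.
      under eq_integral do rewrite EFinD.
      rewrite ge0_integralD//; first by rewrite intcst -cE.
      + by move=> x _; rewrite lee_fin.
      + exact/measurable_EFinP.
    by rewrite (intcst c) lte_fin ltrDl invr_gt0.
have sumB (a b : T -> R) n x : birkhoff_sum (fun x => a x - b x) n x =
    birkhoff_sum a n x - birkhoff_sum b n x by rewrite /birkhoff_sum sumrB.
have sumD (a b : T -> R) n x : birkhoff_sum (fun x => a x + b x) n x =
    birkhoff_sum a n x + birkhoff_sum b n x by rewrite /birkhoff_sum big_split.
have sumC (a : R) n x : birkhoff_sum (fun=> a) n x = n%:R * a.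
  by rewrite /birkhoff_sum sumr_const card_ord mulr_natl.
have := ae_foralln ub; have := ae_foralln lb; apply: filterS2 => x lbx ubx.
apply/cvgrPdist_le => e e0.
have [m me] : exists m : nat, m.+1%:R^-1 <= e / 2.
  exists (Num.truncn (e / 2)^-1); rewrite -[leRHS]invrK lef_pV2 ?posrE//.
    exact/ltW/truncnS_gt.
  by rewrite invr_gt0 divr_gt0.
have [N1 h1] := lbx m m; have [N2 h2] := ubx m m.
exists (maxn N1 N2).+1 => // n /= hn.
have n0 : 0 < n%:R :> R by rewrite ltr0n (leq_trans _ hn).
have {h1} := h1 n (leq_trans (leq_maxl _ _) (ltnW hn)).
have {h2} := h2 n (leq_trans (leq_maxr _ _) (ltnW hn)).
rewrite !(sumB, sumD, sumC) => h2 h1.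
have := ler_wpM2l (ltW n0) me.
move: h1 h2; rewrite ler_norml; set A := birkhoff_sum g n x.
have -> : c - n%:R^-1 * A = n%:R^-1 * (n%:R * c - A).
  by rewrite mulrBr mulKf// gt_eqF.
move: (m.+1%:R^-1) => q h1 h2 h3.
rewrite -(ler_pM2l n0) -[X in _ && X](ler_pM2l n0) mulVKf ?gt_eqF//.
by apply/andP; split; lra.
Qed.

End ergodic.
End birkhoff.

(** * Integral inequalities for information functions *)

Section integral_tools.
Context d (T : measurableType d) (R : realType) (mu : probability T R).
Implicit Types u w : T -> R.

Lemma ge0_integralD_EFin u w : measurable_fun setT u -> measurable_fun setT w ->
  (forall x, 0 <= u x) -> (forall x, 0 <= w x) ->
  (\int[mu]_x (u x + w x)%:E = \int[mu]_x (u x)%:E + \int[mu]_x (w x)%:E)%E.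
Proof.
move=> mu_ mw u0 w0; under eq_integral do rewrite EFinD.
rewrite ge0_integralD//; try by move=> x _; rewrite lee_fin.
- exact/measurable_EFinP.
- exact/measurable_EFinP.
Qed.

Lemma probability_inhabited : exists x : T, True.
Proof.
apply: contrapT => no; have := @probability_setT _ _ _ mu.
rewrite (_ : setT = set0) ?measure0; last first.
  by apply/seteqP; split => // x _; apply: no; exists x.
by move=> [] /eqP; rewrite eq_sym oner_eq0.
Qed.

Lemma integral_cst_probability (a : R) : (\int[mu]_x a%:E = a%:E)%E.
Proof. by rewrite integral_cst//= probability_setT mule1. Qed.

Lemma ge0_integralZ_EFin u (a : R) : measurable_fun setT u ->
  (forall x, 0 <= u x) -> 0 <= a ->
  (\int[mu]_x (a * u x)%:E = a%:E * \int[mu]_x (u x)%:E)%E.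
Proof.
move=> mu_ u0 a0; under eq_integral do rewrite EFinM.
rewrite ge0_integralZl//.
- exact/measurable_EFinP.
- by move=> x _; rewrite lee_fin.
Qed.

Lemma ae_le_integral_EFin u w : measurable_fun setT u -> measurable_fun setT w ->
  (forall x, 0 <= u x) -> (forall x, 0 <= w x) ->
  {ae mu, forall x, u x <= w x} ->
  (\int[mu]_x (u x)%:E <= \int[mu]_x (w x)%:E)%E.
Proof.
move=> mu_ mw u0 w0 uw; apply: ae_ge0_le_integral => //.
- by move=> x _; rewrite lee_fin.
- exact/measurable_EFinP.
- by move=> x _; rewrite lee_fin.
- exact/measurable_EFinP.
- by apply: filterS uw => x ux _; rewrite lee_fin.
Qed.

Lemma le_integral_EFin u w : measurable_fun setT u -> measurable_fun setT w ->
  (forall x, 0 <= u x) -> (forall x, u x <= w x) ->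
  (\int[mu]_x (u x)%:E <= \int[mu]_x (w x)%:E)%E.
Proof.
move=> mu_ mw u0 uw; apply: ae_le_integral_EFin => //.
- by move=> x; exact: (le_trans (u0 x)).
- exact: aeW.
Qed.

Lemma integral_EFin_ge0 u : (forall x, 0 <= u x) ->
  (0 <= \int[mu]_x (u x)%:E)%E.
Proof. by move=> u0; apply: integral_ge0 => x _; rewrite lee_fin. Qed.

Lemma ge0_integral_sum_EFin n (u : nat -> T -> R) :
  (forall i, measurable_fun setT (u i)) -> (forall i x, 0 <= u i x) ->
  (\int[mu]_x (\sum_(i < n) u i x)%:E = \sum_(i < n) \int[mu]_x (u i x)%:E)%E.
Proof.
move=> mu_ u0; elim: n => [|n ih].
  by rewrite big_ord0; under eq_integral do rewrite big_ord0; exact: integral0.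
rewrite big_ord_recr/= -ih -ge0_integralD_EFin//.
- by apply: eq_integral => x _; rewrite big_ord_recr.
- exact: measurable_sum.
- by move=> x; apply: sumr_ge0.
Qed.

(** Markov's inequality bounds the measures of the exceptional sets by a
    geometric series; the Borel-Cantelli lemma concludes. *)
Lemma ae_eventually_lt (X : nat -> T -> R) (a : nat -> R) (q : R) :
  (forall n, measurable_fun setT (X n)) -> (forall n x, 0 <= X n x) ->
  (forall n, 0 < a n) -> 0 < q < 1 ->
  (forall n, (\int[mu]_x (X n x)%:E <= (a n * q ^+ n)%:E)%E) ->
  {ae mu, forall x, exists N, forall n, (N <= n)%N -> X n x < a n}.
Proof.
move=> mX X0 a0 /andP[q0 q1] Xq.
pose F n := [set x | a n <= X n x].
have mF n : measurable (F n).
  rewrite [X in measurable X](_ : _ = X n @^-1` `[a n, +oo[); last first.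
    by apply/seteqP; split => x/=; rewrite /F/= in_itv/= andbT.
  by rewrite -[X in measurable X]setTI; exact: mX.
have Fq n : (mu (F n) <= (q ^+ n)%:E)%E.
  have : ((a n)%:E * mu (F n) <= (a n * q ^+ n)%:E)%E.
    apply: le_trans (Xq n).
    rewrite -integral_cst//.
    apply: (@le_trans _ _ (\int[mu]_(x in F n) (X n x)%:E)%E).
      apply: ge0_le_integral => //.
      - by move=> x _; rewrite lee_fin ltW.
      - exact/measurable_EFinP/measurable_funTS.
    apply: ge0_subset_integral => //.
    - exact/measurable_EFinP.
    - by move=> x _; rewrite lee_fin.
  by rewrite EFinM lee_pmul2l// lte_fin.
exists (lim_sup_set F); split.
- apply: bigcap_measurable => // n _; apply: bigcup_measurable => k _.
  exact: mF.
- apply: lim_sup_set_cvg0 => //.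
  apply: (@le_lt_trans _ _ (\sum_(n <oo) (geometric 1 q n)%:E)%E).
    by apply: lee_nneseries => // n _ /=; rewrite mul1r.
  apply: (@le_lt_trans _ _ ((1 - q)^-1)%:E); last exact: ltry.
  apply: lime_le.
    by apply: is_cvg_nneseries => n _ _; rewrite lee_fin/= mul1r exprn_ge0 ?ltW.
  apply: nearW => n; rewrite sumEFin lee_fin.
  have -> : \sum_(0 <= i < n) geometric 1 q i = series (geometric 1 q) n by [].
  rewrite geometric_seriesE ?lt_eqF//= mul1r ler_pdivrMr ?subr_gt0//.
  by rewrite mulVf ?gt_eqF ?subr_gt0// gerBl exprn_ge0 ?ltW.
- move=> x /= nx n _.
  apply: contrapT => h; apply: nx; exists n => k nk.
  by rewrite ltNge; apply/negP => akX; apply: h; exists k.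
Qed.

(** Gibbs' inequality: [w] and [u] play the part of minus the logarithms of
    two conditional probabilities, and [1 + t <= expR t]. *)
Lemma gibbs u w : measurable_fun setT u -> measurable_fun setT w ->
  (forall x, 0 <= u x) -> (forall x, 0 <= w x) ->
  (\int[mu]_x (expR (w x - u x))%:E <= 1)%E ->
  (\int[mu]_x (w x)%:E <= \int[mu]_x (u x)%:E)%E.
Proof.
move=> mu_ mw u0 w0 h.
have mB : measurable_fun setT (fun x => expR (w x - u x)).
  by apply: measurableT_comp => //; exact: measurable_funB.
rewrite -(@leeD2lE _ 1%:E)//.
rewrite -[X in (X + _ <= _)%E]integral_cst_probability.
rewrite -ge0_integralD_EFin//.
apply: (@le_trans _ _ (\int[mu]_x (expR (w x - u x) + u x)%:E)%E).
  apply: le_integral_EFin => //.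
  - exact: measurable_funD.
  - exact: measurable_funD.
  - by move=> x; rewrite addr_ge0.
  - move=> x; have := expR_ge1Dx (w x - u x); lra.
by rewrite ge0_integralD_EFin ?leeD2r// => x; exact: expR_ge0.
Qed.

(** Borel-Cantelli for the sets where [expR (W n - U n)] exceeds
    [expR (n / m.+1)]: their measures decay exponentially. *)
Lemma ae_subexponential (U W : nat -> T -> R) :
  (forall n, measurable_fun setT (U n)) -> (forall n, measurable_fun setT (W n)) ->
  (forall n, (\int[mu]_x (expR (W n x - U n x))%:E <= 1)%E) ->
  {ae mu, forall x, forall m, exists N, forall n, (N <= n)%N ->
    W n x - U n x <= n%:R / m.+1%:R}.
Proof.
move=> mU mW h; apply: ae_foralln => m.
have q01 : 0 < expR (- (m.+1%:R : R)^-1) < 1.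
  by rewrite expR_gt0 expR_lt1 oppr_lt0 invr_gt0/=.
have : {ae mu, forall x, exists N, forall n, (N <= n)%N ->
    expR (W n x - U n x) < expR (n%:R / m.+1%:R)}.
  apply: ae_eventually_lt q01 _ => n //.
  - by apply: measurableT_comp => //; exact: measurable_funB.
  - by rewrite -expRM_natl -expRD mulrN addrN expR0.
by apply: filterS => x [N xN]; exists N => n /xN; rewrite ltr_expR => /ltW.
Qed.

(** The convex function [expR (- t) - 1 + t] vanishes to second order only, so
    that it dominates the absolute value up to a quadratic error in the free
    slope [s]: take the tangent lines at [- ln (1 - s)] and [- ln (1 + s)]. *)
Lemma ler_norm_relative_entropy (s t : R) : 0 <= s < 1 ->
  s * `|t| <= expR (- t) - 1 + t + s ^+ 2.
Proof.
move=> /andP[s0 s1].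
have tangent (z : R) : 0 < z -> z * (1 - t - ln z) <= expR (- t).
  move=> z0; have := expR_ge1Dx (- t - ln z).
  rewrite expRB lnK ?posrE// ler_pdivlMr// mulrC.
  by rewrite addrA.
have [t0|t0] := ger0P t.
- have := tangent (1 - s); rewrite subr_gt0 => /(_ s1).
  have : ln (1 - s) <= - s by apply: le_ln1Dx; rewrite ltrN2.
  move=> h1 h2.
  have : (1 - s) * (1 - t - ln (1 - s)) >= (1 - s) * (1 - t + s).
    by apply: ler_wpM2l; lra.
  nra.
- have z0 : 0 < 1 + s by lra.
  have := tangent (1 + s) z0.
  have : ln (1 + s) <= s by apply: le_ln1Dx; lra.
  move=> h1 h2.
  have : (1 + s) * (1 - t - ln (1 + s)) >= (1 + s) * (1 - t - s).
    by apply: ler_wpM2l; lra.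
  nra.
Qed.

(** If two information functions satisfy Gibbs' inequality and their integrals
    differ by at most [8^-1 ^+ n], the nonnegative function
    [expR (W - U) - 1 + (U - W)] has integral at most [8^-1 ^+ n]; hence it is
    eventually below [4^-1 ^+ n], and the slope [2^-1 ^+ n] in
    [ler_norm_relative_entropy] bounds the difference itself. *)
Lemma ae_cvg_entropy_gap (U W : nat -> T -> R) :
  (forall n, measurable_fun setT (U n)) -> (forall n, measurable_fun setT (W n)) ->
  (forall n x, 0 <= U n x) -> (forall n x, 0 <= W n x) ->
  (forall n, (\int[mu]_x (U n x)%:E < +oo)%E) ->
  (forall n, (\int[mu]_x (expR (W n x - U n x))%:E <= 1)%E) ->
  (forall n, (\int[mu]_x (U n x)%:E <=
              \int[mu]_x (W n x)%:E + ((8^-1) ^+ n)%:E)%E) ->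
  {ae mu, forall x, exists N, forall n, (N <= n)%N ->
    `|U n x - W n x| <= 2 * (2^-1) ^+ n}.
Proof.
move=> mU mW U0 W0 Ufin UW gap.
pose psi n x := expR (W n x - U n x) - 1 + (U n x - W n x).
have mE n : measurable_fun setT (fun x => expR (W n x - U n x)).
  by apply: measurableT_comp => //; exact: measurable_funB.
have mpsi n : measurable_fun setT (psi n).
  by apply: measurable_funD; [exact: measurable_funB|exact: measurable_funB].
have psi0 n x : 0 <= psi n x.
  by have := expR_ge1Dx (W n x - U n x); rewrite /psi; lra.
have Wfin n : (\int[mu]_x (W n x)%:E)%E \is a fin_num.
  rewrite ge0_fin_numE ?integral_EFin_ge0//.
  by apply: le_lt_trans (Ufin n); exact: gibbs.
have ipsi n : (\int[mu]_x (psi n x)%:E <= ((4^-1) ^+ n * (2^-1) ^+ n)%:E)%E.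
  have e : (\int[mu]_x (psi n x)%:E + (1%:E + \int[mu]_x (W n x)%:E) =
      \int[mu]_x (expR (W n x - U n x))%:E + \int[mu]_x (U n x)%:E)%E.
    rewrite -[X in (_ + (X + _))%E]integral_cst_probability.
    rewrite -!ge0_integralD_EFin//.
    - by apply: eq_integral => x _; congr (_%:E); rewrite /psi; lra.
    all: try by move=> x; rewrite ?addr_ge0 ?expR_ge0.
    exact: measurable_funD.
  rewrite -exprMn -invfM (_ : 4 * 2 = 8 :> R); last by rewrite -natrM.
  have Wf : (1 + \int[mu]_x (W n x)%:E)%E \is a fin_num.
    by rewrite fin_numD Wfin.
  rewrite -(leeD2rE _ _ Wf) e.
  apply: le_trans (leeD (UW n) (gap n)) _.
  by rewrite addeA addeC.
have : {ae mu, forall x, exists N, forall n, (N <= n)%N ->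
    psi n x < (4^-1) ^+ n}.
  by apply: ae_eventually_lt ipsi => //; lra.
apply: filterS => x [N hN]; exists N.+1 => n hn.
have q01 : 0 <= (2^-1 : R) ^+ n < 1.
  rewrite exprn_ge0//= exprn_ilt1//; last by lra.
  by case: n hn.
have := ler_norm_relative_entropy (U n x - W n x) q01.
rewrite opprB -/(psi n x) => h1.
have h2 := hN n (ltnW hn).
have q0 : 0 < 2^-1 ^+ n :> R by rewrite exprn_gt0.
rewrite -(ler_pM2l q0) (le_trans h1)//.
have -> : 2^-1 ^+ n * (2 * 2^-1 ^+ n) = 4^-1 ^+ n + (2^-1 ^+ n) ^+ 2 :> R.
  have -> : 4^-1 = 2^-1 * 2^-1 :> R by rewrite -invfM -natrM.
  by rewrite exprMn; ring.
by rewrite lerD2r ltW.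
Qed.

End integral_tools.

(** Integrate the last factor first: [step] is stated at the time [n] of that
    factor, from which the earlier ones are seen through [iter n g]. *)
Lemma orbit_product_integral_le d (T : measurableType d) (R : realType)
    (mu : probability T R) (f g : T -> T) (phi : nat -> T -> R) N :
  measurable_fun setT f -> measurable_fun setT g -> cancel f g ->
  (forall A : set T, measurable A -> mu (f @^-1` A) = mu A) ->
  (forall i, measurable_fun setT (phi i)) -> (forall i x, 0 <= phi i x) ->
  (forall n (G : T -> R), (n < N)%N -> measurable_fun setT G ->
    (forall x, 0 <= G x) ->
    (forall x, G x = \prod_(i < n) phi i (iter i f (iter n g x))) ->
    (\int[mu]_x (G x * phi n x)%:E <= \int[mu]_x (G x)%:E)%E) ->
  (\int[mu]_x (\prod_(i < N) phi i (iter i f x))%:E <= 1)%E.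
Proof.
move=> mf mg fK inv mphi phi0 step.
pose P n x := \prod_(i < n) phi i (iter i f x).
have mP n : measurable_fun setT (P n).
  apply: measurable_prod => i _.
  by apply: (measurableT_comp (mphi i)); exact: measurable_iter.
have P0 n x : 0 <= P n x by exact: prodr_ge0.
suff main n : (n <= N)%N -> (\int[mu]_x (P n x)%:E <= 1)%E by exact: main.
elim: n => [|n ih] nN.
  under eq_integral do rewrite /P big_ord0.
  by rewrite integral_cst_probability.
apply: le_trans (ih (ltnW nN)); pose G x := P n (iter n g x).
have mG : measurable_fun setT G.
  by apply: (measurableT_comp (mP n)); exact: measurable_iter.
have G0 x : 0 <= G x by exact: P0.
have GE x : P n x = G (iter n f x) by rewrite /G (iter_cancel n fK).
have -> : (\int[mu]_x (P n.+1 x)%:E = \int[mu]_x (G x * phi n x)%:E)%E.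
  rewrite -(@integral_iter _ _ _ mu f mf inv (fun x => (G x * phi n x)%:E) n).
  - by apply: eq_integral => x _; rewrite /P big_ord_recr/= -/(P n x) GE.
  - by apply/measurable_EFinP; exact: measurable_funM.
  - by move=> x; rewrite lee_fin mulr_ge0.
have -> : (\int[mu]_x (P n x)%:E = \int[mu]_x (G x)%:E)%E.
  rewrite -(@integral_iter _ _ _ mu f mf inv (fun x => (G x)%:E) n).
  - by apply: eq_integral => x _; rewrite GE.
  - exact/measurable_EFinP.
  - by move=> x; rewrite lee_fin.
exact: step.
Qed.

(** * Averages of a triangular array along an orbit *)

Lemma cvg_invn (R : realType) : n%:R^-1 @[n --> \oo] --> (0 : R).
Proof.
rewrite -(cvg_shiftn 1)/=.
by under eq_fun do rewrite addn1; exact: cvg_harmonic.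
Qed.

Lemma cvg_sum_ord (R : realType) n (u : nat -> nat -> R) (c : nat -> R) :
  (forall i, (i < n)%N -> u i m @[m --> \oo] --> c i) ->
  \sum_(i < n) u i m @[m --> \oo] --> \sum_(i < n) c i.
Proof.
elim: n => [|n ih] uc.
  by rewrite big_ord0; under eq_fun do rewrite big_ord0; exact: cvg_cst.
rewrite big_ord_recr/=; under eq_fun do rewrite big_ord_recr/=.
by apply: cvgD; [apply: ih => i /ltnW; exact: uc|exact: uc].
Qed.

Lemma ae_fatou d (T : measurableType d) (R : realType) (mu : probability T R)
    (F : nat -> T -> R) (G : T -> R) (c : \bar R) :
  (forall m, measurable_fun setT (F m)) -> (forall m x, 0 <= F m x) ->
  measurable_fun setT G -> (forall x, 0 <= G x) ->
  {ae mu, forall x, F m x @[m --> \oo] --> G x} ->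
  (forall m, (\int[mu]_x (F m x)%:E <= c)%E) -> (\int[mu]_x (G x)%:E <= c)%E.
Proof.
move=> mF F0 mG G0 FG Fc.
have -> : (\int[mu]_x (G x)%:E =
    \int[mu]_x limn_einf (fun m => (F m x)%:E))%E.
  apply: ge0_ae_eq_integral => //.
  - exact/measurable_EFinP.
  - rewrite (_ : (fun x => _) =
        (fun x => - limn_esup (fun m => - (F m x)%:E))%E); last first.
      by apply/funext => x; rewrite limn_esupN oppeK.
    apply: measurableT_comp => //; apply: measurable_fun_limn_esup => m.
    by apply: measurableT_comp => //; exact/measurable_EFinP.
  - by move=> x _; rewrite lee_fin.
  - move=> x _; rewrite limn_einf_lim; apply: lime_ge; first exact: is_cvg_einfs.
    apply: nearW => m; apply: le_ereal_inf_tmp => _ [k _ <-].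
    by rewrite lee_fin.
  - apply: filterS FG => x Fx _.
    have /cvg_limn_einf_sup[-> _//] : (F m x)%:E @[m --> \oo] --> (G x)%:E.
    by apply: cvg_EFin => //; exact: nearW.
have := @fatou _ _ _ mu setT measurableT (fun m x => (F m x)%:E).
move=> /(_ _ _)/le_trans; apply.
- by move=> m; exact/measurable_EFinP.
- by move=> m x _; rewrite lee_fin.
rewrite limn_einf_lim; apply: lime_le; first exact: is_cvg_einfs.
apply: nearW => m; apply: le_trans (Fc m).
by apply: ereal_inf_lbound; exists m => /=.
Qed.

Section triangular_array.
Context d (T : measurableType d) (R : realType) (mu : probability T R).
Variable f : T -> T.
Hypothesis mf : measurable_fun setT f.
Hypothesis inv : forall A : set T, measurable A -> mu (f @^-1` A) = mu A.
Hypothesis erg : forall A : set T, measurable A -> f @^-1` A = A ->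
  mu A = 0%E \/ mu A = 1%E.

(** [g s t] stands for the information of one step of a process, given its
    past over a time [s] and its future over a time [t].  The hypothesis
    [chain] compares the information of [n] steps given longer windows with
    that given shorter ones, and is what the convergence rests on. *)
Variable g : nat -> nat -> T -> R.
Hypothesis mg : forall s t, measurable_fun setT (g s t).
Hypothesis g0 : forall s t x, 0 <= g s t x.
Hypothesis g00 : (\int[mu]_x (g 0 0 x)%:E < +oo)%E.
Hypothesis chain : forall n S U (s t : nat -> nat),
  (forall i, (i < n)%N -> (s i <= S + i)%N /\ (t i <= U + (n.-1 - i))%N) ->
  (\int[mu]_x (expR (\sum_(i < n) g (S + i)%N (U + (n.-1 - i))%N (iter i f x)
                     - \sum_(i < n) g (s i) (t i) (iter i f x)))%:E <= 1)%E.

Definition array_sum n x := \sum_(i < n) g i (n - i)%N (iter i f x).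

Let mgi s t i : measurable_fun setT (fun x => g s t (iter i f x)).
Proof. by apply: measurableT_comp => //; exact: measurable_iter. Qed.

Let msum n (s t : nat -> nat) :
  measurable_fun setT (fun x => \sum_(i < n) g (s i) (t i) (iter i f x)).
Proof. exact: measurable_sum. Qed.

Let chain1 S U s t : (s <= S)%N -> (t <= U)%N ->
  (\int[mu]_x (expR (g S U x - g s t x))%:E <= 1)%E.
Proof.
move=> sS tU.
have := @chain 1 S U (fun=> s) (fun=> t) _.
under eq_integral do rewrite !big_ord1/= subn0 !addn0.
by apply => -[|//] _; rewrite !addn0.
Qed.

Let chainT n (s t : nat -> nat) :
  (forall i, (i < n)%N -> (s i <= i)%N /\ (t i <= n - i)%N) ->
  (\int[mu]_x (expR (array_sum n x
      - \sum_(i < n) g (s i) (t i) (iter i f x)))%:E <= 1)%E.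
Proof.
move=> st; have := @chain n 0 1 s t _.
have E x : \sum_(i < n) g (0 + i)%N (1 + (n.-1 - i))%N (iter i f x) =
    array_sum n x.
  apply: eq_bigr => -[i ni] _ /=.
  have -> : (1 + (n.-1 - i) = n - i)%N by lia.
  by [].
under eq_integral do rewrite E.
by apply => i ni; have [? ?] := st i ni; split; lia.
Qed.

Definition array_entropy s t : \bar R := (\int[mu]_x (g s t x)%:E)%E.
Local Notation H := array_entropy.

Let H_ge0 s t : (0 <= H s t)%E. Proof. exact: integral_EFin_ge0. Qed.

Let H_le s t S U : (s <= S)%N -> (t <= U)%N -> (H S U <= H s t)%E.
Proof. by move=> sS tU; apply: gibbs => //; exact: chain1. Qed.

Let H_fin s t : H s t \is a fin_num.
Proof.
by rewrite ge0_fin_numE// (le_lt_trans _ g00)//; exact: H_le.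
Qed.

Let h j := fine (H j j).
Let hE j : H j j = (h j)%:E. Proof. by rewrite fineK. Qed.
Let h_ge0 j : 0 <= h j. Proof. by rewrite -lee_fin -hE. Qed.
Let h_ni i j : (i <= j)%N -> h j <= h i.
Proof. by move=> ij; rewrite -lee_fin -!hE; exact: H_le. Qed.

Definition array_rate : R := inf (range h).
Local Notation b := array_rate.

Let has_inf_h : has_inf (range h).
Proof.
split; first by exists (h 0%N); exists 0%N.
by exists 0 => _ [j _ <-].
Qed.

Let b_le j : b <= h j.
Proof. by apply: ge_inf; [case: has_inf_h|exists j]. Qed.

Let b_lt e : 0 < e -> exists j, h j < b + e.
Proof.
by move=> /(inf_adherent) /(_ has_inf_h) [_ [j _ <-] ?]; exists j.
Qed.

Let b_leH s t : (b%:E <= H s t)%E.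
Proof.
apply: (@le_trans _ _ (H (maxn s t) (maxn s t))).
  by rewrite hE lee_fin.
by apply: H_le; rewrite ?leq_maxl ?leq_maxr.
Qed.

(** The constant window [j] fits only away from both ends of the orbit; near
    the ends the empty window is used. *)
Let win (n j i : nat) := if (j <= i)%N && (i + j <= n)%N then j else 0%N.

Let le_win n j : (j <= n)%N -> forall x,
  \sum_(i < n) g (win n j i) (win n j i) (iter i f x) <=
  birkhoff_sum f (g j j) n x + birkhoff_sum f (g 0 0) j x +
  (birkhoff_sum f (g 0 0) n x - birkhoff_sum f (g 0 0) (n - j) x).
Proof.
move=> jn x.
have -> : birkhoff_sum f (g 0 0) n x - birkhoff_sum f (g 0 0) (n - j) x =
    \sum_(i < n) (if (n - j <= i)%N then g 0 0 (iter i f x) else 0).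
  rewrite /birkhoff_sum (@big_ord_widen _ _ _ (n - j)%N n (fun i => g 0 0 (iter i f x)))//.
  rewrite [X in _ - X]big_mkcond/= -sumrB; apply: eq_bigr => i _.
  rewrite [(n - j <= i)%N]leqNgt.
  by case: (i < n - j)%N; rewrite ?subrr ?subr0.
  exact: leq_subr.
have -> : birkhoff_sum f (g 0 0) j x =
    \sum_(i < n) (if (i < j)%N then g 0 0 (iter i f x) else 0).
  rewrite /birkhoff_sum (@big_ord_widen _ _ _ j n (fun i => g 0 0 (iter i f x)))//.
  by rewrite big_mkcond.
rewrite /birkhoff_sum -!big_split/=; apply: ler_sum => i _.
have ge0 (c : bool) : 0 <= (if c then g 0 0 (iter i f x) else 0).
  by case: c.
rewrite /win; case: ifP => [_|].
  by rewrite -addrA lerDl addr_ge0.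
move/negbT; rewrite negb_and -!ltnNge => /orP[->|nij].
  by rewrite addrAC lerDr addr_ge0.
by rewrite (_ : (n - j <= i)%N) ?lerDr ?addr_ge0//; lia.
Qed.

Let win_chain n j i : (i < n)%N -> (win n j i <= i)%N /\ (win n j i <= n - i)%N.
Proof. by rewrite /win; case: ifP => //; lia. Qed.

Let cvg_birkhoff_shift (u : T -> R) (c : R) j x :
  n%:R^-1 * birkhoff_sum f u n x @[n --> \oo] --> c ->
  n%:R^-1 * birkhoff_sum f u (n - j) x @[n --> \oo] --> c.
Proof.
move=> h1; rewrite -(cvg_shiftn j)/=.
have h2 : (n + j)%:R^-1 @[n --> \oo] --> (0 : R).
  by have := @cvg_invn R; rewrite -(cvg_shiftn j).
have : (1 - j%:R * (n + j)%:R^-1) * (n%:R^-1 * birkhoff_sum f u n x)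
    @[n --> \oo] --> (1 - j%:R * 0) * c.
  apply: cvgM h1; apply: cvgB; first exact: cvg_cst.
  by apply: cvgM h2; exact: cvg_cst.
rewrite mulr0 subr0 mul1r; apply: cvg_trans; apply: near_eq_cvg.
exists 1%N => // n /= n0; rewrite addnK mulrA; congr (_ * _).
have nj : (n + j)%:R != 0 :> R by rewrite pnatr_eq0; lia.
have nn : n%:R != 0 :> R by rewrite pnatr_eq0; lia.
by rewrite natrD in nj *; field; rewrite nj nn.
Qed.

(** By [chain] the sum is at most that of the constant windows [j], up to
    a subexponential error, and Birkhoff's theorem applies to [g j j]. *)
Lemma ae_array_sum_le : {ae mu, forall x, forall e, 0 < e ->
  exists N, forall n, (N <= n)%N -> n%:R^-1 * array_sum n x <= b + e}.
Proof.
have sub j := ae_subexponential (fun n => msum n (win n j) (win n j))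
  (fun n => msum n id (fun i => n - i)%N)
  (fun n => chainT (@win_chain n j)).
have bh j : {ae mu, forall x, n%:R^-1 * birkhoff_sum f (g j j) n x
    @[n --> \oo] --> h j}.
  by apply: birkhoff => //; rewrite -/(H j j) hE ltry.
have := ae_foralln sub; have := ae_foralln bh.
apply: filterS2 => x {}bh {}sub e e0.
have [j hj] := b_lt (divr_gt0 e0 (ltr0n _ 3)).
pose V n := n%:R^-1 * birkhoff_sum f (g j j) n x +
  n%:R^-1 * birkhoff_sum f (g 0 0) j x +
  (n%:R^-1 * birkhoff_sum f (g 0 0) n x -
   n%:R^-1 * birkhoff_sum f (g 0 0) (n - j) x).
have cV : V n @[n --> \oo] --> h j + 0 * birkhoff_sum f (g 0 0) j x +
    (h 0%N - h 0%N).
  apply: cvgD; [apply: cvgD; [exact: bh|]|apply: cvgB; [exact: bh|]].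
    apply: cvgM; last exact: cvg_cst.
    exact: cvg_invn.
  exact: cvg_birkhoff_shift.
have e3 : 0 < e / 3 by rewrite divr_gt0.
have /cvgrPdist_le/(_ _ e3) [N1 _ hN1] := cV.
have [m me] : exists m : nat, m.+1%:R^-1 <= e / 3.
  exists (Num.truncn (e / 3)^-1); rewrite -[leRHS]invrK lef_pV2 ?posrE//.
    exact/ltW/truncnS_gt.
  by rewrite invr_gt0.
have [N2 hN2] := sub j m.
exists (maxn j (maxn N1 N2)).+1 => n.
rewrite gtn_max gtn_max => /andP[jn /andP[/ltnW/hN1 /= h1 /ltnW/hN2 h2]].
have n0 : 0 < n%:R :> R by rewrite ltr0n (leq_trans _ jn).
move: h1; rewrite mul0r addr0 subrr addr0 => h1.
have : array_sum n x <= n%:R * V n + n%:R / m.+1%:R.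
  rewrite -lerBlDl (le_trans _ h2)// lerD2l lerN2 (le_trans (le_win (ltnW jn) x))//.
  by rewrite /V -!mulrDr -mulrBr -mulrDr mulVKf ?gt_eqF.
rewrite -mulrDr mulrC -ler_pdivrMr// mulrC => /le_trans; apply.
move: h1; rewrite ler_norml => /andP[h1 _].
by move: (V n) (m.+1%:R^-1) h1 me => v q h1 me; lra.
Qed.

(** Windows whose entropies approach the rate at the speed that
    [ae_cvg_entropy_gap] asks for. *)
Let window_choice : exists l : nat -> nat,
  (forall m, (l m <= l m.+1)%N) /\ (forall m, h (l m) <= b + 8^-1 ^+ m).
Proof.
have /choice[l0 hl0] m : exists j, h j < b + 8^-1 ^+ m.
  by apply: b_lt; rewrite exprn_gt0.
exists (fun m => \sum_(i < m.+1) l0 i)%N; split=> m.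
  by rewrite [leqRHS]big_ord_recr/= leq_addr.
rewrite (le_trans _ (ltW (hl0 m)))//; apply: h_ni.
by rewrite big_ord_recr/= leq_addl.
Qed.

Section limit_function.
Variable l : nat -> nat.
Hypothesis l_nd : forall m, (l m <= l m.+1)%N.
Hypothesis hl : forall m, h (l m) <= b + 8^-1 ^+ m.

Let gap (s t : nat -> nat) :
  (forall m, (l m <= s m)%N /\ (l m <= t m)%N) ->
  {ae mu, forall x, exists N, forall m, (N <= m)%N ->
    `|g (l m) (l m) x - g (s m) (t m) x| <= 2 * (2^-1) ^+ m}.
Proof.
move=> st.
apply: (@ae_cvg_entropy_gap _ _ _ _ (fun m => g (l m) (l m))
    (fun m => g (s m) (t m))) => //.
- by move=> m; rewrite -/(H _ _) hE ltry.
- by move=> m; have [? ?] := st m; exact: chain1.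
- move=> m; rewrite -!/(H _ _) hE (@le_trans _ _ (b + 8^-1 ^+ m)%:E) ?lee_fin//.
  by rewrite EFinD leeD2r.
Qed.

(** The information given the whole past and future.  It is a limit almost
    everywhere; the upper limit only serves to have a measurable function
    everywhere. *)
Definition limit_info x : R :=
  fine (limn_esup (fun m => (g (l m) (l m) x)%:E)).

Lemma measurable_limit_info : measurable_fun setT limit_info.
Proof.
apply: measurableT_comp; first exact: fine_measurable.
by apply: measurable_fun_limn_esup => m; exact/measurable_EFinP.
Qed.

Lemma limit_info_ge0 x : 0 <= limit_info x.
Proof.
apply: fine_ge0; rewrite (le_trans _ (limn_einf_sup _))//.
rewrite limn_einf_lim; apply: lime_ge; first exact: is_cvg_einfs.
apply: nearW => m; apply: le_ereal_inf_tmp => _ [k _ <-].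
by rewrite lee_fin.
Qed.

Lemma ae_cvg_diag : {ae mu, forall x,
  g (l m) (l m) x @[m --> \oo] --> limit_info x}.
Proof.
have : {ae mu, forall x, exists N, forall m, (N <= m)%N ->
    `|g (l m) (l m) x - g (l m.+1) (l m.+1) x| <= 2 * (2^-1) ^+ m}.
  by apply: (gap (s := l \o succn) (t := l \o succn)).
apply: filterS => x [N hN].
pose u m := g (l m) (l m) x.
have /cvg_ex[/= c hc] : cvgn u.
  have : cvgn (series (telescope u)).
    apply: normed_cvg.
    (* the sum makes the bound valid for the terms before [N] too *)
    pose K := 1 + \sum_(i < N) (`|telescope u i| * 2 ^+ i).
    have K0 : 0 <= K by rewrite addr_ge0// sumr_ge0.
    apply: (@series_le_cvg _ _ (geometric (2 * K) 2^-1)).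
    - by move=> n; exact: normr_ge0.
    - by move=> n /=; rewrite !mulr_ge0.
    - move=> n /=; have [nN|Nn] := ltnP n N.
        have -> : `|telescope u n| = `|telescope u n| * 2 ^+ n * 2^-1 ^+ n.
          by rewrite -mulrA -exprMn mulfV// expr1n mulr1.
        rewrite ler_wpM2r// (@le_trans _ _ K)//; last by rewrite ler_peMl// ler1n.
        rewrite /K (bigD1 (Ordinal nN))//= addrCA lerDl addr_ge0//.
        by rewrite sumr_ge0.
      rewrite distrC (le_trans (hN n Nn))//.
      rewrite ler_wpM2r// ler_peMr// lerDl sumr_ge0//.
    apply: is_cvg_geometric_series.
    by rewrite ger0_norm// invf_lt1// ltr1n.
  rewrite telescopeK => /cvg_ex[/= c hc]; apply/cvg_ex; exists (c + u 0%N).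
  have : (u n - u 0%N) + u 0%N @[n --> \oo] --> c + u 0%N.
    by apply: cvgD; [exact: hc|exact: cvg_cst].
  by under eq_fun do rewrite subrK.
suff -> : limit_info x = c by [].
rewrite /limit_info.
have /cvg_limn_einf_sup[_ ->//] : (u m)%:E @[m --> \oo] --> c%:E.
by apply: cvg_EFin => //; exact: nearW.
Qed.

(** Any windows longer than [l m] lead to the same limit, because their
    entropies are squeezed between the rate and that of [l m]. *)
Lemma ae_cvg_window (s t : nat -> nat) :
  (forall m, (l m <= s m)%N /\ (l m <= t m)%N) ->
  {ae mu, forall x, g (s m) (t m) x @[m --> \oo] --> limit_info x}.
Proof.
move=> /gap; move: ae_cvg_diag; apply: filterS2 => x h1 [N hN].
rewrite (_ : (fun m => _) = (fun m => g (l m) (l m) x -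
    (g (l m) (l m) x - g (s m) (t m) x))); last first.
  by apply/funext => m; rewrite subKr.
rewrite -[limit_info x]subr0; apply: cvgB => //.
apply/norm_cvg0P.
apply: (@squeeze_cvgr _ _ _ _ (cst 0) (geometric 2 2^-1)).
- by exists N => // m /= Nm; rewrite normr_ge0 hN.
- exact: cvg_cst.
- by apply: cvg_geometric; rewrite ger0_norm// invf_lt1// ltr1n.
Qed.

(** Fatou's lemma in [chain], where the long windows grow to infinity and the
    short ones are those of [array_sum]. *)
Lemma limit_info_chain n :
  (\int[mu]_x (expR (birkhoff_sum f limit_info n x - array_sum n x))%:E <= 1)%E.
Proof.
pose F m x := expR (\sum_(i < n) g (l m + i)%N ((l m).+1 + (n.-1 - i))%N
   (iter i f x) - array_sum n x).
have mA : measurable_fun setT (array_sum n) by exact: measurable_sum.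
apply: (@ae_fatou _ _ _ mu F).
- move=> m; apply: measurableT_comp => //; apply: measurable_funB => //.
  exact: (msum n (fun i => l m + i)%N (fun i => (l m).+1 + (n.-1 - i))%N).
- by move=> m x; exact: expR_ge0.
- apply: measurableT_comp => //; apply: measurable_funB => //.
  by apply: measurable_birkhoff_sum => //; exact: measurable_limit_info.
- by move=> x; exact: expR_ge0.
- have A i : {ae mu, forall x, g (l m + i)%N ((l m).+1 + (n.-1 - i))%N
      (iter i f x) @[m --> \oo] --> limit_info (iter i f x)}.
    apply: (ae_iter mf inv i (P := fun x => g (l m + i)%N
       ((l m).+1 + (n.-1 - i))%N x @[m --> \oo] --> limit_info x)).
    apply: (@ae_cvg_window (fun m => l m + i)%N
      (fun m => (l m).+1 + (n.-1 - i))%N) => m; split; lia.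
  have := ae_foralln A; apply: filterS => x {}A.
  apply: continuous_cvg; first exact: continuous_expR.
  apply: cvgB; last exact: cvg_cst.
  exact: (@cvg_sum_ord _ n (fun i m => g (l m + i)%N
    ((l m).+1 + (n.-1 - i))%N (iter i f x)) (fun i => limit_info (iter i f x))).
- move=> m.
  by apply: (@chain n (l m) (l m).+1 id (fun i => n - i)%N) => i ni; split; lia.
Qed.

Lemma limit_info_fin : (\int[mu]_x (limit_info x)%:E < +oo)%E.
Proof.
apply: le_lt_trans (ltry (fine (H 0 1))); rewrite fineK//.
apply: gibbs => //; first exact: measurable_limit_info.
  exact: limit_info_ge0.
have := limit_info_chain 1.
by under eq_integral do rewrite /birkhoff_sum /array_sum !big_ord1/= subn0.
Qed.

Let Knonneg (k : nat) x : 0 <= g 0 0 x + k%:R.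
Proof. by rewrite addr_ge0. Qed.

(** No entropy is lost in the limit: [g (l m) (l m)] exceeds [g 0 0] by more
    than [k] only with an exponentially small contribution to the integral, by
    [chain], so that the truncations at [g 0 0 + k] are nearly as large, and
    these converge by domination. *)
Lemma ge_limit_info : (b%:E <= \int[mu]_x (limit_info x)%:E)%E.
Proof.
pose G (k m : nat) x := Num.min (g (l m) (l m) x) (g 0 0 x + k%:R).
have mG k m : measurable_fun setT (G k m).
  by apply: measurable_minr => //; exact: measurable_funD.
have G0 k m x : 0 <= G k m x by rewrite le_min g0 Knonneg.
have bG k m : (b%:E <= \int[mu]_x (G k m x)%:E + (expR (- k%:R))%:E)%E.
  apply: (@le_trans _ _ (H (l m) (l m))); first exact: b_leH.
  have mE : measurable_fun setT (fun x => expR (g (l m) (l m) x - g 0 0 x)).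
    by apply: measurableT_comp => //; exact: measurable_funB.
  apply: (@le_trans _ _ (\int[mu]_x (G k m x + expR (- k%:R) *
      expR (g (l m) (l m) x - g 0 0 x))%:E)%E).
    apply: le_integral_EFin => //.
      by apply: measurable_funD => //; exact: measurable_funM.
    move=> x; rewrite /G; have [gk|gk] := leP (g (l m) (l m) x) (g 0 0 x + k%:R).
      by rewrite lerDl mulr_ge0// expR_ge0.
    rewrite -expRD.
    have := expR_ge1Dx (- k%:R + (g (l m) (l m) x - g 0 0 x)); lra.
  rewrite ge0_integralD_EFin//; last exact: measurable_funM.
  rewrite leeD2l// ge0_integralZ_EFin ?expR_ge0//; last first.
  by rewrite -[leRHS]mule1 lee_wpmul2l ?lee_fin ?expR_ge0//; exact: chain1.
have bL k : (b%:E <= \int[mu]_x (limit_info x)%:E + (expR (- k%:R))%:E)%E.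
  pose L x := Num.min (limit_info x) (g 0 0 x + k%:R).
  have mL : measurable_fun setT L.
    apply: measurable_minr; first exact: measurable_limit_info.
    exact: measurable_funD.
  apply: (@le_trans _ _ (\int[mu]_x (L x)%:E + (expR (- k%:R))%:E)%E); last first.
    rewrite leeD2r//; apply: le_integral_EFin => //.
    - exact: measurable_limit_info.
    - by move=> x; rewrite le_min limit_info_ge0 Knonneg.
    - by move=> x; rewrite ge_min lexx.
  have mGe m : measurable_fun setT (fun x => (G k m x)%:E).
    exact/measurable_EFinP.
  have mLe : measurable_fun setT (fun x => (L x)%:E) by exact/measurable_EFinP.
  have GL : {ae mu, forall x, setT x -> (G k m x)%:E @[m --> \oo] --> (L x)%:E}.
    move: ae_cvg_diag; apply: filterS => x gx _.
    apply: cvg_EFin; first exact: nearW.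
    apply: (@continuous_cvg _ R R _ _ _ (fun y => Num.min y (g 0 0 x + k%:R))) gx.
    by apply: (@continuous_min R^o R id (cst (g 0 0 x + k%:R)));
      [exact: cvg_id|exact: cvg_cst].
  have iB : mu.-integrable setT (fun x => (g 0 0 x + k%:R)%:E).
    apply/integrableP; split.
      by apply/measurable_EFinP; exact: measurable_funD.
    under eq_integral do rewrite gee0_abs ?lee_fin ?Knonneg//.
    by rewrite ge0_integralD_EFin// lte_add_pinfty// integral_cst_probability ltry.
  have GB : {ae mu, forall x m, setT x -> (`|(G k m x)%:E| <= (g 0 0 x + k%:R)%:E)%E}.
    apply: aeW => x m _.
    by rewrite gee0_abs ?lee_fin ?G0// ge_min lexx orbT.
  have [_ _ cG] := dominated_convergence measurableT mGe mLe GL iB GB.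
  have Lfin : (\int[mu]_x (L x)%:E)%E \is a fin_num.
    rewrite ge0_fin_numE; last first.
      by apply: integral_EFin_ge0 => x; rewrite le_min limit_info_ge0 Knonneg.
    apply: le_lt_trans limit_info_fin; apply: le_integral_EFin => //.
    - exact: measurable_limit_info.
    - by move=> x; rewrite le_min limit_info_ge0 Knonneg.
    - by move=> x; rewrite ge_min lexx.
  rewrite -leeBlDr//; rewrite -(cvg_lim _ cG)//.
  apply: lime_ge; first exact: (cvgP _ cG).
  by apply: nearW => m; rewrite leeBlDr//; exact: bG.
have /fineK <- : (\int[mu]_x (limit_info x)%:E)%E \is a fin_num.
  rewrite ge0_fin_numE; first exact: limit_info_fin.
  by apply: integral_EFin_ge0 => x; exact: limit_info_ge0.
rewrite lee_fin; apply/ler_addgt0Pr => e e0.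
have /cvgrPdist_lt/(_ _ e0)[N _ /(_ N (leqnn _))] := @cvgn_expR R.
rewrite /= sub0r normrN ger0_norm ?expR_ge0// => eN.
have := bL N; rewrite -[X in (_ <= X + _)%E]fineK.
  by rewrite -EFinD lee_fin => /le_trans; apply; rewrite lerD2l ltW.
rewrite ge0_fin_numE; first exact: limit_info_fin.
by apply: integral_EFin_ge0 => x; exact: limit_info_ge0.
Qed.

End limit_function.

(** By [limit_info_chain] the sum is at least the Birkhoff sum of [limit_info]
    up to a subexponential error. *)
Lemma ae_array_sum_ge : {ae mu, forall x, forall e, 0 < e ->
  exists N, forall n, (N <= n)%N -> b - e <= n%:R^-1 * array_sum n x}.
Proof.
have [l [lnd hl]] := window_choice.
have mL := measurable_limit_info l.
have sub := ae_subexponential (fun n => msum n id (fun i => n - i)%N)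
  (fun n => measurable_birkhoff_sum mf n mL) (limit_info_chain lnd hl).
have Lfin := limit_info_fin lnd hl.
have bL := ge_limit_info lnd hl.
have bk := birkhoff mf inv erg mL (limit_info_ge0 l) Lfin.
move: sub bk; apply: filterS2 => x sub bk e e0.
have e2 : 0 < e / 2 by rewrite divr_gt0.
have /cvgrPdist_le/(_ _ e2) [N1 _ hN1] := bk.
have [m me] : exists m : nat, m.+1%:R^-1 <= e / 2.
  exists (Num.truncn (e / 2)^-1); rewrite -[leRHS]invrK lef_pV2 ?posrE//.
    exact/ltW/truncnS_gt.
  by rewrite invr_gt0.
have [N2 hN2] := sub m.
exists (maxn N1 N2).+1 => n.
rewrite gtn_max => /andP[/[dup] Nn /ltnW/hN1 /= h1 /ltnW/hN2 h2].
have n0 : 0 < n%:R :> R by rewrite ltr0n (leq_trans _ Nn).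
move: h2; rewrite lerBlDl addrC -lerBlDl -(ler_pM2l (_ : 0 < n%:R^-1)) ?invr_gt0//.
rewrite mulrBr mulKf ?gt_eqF//; apply: le_trans.
have {}bL : b <= fine (\int[mu]_x (limit_info l x)%:E)%E.
  rewrite -lee_fin fineK// ge0_fin_numE//.
  by apply: integral_EFin_ge0 => y; exact: limit_info_ge0.
move: h1; rewrite ler_norml => /andP[_ h1].
by move: (fine _) (m.+1%:R^-1) (n%:R^-1 * _) h1 bL me => v q w h1 bL me; lra.
Qed.

Theorem ae_cvg_array_sum : {ae mu, forall x,
  n%:R^-1 * array_sum n x @[n --> \oo] --> b}.
Proof.
move: ae_array_sum_ge ae_array_sum_le; apply: filterS2 => x lb ub.
apply/cvgrPdist_le => e e0; have [N1 h1] := lb _ e0; have [N2 h2] := ub _ e0.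
exists (maxn N1 N2) => // n /=; rewrite geq_max => /andP[/h1 ? /h2 ?].
by rewrite ler_distlC; apply/andP; split.
Qed.

Let int_array_sumE n : (\int[mu]_x (array_sum n x)%:E =
  (\sum_(i < n) fine (H i (n - i)))%:E)%E.
Proof.
rewrite (@ge0_integral_sum_EFin _ _ _ mu n (fun i x => g i (n - i)%N (iter i f x)))//.
rewrite -sumEFin; apply: eq_bigr => i _; rewrite fineK//.
rewrite (@integral_iter _ _ _ mu f mf inv (fun x => (g i (n - i)%N x)%:E))//.
  exact/measurable_EFinP.
by move=> x; rewrite lee_fin.
Qed.

Lemma integral_array_sum_fin n : (\int[mu]_x (array_sum n x)%:E < +oo)%E.
Proof. by rewrite int_array_sumE ltry. Qed.

Theorem cvg_integral_array_sum :
  n%:R^-1 * fine (\int[mu]_x (array_sum n x)%:E)%E @[n --> \oo] --> b.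
Proof.
have lb n : (0 < n)%N -> b <= n%:R^-1 * fine (\int[mu]_x (array_sum n x)%:E)%E.
  move=> n0; rewrite int_array_sumE/= -(ler_pM2l (_ : 0 < n%:R)) ?ltr0n//.
  rewrite mulVKf ?pnatr_eq0 -?lt0n// mulr_natl -[in leLHS](card_ord n) -sumr_const.
  by apply: ler_sum => i _; rewrite -lee_fin fineK.
have ub n j : (j <= n)%N -> fine (\int[mu]_x (array_sum n x)%:E)%E <=
    n%:R * h j + 2 * j%:R * h 0%N.
  move=> jn; rewrite int_array_sumE/=.
  have first_ : \sum_(i < n) (if (i < j)%N then h 0%N else 0) = j%:R * h 0%N.
    rewrite -big_mkcond/= -(@big_ord_widen _ _ _ j n (fun i => h 0%N))//.
    by rewrite sumr_const card_ord mulr_natl.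
  have last_ : \sum_(i < n) (if (n - j <= i)%N then h 0%N else 0) = j%:R * h 0%N.
    rewrite -first_ (reindex_inj rev_ord_inj); apply: eq_bigr => i _ /=.
    have -> // : (n - j <= n - i.+1)%N = (i < j)%N.
    by have := ltn_ord i; lia.
  have -> : n%:R * h j = \sum_(i < n) h j by rewrite sumr_const card_ord mulr_natl.
  rewrite -mulrA mulr2n mulrDl mul1r -{1}first_ -last_ -!big_split/=.
  apply: ler_sum => i _.
  have ge0 (c : bool) : 0 <= (if c then h 0%N else 0) by case: c.
  have [w1 w2] := win_chain j (ltn_ord i).
  apply: (@le_trans _ _ (h (win n j i))).
    by rewrite -lee_fin -hE fineK//; exact: H_le.
  rewrite /win; case: ifP => [_|].
    by rewrite lerDl addr_ge0.
  move/negbT; rewrite negb_and -!ltnNge => /orP[->|nij].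
    by rewrite addrCA lerDl addr_ge0.
  by rewrite (_ : (n - j <= i)%N) ?addrA ?lerDr ?addr_ge0//; lia.
apply/cvgrPdist_le => e e0.
have e2 : 0 < e / 2 by rewrite divr_gt0.
have [j hj] := b_lt e2.
have : n%:R^-1 * (2 * j%:R * h 0%N) @[n --> \oo] --> 0 * (2 * j%:R * h 0%N).
  by apply: cvgM; [exact: (@cvg_invn R)|exact: cvg_cst].
rewrite mul0r => /cvgrPdist_le/(_ _ e2)[N _ hN].
exists (maxn j N).+1 => // n /=; rewrite gtn_max => /andP[jn /ltnW/hN/=].
rewrite sub0r normrN ler_norml => /andP[_ h1].
have n0 : 0 < n%:R :> R by rewrite ltr0n (leq_trans _ jn).
have h2 := lb n (leq_trans (ltn0Sn _) jn).
have : n%:R^-1 * fine (\int[mu]_x (array_sum n x)%:E)%E <= h j + e / 2.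
  have := ub n j (ltnW jn).
  rewrite -(ler_pM2l (_ : 0 < n%:R^-1)) ?invr_gt0// mulrDr mulKf ?gt_eqF//.
  by move/le_trans; apply; rewrite lerD2l.
move: (_ * fine _) h2 => w h2 h3.
by rewrite ler_distlC; apply/andP; split; lra.
Qed.

End triangular_array.

(** * Disintegrations and masses of classes *)

Lemma indic_in (R : realType) (S : Type) (A : set S) z : A z -> \1_A z = 1 :> R.
Proof. by move=> Az; rewrite indicE mem_set. Qed.

Lemma indic_notin (R : realType) (S : Type) (A : set S) z :
  ~ A z -> \1_A z = 0 :> R.
Proof. by move=> nAz; rewrite indicE memNset. Qed.

(** The values of a probability kernel are only known as measures; Fubini's
    theorem wants them packed as probabilities. *)
Section probability_of.
Context d (T : measurableType d) (R : realType) (m : {measure set T -> \bar R}).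
Definition probability_of (m1 : m setT = 1%E) : set T -> \bar R := m.
HB.instance Definition _ m1 := isMeasure.Build d T R (probability_of m1)
  (measure0 m) (measure_ge0 m) (@measure_semi_sigma_additive _ _ _ m).
HB.instance Definition _ m1 := Measure_isProbability.Build d T R (probability_of m1) m1.

End probability_of.

Lemma probability_fubini d (T : measurableType d) (R : realType)
    (m1 m2 : {measure set T -> \bar R}) (F : T * T -> \bar R) :
  m1 setT = 1%E -> m2 setT = 1%E ->
  measurable_fun setT F -> (forall w, 0 <= F w)%E ->
  measurable_fun setT (fun x => \int[m2]_y F (x, y))%E /\
  (\int[m1]_x \int[m2]_y F (x, y) = \int[m2]_y \int[m1]_x F (x, y))%E.
Proof.
move=> m11 m21 mF F0.
pose p1 : probability T R := probability_of m11.
pose p2 : probability T R := probability_of m21.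
have pm1 (G : T -> \bar R) : (\int[m1]_x G x = \int[p1]_x G x)%E.
  exact: eq_measure_integral.
have pm2 (G : T -> \bar R) : (\int[m2]_x G x = \int[p2]_x G x)%E.
  exact: eq_measure_integral.
split.
  under eq_fun do rewrite pm2.
  exact: (@measurable_fun_fubini_tonelli_F _ _ _ _ _ p2 F mF F0).
rewrite pm1 pm2; under eq_integral do rewrite pm2.
under [RHS]eq_integral do rewrite pm1.
exact: (@fubini_tonelli _ _ _ _ _ p1 p2 F mF F0).
Qed.

Section disintegration.
Context d (T : measurableType d) (R : realType) (mu : probability T R).
Variable k : R.-pker T ~> T.
Hypothesis dis : forall A : set T, measurable A ->
  mu A = (\int[mu]_x k x A)%E.
Local Open Scope ereal_scope.

Lemma disintegration (F : T -> \bar R) : measurable_fun setT F ->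
  (forall x, 0 <= F x) -> \int[mu]_x F x = \int[mu]_x \int[k x]_y F y.
Proof.
move=> mF F0.
have := @integral_kcomp _ _ _ unit T T R (kprobability (measurable_cst (mu : pprobability T R)))
  (kernel.kernel_snd k) tt F F0 mF.
rewrite /= => <-; apply: eq_measure_integral => A mA _.
exact: (dis mA).
Qed.

Lemma measurable_kernel_integral (F : T * T -> \bar R) :
  measurable_fun setT F -> (forall z, 0 <= F z) ->
  measurable_fun setT (fun x => \int[k x]_y F (x, y)).
Proof. by move=> mF F0; exact: measurable_fun_integral_finite_kernel. Qed.

Lemma measurable_swap_pair : measurable_fun setT (fun z : T * T => (z.2, z.1)).
Proof.
by apply/measurable_fun_pairP; split; [exact: measurable_snd|exact: measurable_fst].
Qed.

Lemma measurable_kernel_integral2 (F : T * T -> \bar R) :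
  measurable_fun setT F -> (forall z, 0 <= F z) ->
  measurable_fun setT (fun z => \int[k z]_x \int[k z]_y F (x, y)).
Proof.
move=> mF F0.
have mH : measurable_fun setT (fun w : T * T => \int[k w.2]_y F (w.1, y)).
  have := @measurable_fun_integral_finite_kernel _ _ (T * T)%type T R
    (fun w : T * T * T => F (w.1.1, w.2)) (kernel.kernel_snd k).
  apply => //; apply: measurableT_comp => //.
  apply/measurable_fun_pairP; split => /=; last exact: measurable_snd.
  exact: (measurableT_comp measurable_fst measurable_fst).
apply: (measurable_kernel_integral
  (F := fun w => \int[k w.1]_y F (w.2, y))) => //.
- exact: (measurableT_comp mH measurable_swap_pair).
- by move=> w; exact: integral_ge0.
Qed.

Lemma measurable_fun_integral_kernel_cst z (F : T * T -> \bar R) :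
  measurable_fun setT F -> (forall w, 0 <= F w) ->
  measurable_fun setT (fun x => \int[k z]_y F (x, y)).
Proof. by move=> mF F0; have [] := probability_fubini
  (@prob_kernel _ _ _ _ _ k z) (@prob_kernel _ _ _ _ _ k z) mF F0. Qed.

Lemma kernel_fubini z z' (F : T * T -> \bar R) :
  measurable_fun setT F -> (forall w, 0 <= F w) ->
  \int[k z]_x \int[k z']_y F (x, y) = \int[k z']_y \int[k z]_x F (x, y).
Proof. by move=> mF F0; have [] := probability_fubini
  (@prob_kernel _ _ _ _ _ k z) (@prob_kernel _ _ _ _ _ k z') mF F0. Qed.

(** [X] stands for the relation of the partition [xi] of which [k] is the
    system of conditional measures. *)
Variable X : set (T * T).
Hypothesis mX : measurable X.
Hypothesis kX : forall x y, X (x, y) ->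
  forall A : set T, measurable A -> k x A = k y A.
Hypothesis concX : {ae mu, forall x, k x (~` xsection X x) = 0}.

Lemma eq_kernel_integral x y (F : T -> \bar R) : X (x, y) ->
  \int[k x]_z F z = \int[k y]_z F z.
Proof. by move=> Xxy; apply: eq_measure_integral => A mA _; exact: kX. Qed.

Lemma ae_kernel_class (F G : T -> \bar R) x :
  measurable_fun setT F -> measurable_fun setT G ->
  (forall y, 0 <= F y) -> (forall y, 0 <= G y) ->
  k x (~` xsection X x) = 0 -> (forall y, X (x, y) -> F y = G y) ->
  \int[k x]_y F y = \int[k x]_y G y.
Proof.
move=> mF mG F0 G0 kx0 FG; apply: ge0_ae_eq_integral => //.
exists (~` xsection X x); split => //.
  by apply: measurableC; exact: measurable_xsection.
move=> y /= nFG /xsectionP Xxy; apply: nFG => _; exact: FG.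
Qed.

(** Conditionally on the class of [x], a second point [y] drawn from the same
    conditional measure is exchangeable with [x]. *)
Lemma mass_transport (F : T * T -> \bar R) : measurable_fun setT F ->
  (forall z, 0 <= F z) ->
  \int[mu]_x \int[k x]_y F (x, y) = \int[mu]_x \int[k x]_y F (y, x).
Proof.
have main (G : T * T -> \bar R) : measurable_fun setT G -> (forall z, 0 <= G z) ->
    \int[mu]_x \int[k x]_y G (x, y) =
    \int[mu]_z \int[k z]_x \int[k z]_y G (x, y).
  move=> mG G0.
  have mK := measurable_kernel_integral mG G0.
  have K0 x : 0 <= \int[k x]_y G (x, y) by exact: integral_ge0.
  rewrite (disintegration mK K0); apply: ge0_ae_eq_integral.
  - exact: measurableT.
  - exact: (measurable_fun_integral_kernel (measurable_kernel k)).
  - exact: measurable_kernel_integral2.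
  - by move=> x _; exact: integral_ge0.
  - by move=> x _; apply: integral_ge0 => y _; exact: integral_ge0.
  - apply: filterS concX => z kz _.
    apply: ae_kernel_class => //.
    + exact: (@measurable_fun_integral_kernel_cst z).
    + by move=> x; exact: integral_ge0.
    + by move=> x Xzx; apply/esym; exact: eq_kernel_integral.
move=> mF F0.
have mFs : measurable_fun setT (F \o (fun z => (z.2, z.1))).
  exact: (measurableT_comp mF measurable_swap_pair).
transitivity (\int[mu]_z \int[k z]_x \int[k z]_y F (x, y)).
  exact: (main F mF F0).
transitivity (\int[mu]_z \int[k z]_x \int[k z]_y F (y, x)).
  by apply: eq_integral => z _; exact: kernel_fubini.
exact/esym/(main _ mFs (fun z => F0 _)).
Qed.

Local Close Scope ereal_scope.

Lemma measurable_inv_ge0 d' (S : measurableType d') (u : S -> R) :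
  measurable_fun setT u -> (forall x, 0 <= u x) ->
  measurable_fun setT (fun x => (u x)^-1).
Proof.
move=> mu_ u0; rewrite (_ : (fun _ => _) = (@powR R ^~ (-1)) \o u).
  by apply: measurableT_comp => //; exact: measurable_powR.
by apply/funext => x /=; rewrite powR_inv1.
Qed.

Lemma kernel_integralZ z (a : R) (u : T -> R) : measurable_fun setT u ->
  (forall y, 0 <= u y) -> 0 <= a ->
  (\int[k z]_y (a * u y)%:E = a%:E * \int[k z]_y (u y)%:E)%E.
Proof.
move=> mu_ u0 a0; under eq_integral do rewrite EFinM.
rewrite ge0_integralZl//; first exact/measurable_EFinP.
by move=> y _; rewrite lee_fin.
Qed.

(** Measurable partial equivalence relations, in place of partitions: classes
    are then sections of a measurable set, to which Fubini's theorem applies,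
    and the points of a null set may be left out of every class. *)
Record is_per (E : set (T * T)) : Prop := IsPer {
  per_measurable : measurable E ;
  per_sym : forall x y, E (x, y) -> E (y, x) ;
  per_trans : forall x y z, E (x, y) -> E (y, z) -> E (x, z) }.

Definition class_mass (E : set (T * T)) x : R := fine (k x (xsection E x)).
Local Notation m := class_mass.

Lemma k_le1 x (A : set T) : measurable A -> (k x A <= 1)%E.
Proof.
by move=> mA; rewrite -(@prob_kernel _ _ _ _ _ k x) le_measure// inE.
Qed.

Lemma k_fin x (A : set T) : measurable A -> k x A \is a fin_num.
Proof.
by move=> mA; rewrite ge0_fin_numE// (le_lt_trans (k_le1 x mA))// ltry.
Qed.

Lemma class_massE E x : measurable E -> (m E x)%:E = k x (xsection E x).
Proof.
by move=> mE; rewrite fineK// k_fin//; exact: measurable_xsection.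
Qed.

Lemma class_mass_ge0 E x : 0 <= m E x.
Proof. exact: fine_ge0. Qed.

Lemma class_mass_le1 E x : measurable E -> m E x <= 1.
Proof.
move=> mE; rewrite -lee_fin class_massE// k_le1//.
exact: measurable_xsection.
Qed.

Lemma le_class_mass E F x : measurable E -> measurable F -> E `<=` F ->
  m E x <= m F x.
Proof.
move=> mE mF EF; rewrite -lee_fin !class_massE//; apply: le_measure.
- by rewrite inE; exact: measurable_xsection.
- by rewrite inE; exact: measurable_xsection.
- by move=> y /xsectionP /EF /xsectionP.
Qed.

Lemma measurable_class_mass E : measurable E -> measurable_fun setT (m E).
Proof.
move=> mE; apply: measurableT_comp; first exact: fine_measurable.
by apply: measurable_fun_xsection_finite_kernel; rewrite inE.
Qed.

Lemma measurable_class_info E : measurable E ->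
  measurable_fun setT (fun x => - ln (m E x)).
Proof.
move=> mE; apply: measurable_funN.
exact: (measurableT_comp (@measurable_ln R) (measurable_class_mass mE)).
Qed.

Lemma class_info_ge0 E x : measurable E -> 0 <= - ln (m E x).
Proof. by move=> mE; rewrite oppr_ge0 ln_le0// class_mass_le1. Qed.

Lemma measurable_relation1 (E : set (T * T)) x : measurable E ->
  measurable_fun setT (fun y => \1_E (x, y) : R).
Proof. by move=> mE; apply: measurable_fun_pair2; exact: measurable_indic. Qed.

Lemma measurable_relation2 (E : set (T * T)) y : measurable E ->
  measurable_fun setT (fun x => \1_E (x, y) : R).
Proof. by move=> mE; apply: measurable_fun_pair1; exact: measurable_indic. Qed.

Lemma class_mass_integral E x : measurable E ->
  (\int[k x]_y (\1_E (x, y))%:E = (m E x)%:E)%E.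
Proof.
move=> mE; rewrite class_massE//.
have mEx : measurable (xsection E x) by exact: measurable_xsection.
rewrite -[xsection E x]setIT -integral_indic//; apply: eq_integral => y _.
by rewrite !indicE mem_xsection.
Qed.

(** The mass of a class may be computed from any point of the same class of
    [X]. *)
Lemma class_mass_integral_other E x y : measurable E -> X (x, y) ->
  (\int[k x]_z (\1_E (y, z))%:E = (m E y)%:E)%E.
Proof.
by move=> mE Xxy; rewrite (eq_kernel_integral _ Xxy) class_mass_integral.
Qed.

Lemma per_class E x y : is_per E -> E (x, y) -> forall z, E (x, z) <-> E (y, z).
Proof.
move=> pE Exy z; split; first exact/(per_trans pE)/(per_sym pE).
exact: (per_trans pE).
Qed.

Lemma class_mass_eq E x y : is_per E -> E `<=` X -> E (x, y) -> m E x = m E y.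
Proof.
move=> pE EX Exy; have mE := per_measurable pE.
apply: EFin_inj; rewrite !class_massE//.
rewrite (kX (EX _ Exy)); last exact: measurable_xsection.
congr (k y _); apply/seteqP; split => z /xsectionP h; apply/xsectionP.
  exact/(per_class pE Exy).
exact/(per_class pE Exy).
Qed.

Lemma perI E F : is_per E -> is_per F -> is_per (E `&` F).
Proof.
move=> [mE sE tE] [mF sF tF]; split; first exact: measurableI.
- by move=> x y [/sE ? /sF ?].
- by move=> x y z [Exy Fxy] [Eyz Fyz]; split; [exact: (tE _ y)|exact: (tF _ y)].
Qed.

(** The conditional probabilities of [C] given [Q'] and given the finer [Q]
    are compared on the classes of [Q].  In a class [q] of [Q] the expectation
    of the quotient, given [Q], sums over the classes of [C] inside [q] their
    conditional probabilities given [Q']; that sum is at most 1. *)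
Section ratio.
Variables (C Q Q' : set (T * T)) (G : T -> R).
Hypotheses (pC : is_per C) (pQ : is_per Q) (pQ' : is_per Q').
Hypotheses (QQ' : Q `<=` Q') (Q'X : Q' `<=` X).
Hypotheses (mG : measurable_fun setT G) (G0 : forall x, 0 <= G x).
Hypothesis GQ : forall x y, Q (x, y) -> G x = G y.

Let mQ := per_measurable pQ.
Let mQ' := per_measurable pQ'.
Let pCQ := perI pC pQ.
Let pCQ' := perI pC pQ'.
Let mCQ := per_measurable pCQ.
Let mCQ' := per_measurable pCQ'.
Let CQX : C `&` Q `<=` X. Proof. by move=> z [_ /QQ']; exact: Q'X. Qed.
Let CQ'X : C `&` Q' `<=` X. Proof. by move=> z [_]; exact: Q'X. Qed.

Let inv_ge0 E x : 0 <= (m E x)^-1.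
Proof. by rewrite invr_ge0 class_mass_ge0. Qed.

Let minv E : measurable E -> measurable_fun setT (fun x => (m E x)^-1).
Proof.
move=> mE; apply: measurable_inv_ge0; first exact: measurable_class_mass.
by move=> x; exact: class_mass_ge0.
Qed.

(** The integrand divided by the mass of [C `&` Q'], so that the integrand is
    the integral of [h x] over the class of [x]; mass transport may then move
    [h] to the other point of the pair. *)
Let h x := G x * m Q x * ((m Q' x)^-1 * (m (C `&` Q) x)^-1).

Let h0 x : 0 <= h x.
Proof. by rewrite !mulr_ge0// class_mass_ge0. Qed.

Let mh : measurable_fun setT h.
Proof.
apply: measurable_funM; apply: measurable_funM => //; try exact: minv.
exact: measurable_class_mass.
Qed.

Let inner x z : (\int[k x]_y ((\1_(C `&` Q') (x, y) *
    (m (C `&` Q) y)^-1) * \1_Q (y, z))%:E <= (\1_Q' (x, z))%:E)%E.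
Proof.
have [[y0 [[Cxy0 Q'xy0] Qy0z]]|no] :=
    pselect (exists y0, (C `&` Q') (x, y0) /\ Q (y0, z)); last first.
  rewrite integral0_eq ?lee_fin// => y _; congr (_%:E).
  have [h1|h1] := pselect ((C `&` Q') (x, y)); last first.
    by rewrite (indic_notin _ h1) !mul0r.
  have [h2|h2] := pselect (Q (y, z)); last first.
    by rewrite (indic_notin _ h2) mulr0.
  by exfalso; apply: no; exists y.
have Q'xz : Q' (x, z) by exact: (per_trans pQ' Q'xy0 (QQ' Qy0z)).
rewrite (indic_in _ Q'xz).
apply: (@le_trans _ _ (\int[k x]_y ((m (C `&` Q) y0)^-1 *
    \1_(C `&` Q) (y0, y))%:E)%E).
  apply: ge0_le_integral => //.
  - by move=> y _; rewrite lee_fin !mulr_ge0.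
  - apply/measurable_EFinP; apply: measurable_funM.
      by apply: measurable_funM; [exact: measurable_relation1|exact: minv].
    exact: measurable_relation2.
  - apply/measurable_EFinP; apply: measurable_funM => //.
    exact: measurable_relation1.
  - move=> y _; rewrite lee_fin.
    have [h1|h1] := pselect ((C `&` Q') (x, y)); last first.
      by rewrite (indic_notin _ h1) !mul0r mulr_ge0.
    have [h2|h2] := pselect (Q (y, z)); last first.
      by rewrite (indic_notin _ h2) mulr0 mulr_ge0.
    have h3 : (C `&` Q) (y0, y).
      split; first exact: (per_trans pC (per_sym pC Cxy0) h1.1).
      exact: (per_trans pQ Qy0z (per_sym pQ h2)).
    rewrite (indic_in _ h1) (indic_in _ h2) (indic_in _ h3) mul1r !mulr1.
    by rewrite (class_mass_eq pCQ CQX h3).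
rewrite kernel_integralZ//; last exact: measurable_relation1.
rewrite class_mass_integral_other//; last exact: Q'X.
rewrite -EFinM lee_fin.
have [->|n0] := eqVneq (m (C `&` Q) y0) 0; first by rewrite mulr0.
by rewrite mulVf.
Qed.

Let claim x : (\int[k x]_y (h y * \1_(C `&` Q') (x, y))%:E <=
  \int[k x]_z ((m Q' x)^-1 * (G z * \1_Q' (x, z)))%:E)%E.
Proof.
pose Phi (w : T * T) := (m Q' x)^-1 * (G w.2 *
  ((\1_(C `&` Q') (x, w.1) * (m (C `&` Q) w.1)^-1) * \1_Q w)).
have Phi0 w : 0 <= Phi w by rewrite !mulr_ge0.
have mPhi : measurable_fun setT Phi.
  apply: measurable_funM => //; apply: measurable_funM.
    exact: (measurableT_comp mG measurable_snd).
  apply: measurable_funM; last exact: measurable_indic.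
  apply: measurable_funM.
    exact: (measurableT_comp (measurable_relation1 x mCQ') measurable_fst).
  exact: (measurableT_comp (minv mCQ) measurable_fst).
have mPhiE : measurable_fun setT (EFin \o Phi) by exact/measurable_EFinP.
have -> : (\int[k x]_y (h y * \1_(C `&` Q') (x, y))%:E =
    \int[k x]_y \int[k x]_z (Phi (y, z))%:E)%E.
  apply: eq_integral => y _.
  have [h1|h1] := pselect ((C `&` Q') (x, y)); last first.
    rewrite (indic_notin _ h1) mulr0 integral0_eq// => z _.
    by rewrite /Phi/= (indic_notin _ h1) !mul0r !mulr0.
  have Xxy := CQ'X h1.
  rewrite (indic_in _ h1) mulr1.
  transitivity (\int[k x]_z ((m Q' x)^-1 * (m (C `&` Q) y)^-1 * G y *
      \1_Q (y, z))%:E)%E.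
    rewrite kernel_integralZ ?mulr_ge0//; last exact: measurable_relation1.
    rewrite class_mass_integral_other// -EFinM /h (class_mass_eq pQ' Q'X h1.2).
    by congr (_%:E); ring.
  apply: eq_integral => z _; congr (_%:E); rewrite /Phi/=.
  have [h2|h2] := pselect (Q (y, z)); last first.
    by rewrite (indic_notin _ h2) !mulr0.
  by rewrite (GQ h2) (indic_in _ h1); ring.
rewrite (kernel_fubini x x mPhiE (fun w => Phi0 w)).
apply: ge0_le_integral => //.
- by move=> z _; apply: integral_ge0 => y _; rewrite lee_fin.
- have mS : measurable_fun setT (fun w : T * T => (Phi (w.2, w.1))%:E).
    exact: (measurableT_comp mPhiE measurable_swap_pair).
  exact: (measurable_fun_integral_kernel_cst x mS (fun w => Phi0 _)).
- apply/measurable_EFinP; apply: measurable_funM => //.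
  by apply: measurable_funM => //; exact: measurable_relation1.
- move=> z _; rewrite /Phi/=.
  under eq_integral do rewrite mulrA.
  rewrite kernel_integralZ//.
  + have -> : ((m Q' x)^-1 * (G z * \1_Q' (x, z)))%:E =
        (((m Q' x)^-1 * G z)%:E * (\1_Q' (x, z))%:E)%E.
      by rewrite -EFinM mulrA.
    by rewrite lee_wpmul2l ?inner// lee_fin mulr_ge0.
  + apply: measurable_funM; last exact: measurable_relation2.
    by apply: measurable_funM; [exact: measurable_relation1|exact: minv].
  + by move=> y; rewrite !mulr_ge0.
  + by rewrite mulr_ge0.
Qed.

Lemma ratio_integral_le :
  (\int[mu]_x (G x * ((m (C `&` Q') x / m Q' x) / (m (C `&` Q) x / m Q x)))%:E
   <= \int[mu]_x (G x)%:E)%E.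
Proof.
have mF (u : T -> R) (E : set (T * T)) : measurable_fun setT u -> measurable E ->
    measurable_fun setT (fun w : T * T => (u w.1 * \1_E w)%:E).
  move=> mu_ mE; apply/measurable_EFinP; apply: measurable_funM.
    exact: (measurableT_comp mu_ measurable_fst).
  exact: measurable_indic.
have swap E x y : is_per E -> \1_E (x, y) = \1_E (y, x) :> R.
  move=> pE; rewrite !indicE; congr (nat_of_bool _)%:R.
  by apply/idP/idP => /set_mem e; apply/mem_set; exact: (per_sym pE).
have int_mul u E x : measurable E -> 0 <= u ->
    (\int[k x]_y (u * \1_E (x, y))%:E = (u * m E x)%:E)%E.
  move=> mE u0; rewrite kernel_integralZ//; last exact: measurable_relation1.
  by rewrite class_mass_integral.
have -> : (\int[mu]_x (G x * ((m (C `&` Q') x / m Q' x) /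
    (m (C `&` Q) x / m Q x)))%:E =
    \int[mu]_x \int[k x]_y (h x * \1_(C `&` Q') (x, y))%:E)%E.
  apply: eq_integral => x _; rewrite int_mul//; congr (_%:E).
  by rewrite /h invfM invrK; ring.
rewrite (mass_transport (mF h _ mh mCQ')); last first.
  by move=> w; rewrite lee_fin mulr_ge0.
pose u x := (m Q' x)^-1 * G x.
have mu_ : measurable_fun setT u by apply: measurable_funM => //; exact: minv.
have u0 x : 0 <= u x by rewrite mulr_ge0.
apply: (@le_trans _ _ (\int[mu]_x \int[k x]_y (u x * \1_Q' (x, y))%:E)%E).
  rewrite (mass_transport (mF u _ mu_ mQ')); last first.
    by move=> w; rewrite lee_fin mulr_ge0.
  apply: ge0_le_integral => //.
  - by move=> x _; apply: integral_ge0 => y _; rewrite lee_fin mulr_ge0.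
  - apply: (@measurable_kernel_integral (fun w => (h w.2 * \1_(C `&` Q') (w.2, w.1))%:E)).
      exact: (measurableT_comp (mF h _ mh mCQ') measurable_swap_pair).
    by move=> w; rewrite lee_fin mulr_ge0.
  - apply: (@measurable_kernel_integral (fun w => (u w.2 * \1_Q' (w.2, w.1))%:E)).
      exact: (measurableT_comp (mF u _ mu_ mQ') measurable_swap_pair).
    by move=> w; rewrite lee_fin mulr_ge0.
  - move=> x _.
    under eq_integral do rewrite (swap _ _ _ pCQ').
    apply: (le_trans (claim x)).
    rewrite le_eqVlt; apply/orP; left; apply/eqP; apply: eq_integral => z _.
    congr (_%:E); rewrite (swap Q' z x pQ').
    have [h1|h1] := pselect (Q' (x, z)); last first.
      by rewrite (indic_notin _ h1) !mulr0.
    by rewrite /u (class_mass_eq pQ' Q'X h1) mulrA.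
apply: ge0_le_integral => //.
- by move=> x _; apply: integral_ge0 => y _; rewrite lee_fin mulr_ge0.
- apply: (@measurable_kernel_integral (fun w => (u w.1 * \1_Q' w)%:E)).
    exact: mF.
  by move=> w; rewrite lee_fin mulr_ge0.
- exact/measurable_EFinP.
- move=> x _; rewrite int_mul// lee_fin /u mulrAC.
  have [->|n0] := eqVneq (m Q' x) 0; first by rewrite mulr0 mul0r.
  by rewrite mulVf// mul1r.
Qed.
End ratio.

End disintegration.

(** * Masses of classes and invariant maps *)

(** For the relation of a partition, the relation of the preimage partition. *)
Definition pull (T : Type) (phi : T -> T) (E : set (T * T)) : set (T * T) :=
  [set w | E (phi w.1, phi w.2)].

Section class_mass_dynamics.
Context d (T : measurableType d) (R : realType) (mu : probability T R).
Variable k : R.-pker T ~> T.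
Hypothesis dis : forall A : set T, measurable A ->
  mu A = (\int[mu]_x k x A)%E.
Variable X : set (T * T).
Hypothesis pX : is_per X.
Hypothesis kX : forall x y, X (x, y) ->
  forall A : set T, measurable A -> k x A = k y A.
Hypothesis concX : {ae mu, forall x, k x (~` xsection X x) = 0%E}.
Let mX := per_measurable pX.
Local Notation m := (class_mass k).

Lemma measurable_pull (phi : T -> T) (E : set (T * T)) :
  measurable_fun setT phi -> measurable E -> measurable (pull phi E).
Proof.
move=> mphi mE; rewrite -[X in measurable X]setTI.
rewrite (_ : pull phi E = (fun w => (phi w.1, phi w.2)) @^-1` E)//.
have : measurable_fun setT (fun w : T * T => (phi w.1, phi w.2)).
  apply/measurable_fun_pairP; split.
    exact: (measurableT_comp mphi measurable_fst).
  exact: (measurableT_comp mphi measurable_snd).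
by apply.
Qed.

Lemma per_pull (phi : T -> T) (E : set (T * T)) : measurable_fun setT phi -> is_per E ->
  is_per (pull phi E).
Proof.
move=> mphi [mE sE tE]; split; first exact: measurable_pull.
- by move=> x y /sE.
- by move=> x y z /tE/[apply].
Qed.

Section covariance.
Variables phi psi : T -> T.
Hypotheses (mphi : measurable_fun setT phi) (mpsi : measurable_fun setT psi).
Hypotheses (phiK : cancel phi psi) (psiK : cancel psi phi).
Hypothesis invphi : forall A : set T, measurable A -> mu (phi @^-1` A) = mu A.
Hypothesis Xphi : pull phi X `<=` X.

Let invpsi (A : set T) : measurable A -> mu (psi @^-1` A) = mu A.
Proof. exact: (invariant_inverse mpsi phiK invphi). Qed.

Variable E : set (T * T).
Hypotheses (pE : is_per E) (EX : E `<=` X).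
Let mE := per_measurable pE.

Let swap (F : set (T * T)) x y : is_per F -> \1_F (x, y) = \1_F (y, x) :> R.
Proof.
move=> pF; rewrite !indicE; congr (nat_of_bool _)%:R.
by apply/idP/idP => /set_mem e; apply/mem_set; exact: (per_sym pF).
Qed.

Let inner z y : k z (~` xsection X z) = 0%E ->
  (\int[k z]_w (\1_E (w, y))%:E = (\1_X (z, y) * m E y)%:E)%E.
Proof.
move=> kz.
under eq_integral do rewrite (swap _ _ pE).
have [h1|h1] := pselect (X (z, y)).
  by rewrite (indic_in _ h1) mul1r (class_mass_integral_other kX mE h1).
rewrite (indic_notin _ h1) mul0r.
rewrite (ae_kernel_class (G := cst 0%E) mX _ _ _ _ kz)//.
- by rewrite integral0_eq.
- exact/measurable_EFinP/measurable_relation1.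
- move=> w Xzw; rewrite indic_notin// => /EX/(per_sym pX) Xwy.
  by apply: h1; exact: (per_trans pX Xzw Xwy).
Qed.

(** Mass transport, invariance of [mu] under [psi], and a second disintegration
    bring both sides to an integral over pairs [(w, y)] with [w] drawn from
    [k z] and [y] from [k (psi z)], where Fubini's theorem exchanges them. *)
Let test (B : set T) : measurable B ->
  (\int[mu]_x (\1_B x * m (pull phi E) x)%:E =
   \int[mu]_x (\1_B x * (m (pull phi X) x * m E (phi x)))%:E)%E.
Proof.
move=> mB.
have pP := per_pull mphi pE; have mP := per_measurable pP.
have pPX := per_pull mphi pX; have mPX := per_measurable pPX.
have mI : measurable_fun setT (\1_B : T -> R) by exact: measurable_indic.
have mEphi : measurable_fun setT (fun x => m E (phi x)).
  exact: (measurableT_comp (measurable_class_mass k mE) mphi).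
have int_mul (u : R) F x : measurable F -> 0 <= u ->
    (\int[k x]_y (u * \1_F (x, y))%:E = (u * m F x)%:E)%E.
  move=> mF u0; rewrite kernel_integralZ//; last exact: measurable_relation1.
  by rewrite class_mass_integral.
pose F1 (w : T * T) := (\1_B w.1 * \1_(pull phi E) w)%:E : \bar R.
have mF1 : measurable_fun setT F1.
  apply/measurable_EFinP; apply: measurable_funM; last exact: measurable_indic.
  exact: (measurableT_comp mI measurable_fst).
have F10 w : (0 <= F1 w)%E by rewrite lee_fin.
have -> : (\int[mu]_x (\1_B x * m (pull phi E) x)%:E =
    \int[mu]_x \int[k x]_y F1 (x, y))%E.
  by apply: eq_integral => x _; rewrite /F1 /= int_mul.
rewrite (mass_transport dis mX kX concX mF1 F10).
pose F2 (w : T * T) := F1 (w.2, w.1).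
have mF2 : measurable_fun setT F2.
  exact: (measurableT_comp mF1 (@measurable_swap_pair _ T)).
pose phi1 x := (\int[k x]_y F2 (x, y))%E.
have mphi1 : measurable_fun setT phi1.
  exact: (measurable_kernel_integral k mF2 (fun w => F10 _)).
have phi10 x : (0 <= phi1 x)%E by apply: integral_ge0 => y _; exact: F10.
rewrite -/(integral mu setT phi1).
rewrite -(integral_invariant mpsi invpsi mphi1 phi10).
have mphi1p : measurable_fun setT (phi1 \o psi) by exact: measurableT_comp.
rewrite (disintegration dis mphi1p (fun x => phi10 _)).
pose F3 (w : T * T) := (\1_B w.1 * m E (phi w.1) * \1_(pull phi X) w)%:E : \bar R.
have mF3 : measurable_fun setT F3.
  apply/measurable_EFinP; apply: measurable_funM; last exact: measurable_indic.
  apply: (@measurableT_comp _ _ _ _ _ _ (fun x => \1_B x * m E (phi x))) => //.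
  exact: measurable_funM.
have F30 w : (0 <= F3 w)%E by rewrite lee_fin !mulr_ge0// class_mass_ge0.
pose F4 (w : T * T) := F3 (w.2, w.1).
have mF4 : measurable_fun setT F4.
  exact: (measurableT_comp mF3 (@measurable_swap_pair _ T)).
pose D x := (\int[k x]_y F4 (x, y))%E.
have mD : measurable_fun setT D.
  exact: (measurable_kernel_integral k mF4 (fun w => F30 _)).
have D0 x : (0 <= D x)%E by apply: integral_ge0 => y _; exact: F30.
transitivity (\int[mu]_x D (psi x))%E.
  apply: ge0_ae_eq_integral => //.
  - exact: (measurable_fun_integral_kernel (measurable_kernel k) (fun x => phi10 (psi x)) mphi1p).
  - exact: (measurableT_comp mD mpsi).
  - by move=> x _; apply: integral_ge0 => y _; exact: phi10.
  - apply: filterS concX => z kz _.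
    pose F5 (w : T * T) := (\1_B w.2 * \1_E (w.1, phi w.2))%:E : \bar R.
    have mF5 : measurable_fun setT F5.
      apply/measurable_EFinP; apply: measurable_funM.
        exact: (measurableT_comp mI measurable_snd).
      apply: (@measurableT_comp _ _ _ _ _ _ (\1_E : T * T -> R)).
        exact: measurable_indic.
      apply/measurable_fun_pairP; split; first exact: measurable_fst.
      exact: (measurableT_comp mphi measurable_snd).
    have F50 w : (0 <= F5 w)%E by rewrite lee_fin mulr_ge0.
    transitivity (\int[k z]_w \int[k (psi z)]_y F5 (w, y))%E.
      apply: (ae_kernel_class mX) => //.
      + have [h1 _] := probability_fubini (@prob_kernel _ _ _ _ _ k z)
          (@prob_kernel _ _ _ _ _ k (psi z)) mF5 F50.
        exact: h1.
      + by move=> w; exact: phi10.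
      + by move=> w; apply: integral_ge0 => y _; exact: F50.
      + move=> w Xzw /=.
        have Xp : X (psi z, psi w) by apply: Xphi; rewrite /pull/= !psiK.
        rewrite /phi1 -(eq_kernel_integral kX _ Xp).
        apply: eq_integral => y _; rewrite /F2 /F1 /F5/=.
        rewrite (swap _ _ pP); congr (_ * _)%:E.
        by rewrite !indicE /pull; congr (nat_of_bool _)%:R;
          apply/idP/idP => /set_mem/= h; apply/mem_set => /=; rewrite ?psiK // in h *.
    rewrite (kernel_fubini k _ _ mF5 F50) /D.
    apply: eq_integral => y _.
    rewrite /F5/= kernel_integralZ//; last exact: measurable_relation2.
    rewrite inner// -EFinM /F4 /F3/=; congr (_%:E).
    rewrite (swap _ _ pPX).
    have -> : \1_(pull phi X) (psi z, y) = \1_X (z, phi y) :> R.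
      by rewrite !indicE /pull; congr (nat_of_bool _)%:R;
          apply/idP/idP => /set_mem/= h; apply/mem_set => /=; rewrite ?psiK // in h *.
    by ring.
rewrite (integral_invariant mpsi invpsi mD D0).
rewrite (_ : (\int[mu]_x D x)%E = (\int[mu]_x \int[k x]_y F3 (y, x))%E)//.
rewrite -(mass_transport dis mX kX concX mF3 F30).
apply: eq_integral => x _; rewrite /F3 /= int_mul//; last first.
  by rewrite mulr_ge0// class_mass_ge0.
by congr (_%:E); ring.
Qed.

(** Uniqueness of conditional measures: [phi] carries the conditional measures
    on the classes of [pull phi X] to those on the classes of [X]. *)
Lemma ae_covariance :
  {ae mu, forall x, m (pull phi E) x = m (pull phi X) x * m E (phi x)}.
Proof.
have pP := per_pull mphi pE; have mP := per_measurable pP.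
have pPX := per_pull mphi pX; have mPX := per_measurable pPX.
have mEphi : measurable_fun setT (fun x => m E (phi x)).
  exact: (measurableT_comp (measurable_class_mass k mE) mphi).
have mu1 : measurable_fun setT (fun x => (m (pull phi E) x)%:E).
  exact/measurable_EFinP/measurable_class_mass.
have mu2 : measurable_fun setT
    (fun x => (m (pull phi X) x * m E (phi x))%:E).
  apply/measurable_EFinP; apply: measurable_funM => //.
  exact: measurable_class_mass.
have intB (u : T -> R) B : measurable B -> (\int[mu]_(x in B) (u x)%:E =
    \int[mu]_x (\1_B x * u x)%:E)%E.
  move=> mB; rewrite integral_mkcond; apply: eq_integral => x _.
  by rewrite patchE indicE; case: ifP => _; rewrite ?mul1r ?mul0r.
have h : ae_eq mu setT (fun x => (m (pull phi E) x)%:E)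
    (fun x => (m (pull phi X) x * m E (phi x))%:E).
  apply: integral_ae_eq => //.
  - apply: (@le_integrable _ _ _ mu setT measurableT _ (cst 1%E)) => //.
      move=> x _ /=; rewrite ger0_norm ?class_mass_ge0// normr1 lee_fin.
      exact: class_mass_le1.
    exact: finite_measure_integrable_cst.
  - by move=> B _ mB; rewrite (intB _ _ mB) [RHS](intB _ _ mB); exact: test.
by apply: filterS h => x /(_ I) [].
Qed.

End covariance.
End class_mass_dynamics.

(** * Conditional information along a shifted family of relations *)

Section relation_array.
Context d (T : measurableType d) (R : realType) (mu : probability T R).
Variable k : R.-pker T ~> T.
Hypothesis dis : forall A : set T, measurable A ->
  mu A = (\int[mu]_x k x A)%E.
Variable X : set (T * T).
Hypothesis pX : is_per X.
Hypothesis kX : forall x y, X (x, y) ->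
  forall A : set T, measurable A -> k x A = k y A.
Hypothesis concX : {ae mu, forall x, k x (~` xsection X x) = 0%E}.
Let mX := per_measurable pX.
Local Notation m := (class_mass k).

(** A set all of whose points lie in a [P]-class of positive mass in which it
    is null: its mass is the integral over its points of the normalised mass of
    their classes, and Fubini's theorem integrates each class to 0. *)
Lemma null_of_null_classes x (Z : set T) (P : set (T * T)) :
  measurable Z -> Z `<=` xsection X x -> is_per P ->
  (forall y, Z y -> 0 < m P y) ->
  (forall y, Z y -> k x (Z `&` xsection P y) = 0%E) -> k x Z = 0%E.
Proof.
move=> mZ ZX pP P0 ZP; have mP := per_measurable pP.
have mIZ : measurable_fun setT (\1_Z : T -> R) by exact: measurable_indic.
have mV : measurable_fun setT (fun y => (m P y)^-1).
  apply: measurable_inv_ge0; first exact: measurable_class_mass.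
  by move=> y; exact: class_mass_ge0.
have V0 y : 0 <= (m P y)^-1 by rewrite invr_ge0 class_mass_ge0.
pose F (w : T * T) := (\1_Z w.1 * (m P w.1)^-1 * \1_P w)%:E : \bar R.
have mF : measurable_fun setT F.
  apply/measurable_EFinP; apply: measurable_funM; last exact: measurable_indic.
  apply: (@measurableT_comp _ _ _ _ _ _ (fun y => \1_Z y * (m P y)^-1)) => //.
  exact: measurable_funM.
have F0 w : (0 <= F w)%E by rewrite lee_fin !mulr_ge0.
have -> : k x Z = (\int[k x]_y \int[k x]_w F (y, w))%E.
  rewrite -[Z in LHS]setIT -integral_indic//; apply: eq_integral => y _.
  rewrite /F/=.
  have [Zy|nZy] := pselect (Z y); last first.
    by rewrite (indic_notin _ nZy) integral0_eq// => w _; rewrite !mul0r.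
  have /xsectionP Xxy := ZX _ Zy.
  rewrite kernel_integralZ ?mulr_ge0//; last exact: measurable_relation1.
  rewrite (class_mass_integral_other kX)// -EFinM (indic_in _ Zy) mul1r.
  by rewrite mulVf// gt_eqF// P0.
rewrite (kernel_fubini k _ _ mF F0); apply: integral0_eq => w _.
have [[y0 [Zy0 Py0w]]|no] := pselect (exists y0, Z y0 /\ P (y0, w)); last first.
  apply: integral0_eq => y _; rewrite /F/=.
  have [Zy|nZy] := pselect (Z y); last by rewrite (indic_notin _ nZy) !mul0r.
  by rewrite [\1_P _](indic_notin) ?mulr0// => Pyw; apply: no; exists y.
have mN : measurable (Z `&` xsection P y0).
  by apply: measurableI => //; exact: measurable_xsection.
rewrite (@ge0_ae_eq_integral _ _ _ (k x) setT _ (cst 0%E)) ?integral0//.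
  exact: measurable_fun_pair1.
exists (Z `&` xsection P y0); split => //; first exact: ZP.
move=> y /= ny; apply: contrapT => nZP; apply: ny => _; rewrite /F/=.
have [Zy|nZy] := pselect (Z y); last by rewrite (indic_notin _ nZy) !mul0r.
rewrite [\1_P _](indic_notin) ?mulr0// => Pyw; apply: nZP; split => //.
apply/xsectionP; exact: (per_trans pP Py0w (per_sym pP Pyw)).
Qed.

(** If classes of [P] and of [Q] have positive mass, then there are countably
    many of each, hence countably many classes of [P `&` Q], and the null ones
    have a null union; [null_of_null_classes], used twice, replaces the
    counting. *)
Lemma class_mass_gt0I (P Q : set (T * T)) : is_per P -> is_per Q ->
  P `<=` X ->
  {ae mu, forall x, 0 < m P x} -> {ae mu, forall x, 0 < m Q x} ->
  {ae mu, forall x, 0 < m (P `&` Q) x}.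
Proof.
move=> pP pQ PX P0 Q0.
have pPQ := perI pP pQ; have mPQ := per_measurable pPQ.
have PQX : P `&` Q `<=` X by move=> w [/PX].
pose Z := [set x | 0 < m P x] `&` [set x | 0 < m Q x] `&`
  ~` [set x | 0 < m (P `&` Q) x].
have mpos E : measurable E -> measurable [set x | 0 < m E x].
  move=> mE; rewrite (_ : [set x | _] = m E @^-1` `]0, +oo[); last first.
    by apply/seteqP; split => x/=; rewrite in_itv/= andbT.
  by rewrite -[X in measurable X]setTI; exact: measurable_class_mass.
have mZ : measurable Z.
  apply: measurableI; last exact/measurableC/mpos.
  by apply: measurableI; apply: mpos; exact: per_measurable.
have Z0 : mu Z = 0%E.
  rewrite dis//.
  rewrite (@ge0_ae_eq_integral _ _ _ mu setT _ (cst 0%E)) ?integral0//.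
    exact: measurable_kernel.
  apply: filterS concX => x kx _.
  have mXx : measurable (xsection X x) by exact: measurable_xsection.
  rewrite (_ : k x Z = k x (Z `&` xsection X x)); last first.
    rewrite (measureDI _ mZ mXx) [X in (X + _)%E](_ : _ = 0%E) ?add0e//.
    apply: (@subset_measure0 _ _ _ (k x) _ (~` xsection X x)) => //.
    - exact: measurableD.
    - exact: measurableC.
  apply: (@null_of_null_classes x _ P) => //.
  - exact: measurableI.
  - by move=> y [[[]]].
  move=> y [[[Py Qy] _] Xxy].
  have mPy : measurable (xsection P y).
    by apply: measurable_xsection; exact: per_measurable pP.
  apply: (@null_of_null_classes x _ Q) => //.
  - by apply: measurableI => //; exact: measurableI.
  - by move=> z [[]].
  - by move=> z [[[[]]]].
  move=> z [[[_ nz] /xsectionP Xxz] /xsectionP Pyz].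
  have mPQz : measurable (xsection (P `&` Q) z) by exact: measurable_xsection.
  apply: (@subset_measure0 _ _ _ (k x) _ (xsection (P `&` Q) z)) => //.
  - apply: measurableI; last by apply: measurable_xsection; exact: per_measurable pQ.
    by apply: measurableI => //; exact: measurableI.
  - move=> w [[_ /xsectionP Pyw] /xsectionP Qzw]; apply/xsectionP; split => //.
    exact: (per_trans pP (per_sym pP Pyz) Pyw).
  - transitivity (k z (xsection (P `&` Q) z)); first exact: kX.
    rewrite -class_massE//; congr (_%:E).
    apply/eqP; rewrite eq_le class_mass_ge0 andbT leNgt.
    exact/negP.
have ZN : {ae mu, forall x, ~ Z x}.
  by exists Z; split => // x /= /contrapT.
move: P0 Q0 ZN; apply: filterS3 => x Px Qx nZ.
by apply: contrapT => nPQ; apply: nZ; split.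
Qed.

Variables f finv : T -> T.
Hypotheses (mf : measurable_fun setT f) (mfinv : measurable_fun setT finv).
Hypotheses (fK : cancel f finv) (finvK : cancel finv f).
Hypothesis inv : forall A : set T, measurable A -> mu (f @^-1` A) = mu A.
Hypothesis erg : forall A : set T, measurable A -> f @^-1` A = A ->
  mu A = 0%E \/ mu A = 1%E.
Hypothesis fX : pull f X `<=` X.

Lemma pull_iter_sub n : pull (iter n f) X `<=` X.
Proof.
elim: n => [|n ih] [x y]//.
by move=> h; apply: ih; apply: fX; exact: h.
Qed.

Lemma ae_covariance_iter n (E : set (T * T)) : is_per E -> E `<=` X ->
  {ae mu, forall x, m (pull (iter n f) E) x =
    m (pull (iter n f) X) x * m E (iter n f x)}.
Proof.
move=> pE EX.
apply: (@ae_covariance _ _ _ mu k dis X pX kX concX (iter n f) (iter n finv)) => //.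
- exact: measurable_iter.
- exact: measurable_iter.
- exact: iter_cancel.
- exact: iter_cancel.
- move=> A mA; elim: n => // n ih.
  rewrite (_ : iter n.+1 f @^-1` A = f @^-1` (iter n f @^-1` A)); last first.
    by apply/seteqP; split => x; rewrite /preimage/= -iterS iterSr.
  by rewrite inv// -[X in measurable X]setTI; exact: measurable_iter.
- exact: pull_iter_sub.
Qed.

Section array_of_relations.
(** [V s t] is a partition known from the past over a time [s] and the future
    over a time [t], and [C] the information that one more step reveals. *)
Variables (V : nat -> nat -> set (T * T)) (C : set (T * T)).
Hypotheses (pV : forall s t, is_per (V s t)) (pC : is_per C).
Hypothesis VX : forall s t, V s t `<=` X.
Hypothesis V_mono : forall s t s' t', (s <= s')%N -> (t <= t')%N ->
  V s' t' `<=` V s t.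
Hypothesis V_shift : forall s t, pull f (V s.+1 t) = C `&` V s t.+1.

Definition cond_prob s t x : R := m (C `&` V s t) x / m (V s t) x.
Definition cond_info s t x : R := - ln (cond_prob s t x).

Let pCV s t : is_per (C `&` V s t). Proof. exact: perI. Qed.
Let mCV s t : measurable (C `&` V s t). Proof. exact: per_measurable. Qed.
Let mV s t : measurable (V s t). Proof. exact: per_measurable. Qed.
Let CVX s t : C `&` V s t `<=` X. Proof. by move=> w [_ /VX]. Qed.

Lemma cond_prob_ge0 s t x : 0 <= cond_prob s t x.
Proof. by rewrite divr_ge0// class_mass_ge0. Qed.

Lemma cond_prob_le1 s t x : cond_prob s t x <= 1.
Proof.
have [m0|m0] := eqVneq (m (V s t) x) 0.
  by rewrite /cond_prob m0 invr0 mulr0 ler01.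
have mgt0 : 0 < m (V s t) x by rewrite lt_neqAle eq_sym m0 class_mass_ge0.
by rewrite ler_pdivrMr// mul1r le_class_mass.
Qed.

Lemma measurable_cond_prob s t : measurable_fun setT (cond_prob s t).
Proof.
apply: measurable_funM; first exact: measurable_class_mass.
apply: measurable_inv_ge0; first exact: measurable_class_mass.
by move=> x; exact: class_mass_ge0.
Qed.

Lemma measurable_cond_info s t : measurable_fun setT (cond_info s t).
Proof.
apply: measurable_funN; apply: (measurableT_comp (@measurable_ln R)).
exact: measurable_cond_prob.
Qed.

Lemma cond_info_ge0 s t x : 0 <= cond_info s t x.
Proof. by rewrite oppr_ge0 ln_le0// cond_prob_le1. Qed.

Lemma cond_prob_eq s t S U x y : (s <= S)%N -> (t <= U)%N ->
  (C `&` V S U) (x, y) -> cond_prob s t x = cond_prob s t y.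
Proof.
move=> sS tU [Cxy /(V_mono sS tU) Vxy]; rewrite /cond_prob.
rewrite (class_mass_eq kX (pCV s t) (@CVX s t) (conj Cxy Vxy)).
by rewrite (class_mass_eq kX (pV s t) (@VX s t) Vxy).
Qed.

(** Knowing [V] at time [j.+1] from its past includes what one step revealed at
    time 0, and the window seen from there. *)
Lemma V_back j s t x y : V (s + j.+1)%N t (x, y) ->
  (C `&` V s (t + j.+1)%N) (iter j.+1 finv x, iter j.+1 finv y).
Proof.
elim: j t x y => [|j ih] t x y.
  by rewrite !addn1 -V_shift /pull/= !finvK.
rewrite addnS => Vxy.
have : pull f (V (s + j.+1).+1 t) (finv x, finv y) by rewrite /pull/= !finvK.
rewrite V_shift => -[_ /ih].
by rewrite addSnnS -!iterSr.
Qed.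

(** Seen from time [l], the factors before time [l] are constant on the classes
    of [V (S + l) (U + (n.-1 - l))], so that [ratio_integral_le] absorbs the
    factor of time [l]. *)
Lemma chain_integral_le n S U (s t : nat -> nat) :
  (forall i, (i < n)%N -> (s i <= S + i)%N /\ (t i <= U + (n.-1 - i))%N) ->
  (\int[mu]_x (\prod_(i < n) (cond_prob (s i) (t i) (iter i f x) /
     cond_prob (S + i)%N (U + (n.-1 - i))%N (iter i f x)))%:E <= 1)%E.
Proof.
move=> st.
pose phi i x := cond_prob (s i) (t i) x / cond_prob (S + i)%N (U + (n.-1 - i))%N x.
apply: (orbit_product_integral_le (phi := phi) mf mfinv fK inv).
- move=> i; apply: measurable_funM; first exact: measurable_cond_prob.
  apply: measurable_inv_ge0; first exact: measurable_cond_prob.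
  by move=> x; exact: cond_prob_ge0.
- by move=> i x; rewrite divr_ge0// cond_prob_ge0.
move=> l G ln mG G0 GE; have [sn tn] := st l ln.
apply: (@ratio_integral_le _ _ _ mu k dis X mX kX concX C
  (V (S + l) (U + (n.-1 - l))) (V (s l) (t l)) G) => //.
- exact: V_mono.
- move=> x y Vxy; rewrite !GE; apply: eq_bigr => -[i il] _ /=.
  rewrite !(iter_back _ finvK il) /phi.
  have : V (S + i + (l - i.+1).+1)%N (U + (n.-1 - l))%N (x, y).
    by rewrite -addnA (_ : (i + (l - i.+1).+1 = l)%N)//; lia.
  move=> /V_back.
  rewrite (_ : (U + (n.-1 - l) + (l - i.+1).+1 = U + (n.-1 - i))%N); last by lia.
  move=> CV; have [si ti] := st i (ltn_trans il ln).
  congr (_ / _); first exact: (cond_prob_eq si ti CV).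
  exact: (cond_prob_eq (leqnn _) (leqnn _) CV).
Qed.

Hypothesis pos : forall s t, {ae mu, forall x, 0 < m (C `&` V s t) x}.

Lemma ae_cond_prob_gt0 s t : {ae mu, forall x, 0 < cond_prob s t x}.
Proof.
move: (pos s t); apply: filterS => x mx; rewrite divr_gt0//.
by rewrite (lt_le_trans mx)// le_class_mass.
Qed.

Lemma cond_info_chain n S U (s t : nat -> nat) :
  (forall i, (i < n)%N -> (s i <= S + i)%N /\ (t i <= U + (n.-1 - i))%N) ->
  (\int[mu]_x (expR (\sum_(i < n) cond_info (S + i)%N (U + (n.-1 - i))%N (iter i f x)
                 - \sum_(i < n) cond_info (s i) (t i) (iter i f x)))%:E <= 1)%E.
Proof.
move=> st; apply: le_trans (chain_integral_le st).
rewrite le_eqVlt; apply/orP; left; apply/eqP.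
have mi (a : nat -> nat -> T -> R) (u v : nat -> nat) i :
    (forall s t, measurable_fun setT (a s t)) ->
    measurable_fun setT (fun x => a (u i) (v i) (iter i f x)).
  by move=> ma; apply: (measurableT_comp (ma _ _)); exact: measurable_iter.
have mS (u v : nat -> nat) : measurable_fun setT
    (fun x => \sum_(i < n) cond_info (u i) (v i) (iter i f x)).
  by apply: measurable_sum => i; apply: mi; exact: measurable_cond_info.
apply: ge0_ae_eq_integral => //.
- apply/measurable_EFinP; apply: measurableT_comp => //.
  exact: (measurable_funB (mS (fun i => S + i)%N (fun i => U + (n.-1 - i))%N) (mS s t)).
- apply/measurable_EFinP; apply: measurable_prod => i _.
  apply: measurable_funM; first exact/(mi cond_prob)/measurable_cond_prob.
  apply: measurable_inv_ge0; last by move=> x; exact: cond_prob_ge0.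
  exact/(mi cond_prob (fun i => S + i)%N (fun i => U + (n.-1 - i))%N)/measurable_cond_prob.
- by move=> x _; rewrite lee_fin prodr_ge0// => i _; rewrite divr_ge0// cond_prob_ge0.
have A i : {ae mu, forall x, forall s t, 0 < cond_prob s t (iter i f x)}.
  apply: (ae_iter mf inv i (P := fun x => forall s t, 0 < cond_prob s t x)).
  by apply: ae_foralln => s'; apply: ae_foralln => t'; exact: ae_cond_prob_gt0.
have := ae_foralln A; apply: filterS => x {}A _; congr (_%:E).
rewrite -sumrB expR_sum; apply: eq_bigr => i _.
by rewrite /cond_info opprK addrC expRB !lnK// posrE A.
Qed.

Hypothesis posX : forall n, {ae mu, forall x, 0 < m (pull (iter n f) X) x}.

(** The chain rule: [C] joined with the window at time [i] is the window at
    time [i.+1], pulled back by one step, so that the sum telescopes. *)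
Lemma ae_array_sumE n : {ae mu, forall x, array_sum f cond_info n x =
  - ln (m (pull (iter n f) (V n 0)) x) + ln (m (V 0 n) x)}.
Proof.
have A1 i := ae_covariance_iter i (pV i (n - i)) (@VX i (n - i)%N).
have A2 i := ae_covariance_iter i (pCV i (n - i)) (@CVX i (n - i)%N).
have A3 i : {ae mu, forall x, 0 < m (C `&` V i (n - i)) (iter i f x)}.
  exact: (ae_iter mf inv i (pos i (n - i))).
have A4 i : {ae mu, forall x,
    [/\ m (pull (iter i f) (V i (n - i))) x =
          m (pull (iter i f) X) x * m (V i (n - i)) (iter i f x) ,
        m (pull (iter i f) (C `&` V i (n - i))) x =
          m (pull (iter i f) X) x * m (C `&` V i (n - i)) (iter i f x),
        0 < m (pull (iter i f) X) x &
        0 < m (C `&` V i (n - i)) (iter i f x)]}.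
  have A12 : {ae mu, forall x,
    m (pull (iter i f) (V i (n - i))) x =
      m (pull (iter i f) X) x * m (V i (n - i)) (iter i f x) /\
    m (pull (iter i f) (C `&` V i (n - i))) x =
      m (pull (iter i f) X) x * m (C `&` V i (n - i)) (iter i f x)}.
    by move: (A1 i) (A2 i); apply: filterS2 => x; split.
  by move: A12 (posX i) (A3 i); apply: filterS3 => x [? ?]; split.
have := ae_foralln A4; apply: filterS => x {}A4.
pose L i := - ln (m (pull (iter i f) (V i (n - i))) x).
rewrite (_ : ln (m (V 0 n) x) = - L 0%N); last first.
  rewrite /L opprK subn0; congr (ln (m _ x)).
  by apply/seteqP; split => -[].
rewrite (_ : - ln _ = L n); last by rewrite /L subnn.
rewrite /array_sum -(big_mkord xpredT (fun i => cond_info i (n - i) (iter i f x))).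
apply: (telescope_sumr_eq L) => // i /= ni.
have [e1 e2 a0 c0] := A4 i.
have v0 : 0 < m (V i (n - i)) (iter i f x).
  by rewrite (lt_le_trans c0)// le_class_mass.
have -> : L i.+1 = - ln (m (pull (iter i f) (C `&` V i (n - i))) x).
  rewrite /L; congr (- ln (m _ x)).
  rewrite (_ : (n - i = (n - i.+1).+1)%N); last by lia.
  by rewrite -V_shift.
rewrite /L e1 e2 /cond_info /cond_prob ln_div ?posrE//.
rewrite !lnM ?posrE//; ring.
Qed.

Hypothesis fin00 : (\int[mu]_x (cond_info 0 0 x)%:E < +oo)%E.

Definition relation_info n x : R :=
  - ln (m (pull (iter n f) (V n 0)) x) + ln (m (V 0 n) x).

Theorem relation_smb : exists b : R,
  [/\ {ae mu, forall x, n%:R^-1 * relation_info n x @[n --> \oo] --> b},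
      (forall n, (\int[mu]_x (array_sum f cond_info n x)%:E < +oo)%E) &
      n%:R^-1 * fine (\int[mu]_x (array_sum f cond_info n x)%:E)%E
        @[n --> \oo] --> b].
Proof.
have ch := cond_info_chain.
exists (array_rate mu cond_info); split.
- have := ae_cvg_array_sum mf inv erg measurable_cond_info cond_info_ge0 fin00 ch.
  move: (ae_foralln ae_array_sumE); apply: filterS2 => x e.
  by rewrite /relation_info; under eq_fun do rewrite e.
- exact: (integral_array_sum_fin mf inv measurable_cond_info cond_info_ge0 fin00 ch).
- exact: (cvg_integral_array_sum mf inv measurable_cond_info cond_info_ge0 fin00 ch).
Qed.

End array_of_relations.
End relation_array.

(** * Names of an orbit *)

Section windows.
Context d (T : measurableType d) (R : realType) (mu : probability T R).
Variable k : R.-pker T ~> T.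
Hypothesis dis : forall A : set T, measurable A ->
  mu A = (\int[mu]_x k x A)%E.
Variable X : set (T * T).
Hypothesis pX : is_per X.
Hypothesis kX : forall x y, X (x, y) ->
  forall A : set T, measurable A -> k x A = k y A.
Hypothesis concX : {ae mu, forall x, k x (~` xsection X x) = 0%E}.
Let mX := per_measurable pX.
Local Notation m := (class_mass k).
Variables f finv : T -> T.
Hypotheses (mf : measurable_fun setT f) (mfinv : measurable_fun setT finv).
Hypotheses (fK : cancel f finv) (finvK : cancel finv f).
Hypothesis inv : forall A : set T, measurable A -> mu (f @^-1` A) = mu A.
Hypothesis erg : forall A : set T, measurable A -> f @^-1` A = A ->
  mu A = 0%E \/ mu A = 1%E.
Hypothesis fX : pull f X `<=` X.

Let inv_finv (A : set T) : measurable A -> mu (finv @^-1` A) = mu A.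
Proof. exact: (invariant_inverse mfinv fK inv). Qed.

Variable A : set (T * T).
Hypothesis pA : is_per A.
Hypothesis posX1 : {ae mu, forall x, 0 < m (pull f X) x}.
Hypothesis posA : {ae mu, forall x, 0 < m (A `&` X) x}.

(** The class of [X] together with the [A]-names from time [- s] to time [t]. *)
Definition window s t : set (T * T) := [set w | X w /\
  (forall i, (i < s)%N -> pull (iter i.+1 finv) A w) /\
  (forall i, (i < t)%N -> pull (iter i f) A w)].
Local Notation W := window.

Let windowE s t : W s t = X `&` (\bigcap_(i in [set i | (i < s)%N])
  pull (iter i.+1 finv) A `&` \bigcap_(i in [set i | (i < t)%N]) pull (iter i f) A).
Proof. by []. Qed.

Lemma per_window s t : is_per (W s t).
Proof.
have pAf i : is_per (pull (iter i f) A).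
  by apply: per_pull => //; exact: measurable_iter.
have pAg i : is_per (pull (iter i.+1 finv) A).
  by apply: per_pull => //; exact: measurable_iter.
split.
- rewrite windowE; apply: measurableI => //; apply: measurableI.
  + by apply: bigcap_measurableType => i _; exact: per_measurable.
  + by apply: bigcap_measurableType => i _; exact: per_measurable.
- move=> x y [Xxy [Ag Af]]; split; first exact: (per_sym pX).
  by split => i ii; [exact: (per_sym (pAg i) (Ag i ii))|
                     exact: (per_sym (pAf i) (Af i ii))].
- move=> x y z [Xxy [Ag Af]] [Xyz [Ag' Af']].
  split; first exact: (per_trans pX Xxy Xyz).
  by split => i ii; [exact: (per_trans (pAg i) (Ag i ii) (Ag' i ii))|
                     exact: (per_trans (pAf i) (Af i ii) (Af' i ii))].
Qed.

Lemma window_sub s t : W s t `<=` X.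
Proof. by move=> w []. Qed.

Lemma window_mono s t s' t' : (s <= s')%N -> (t <= t')%N ->
  W s' t' `<=` W s t.
Proof.
move=> ss tt w [Xw [Ag Af]]; split => //; split => i ii.
  by apply: Ag; exact: leq_trans ii ss.
by apply: Af; exact: leq_trans ii tt.
Qed.

Lemma window00 : W 0 0 = X.
Proof. by apply/seteqP; split=> [w []//|w Xw]; split. Qed.

Let X1 := pull f X.
Let pX1 : is_per X1. Proof. exact: per_pull. Qed.
Let mX1 := per_measurable pX1.

Lemma window_shift s t : pull f (W s.+1 t) = X1 `&` W s t.+1.
Proof.
apply/seteqP; split => -[x y].
- move=> [Xf [Ag Af]]; split => //; split; first exact: fX.
  split => i ii.
    by have := Ag i.+1 ii; rewrite /pull/= -!iterS !(iterSr i.+1) !fK.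
  case: i ii => [_|i ii].
    by have := Ag 0%N (ltn0Sn _); rewrite /pull/= !fK.
  by have := Af i ii; rewrite /pull/= -!iterSr.
- move=> [Xf [Xxy [Ag Af]]]; split => //; split => i ii.
    case: i ii => [_|i ii].
      by rewrite /pull/= !fK; exact: (Af 0%N (ltn0Sn _)).
    by have := Ag i ii; rewrite /pull/= -!iterS !(iterSr i.+1) !fK.
  by have := Af i.+1 ii; rewrite /pull/= -!iterSr.
Qed.

Lemma window_shift0 s : pull f (W s.+1 0) = (A `&` X1) `&` W s 0.
Proof.
rewrite window_shift; apply/seteqP; split => -[x y].
- move=> [Xf [Xxy [Ag Af]]]; split; last by split.
  by split => //; exact: (Af 0%N (ltn0Sn _)).
- move=> [[Axy Xf] [Xxy [Ag _]]]; split => //; split => //; split => //.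
  by case.
Qed.

(** All that is learnt in [n] steps: the class of [X] at time [n] and the
    [A]-names in between. *)
Let D n : set (T * T) := [set w | pull (iter n f) X w /\
  forall i, (i < n)%N -> pull (iter i f) A w].

Let DS n : D n.+1 = (A `&` X) `&` pull f (D n).
Proof.
apply/seteqP; split => -[x y].
- move=> [Xn An].
  have Xf : X (f x, f y).
    have : pull (iter n f) X (f x, f y) by move: Xn; rewrite /pull/= -!iterS !iterSr.
    exact: (pull_iter_sub fX).
  split; first by split; [exact: (An 0%N (ltn0Sn _))|exact: fX].
  split; first by move: Xn; rewrite /pull/= -!iterS !iterSr.
  by move=> i ii; have := An i.+1 ii; rewrite /pull/= -!iterS !iterSr.
- move=> [[Axy Xxy] [Xn An]]; split.
    by move: Xn; rewrite /pull/= -!iterS !iterSr.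
  move=> [_|i ii]//.
  by have := An i ii; rewrite /pull/= -!iterS !iterSr.
Qed.

Let DX n : D n `<=` X.
Proof. by move=> w [/(pull_iter_sub fX)]. Qed.

Let pD n : is_per (D n).
Proof.
elim: n => [|n ih].
  rewrite (_ : D 0 = X)//.
  by apply/seteqP; split => [[x y] []//|[x y] Xxy]; split.
by rewrite DS; apply: perI; [exact: perI|exact: per_pull].
Qed.

Let cov := ae_covariance_iter dis pX kX concX mf mfinv fK finvK inv fX.

Let massX : {ae mu, forall x, m X x = 1}.
Proof.
apply: filterS concX => x kx.
have mXx : measurable (xsection X x) by exact: measurable_xsection.
apply: EFin_inj; rewrite class_massE//.
have h : (k x setT = k x (xsection X x) + k x (~` xsection X x))%E.
  rewrite -measureU ?setUv//; first exact: measurableC.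
  by rewrite setICr.
by rewrite -(@prob_kernel _ _ _ _ _ k x) h kx adde0.
Qed.

Let posD n : {ae mu, forall x, 0 < m (D n) x}.
Proof.
elim: n => [|n ih].
  rewrite (_ : D 0 = X); last first.
    by apply/seteqP; split => [[x y] []//|[x y] Xxy]; split.
  by apply: filterS massX => x ->.
rewrite DS; apply: (class_mass_gt0I dis pX kX concX (perI pA pX)
  (per_pull mf (pD n)) _ posA); first by move=> w [].
have := cov 1 (pD n) (@DX n).
have ihf := @ae_iter _ _ _ mu f mf inv (fun x => 0 < m (D n) x) 1 ih.
move: posX1 ihf; apply: filterS3 => x x1 Dx.
by move=> /=->; rewrite mulr_gt0.
Qed.

(** The relation seen from time [- s] contains [D (s + t.+1)], whose classes
    have positive mass by induction, one step at a time. *)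
Lemma window_mass_gt0 s t : {ae mu, forall x, 0 < m (X1 `&` W s t) x}.
Proof.
have pE : is_per (X1 `&` W s t) by apply: perI => //; exact: per_window.
have EX : X1 `&` W s t `<=` X by move=> w [_ []].
have DE : D (s + t.+1) `<=` pull (iter s f) (X1 `&` W s t).
  move=> [x y] [Xn An].
  have Xs1 : X (f (iter s f x), f (iter s f y)).
    have := @pull_iter_sub _ _ _ f fX t (f (iter s f x), f (iter s f y)).
    rewrite /pull/= -!iterS -!iterD; apply.
    by move: Xn; rewrite /pull/= addnC !addSnnS.
  split => //; split; first exact: fX.
  split => i ii.
  - have := An (s - i.+1)%N; rewrite /pull/= -!iterS.
    have e z : iter i.+1 finv (iter s f z) = iter (s - i.+1) f z.
      by rewrite -{1}(subnKC ii) iterD (iter_cancel _ fK).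
    by rewrite !e; apply; lia.
  - have := An (i + s)%N; rewrite /pull/= !iterD; apply; lia.
have h1 : {ae mu, forall x, 0 < m (X1 `&` W s t) (iter s f x)}.
  move: (posD (s + t.+1)) (cov s pE EX); apply: filterS2 => x Dx e.
  have : 0 < m (pull (iter s f) (X1 `&` W s t)) x.
    apply: lt_le_trans Dx _; apply: le_class_mass DE; first exact: per_measurable.
    by apply: measurable_pull; [exact: measurable_iter|exact: per_measurable].
  rewrite e lt_neqAle eq_sym mulf_eq0 negb_or => /andP[/andP[_ n0] _].
  by rewrite lt_neqAle eq_sym n0 class_mass_ge0.
have := @ae_iter _ _ _ mu finv mfinv inv_finv _ s h1.
by apply: filterS => x; rewrite (iter_cancel s finvK).
Qed.

Let posX n : {ae mu, forall x, 0 < m (pull (iter n f) X) x}.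
Proof.
apply: filterS (posD n) => x /lt_le_trans; apply.
apply: le_class_mass; first exact: per_measurable.
  by apply: measurable_pull => //; exact: measurable_iter.
by move=> w [].
Qed.

(** Given the past names only, one step reveals the name at time 0 and the class
    of [X] at time 1. *)
Let V1 (s t : nat) := W s 0.
Let C1 := A `&` X1.
Let pC1 : is_per C1. Proof. exact: perI. Qed.

Let pos1 s t : {ae mu, forall x, 0 < m (C1 `&` V1 s t) x}.
Proof.
apply: filterS (window_mass_gt0 s 1) => x /lt_le_trans; apply.
apply: le_class_mass.
- by apply: measurableI => //; apply: per_measurable; exact: per_window.
- by apply: measurableI; apply: per_measurable => //; exact: per_window.
- move=> [y z] [Xf w]; split; last exact: (window_mono _ _ w).
  by split => //; have [_ [_ /(_ 0%N (ltn0Sn _))]] := w.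
Qed.

Hypothesis finX1 : (\int[mu]_x (- ln (m (pull f X) x))%:E < +oo)%E.
Hypothesis finA : (\int[mu]_x (- ln (m (A `&` X) x))%:E < +oo)%E.

Let fin2 : (\int[mu]_x (cond_info k W X1 0 0 x)%:E < +oo)%E.
Proof.
apply: le_lt_trans finX1; apply: ae_le_integral_EFin.
- by apply: measurable_cond_info; [exact: per_window|exact: pX1].
- exact: measurable_class_info.
- by move=> x; apply: (@cond_info_ge0 _ _ _ k W X1); [exact: per_window|exact: pX1].
- by move=> x; exact: class_info_ge0.
apply: filterS massX => x m1; rewrite /cond_info /cond_prob window00 m1 divr1.
by rewrite (_ : X1 `&` X = X1)//; apply/seteqP; split => [w []//|w Xw]; split => //; exact: fX.
Qed.

(** Subadditivity of entropy. *)
Let finAX1 : (\int[mu]_x (- ln (m C1 x))%:E < +oo)%E.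
Proof.
have mAX : measurable (A `&` X) by apply: measurableI => //; exact: per_measurable.
have mC1 : measurable C1 by exact: per_measurable.
pose u x := - ln (m (A `&` X) x) + - ln (m X1 x).
have mu_ : measurable_fun setT u by apply: measurable_funD; exact: measurable_class_info.
apply: (@le_lt_trans _ _ (\int[mu]_x (u x)%:E)%E); last first.
  rewrite ge0_integralD_EFin; [by rewrite lte_add_pinfty| | | |].
  - exact: measurable_class_info.
  - exact: measurable_class_info.
  - by move=> x; exact: class_info_ge0.
  - by move=> x; exact: class_info_ge0.
apply: gibbs => //.
- exact: measurable_class_info.
- by move=> x; rewrite addr_ge0//; exact: class_info_ge0.
- by move=> x; exact: class_info_ge0.
(* conditioning [A] on [X1] rather than on [X] lowers its entropy *)
have := @ratio_integral_le _ _ _ mu k dis X mX kX concX A X1 X (cst 1)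
  pA pX1 pX fX (fun w Xw => Xw) (measurable_cst _) (fun _ => ler01) (fun _ _ _ => erefl).
rewrite integral_cst_probability; apply: le_trans.
rewrite le_eqVlt; apply/orP; left; apply/eqP.
apply: ge0_ae_eq_integral => //.
- apply/measurable_EFinP; apply: measurableT_comp => //.
  by apply: measurable_funB => //; exact: measurable_class_info.
- have mdiv E F : measurable E -> measurable F -> measurable_fun setT (fun x => m E x / m F x).
    move=> mE mF; apply: measurable_funM; first exact: measurable_class_mass.
    apply: measurable_inv_ge0; first exact: measurable_class_mass.
    by move=> x; exact: class_mass_ge0.
  apply/measurable_EFinP; apply: measurable_funM => //; apply: measurable_funM.
    exact: mdiv.
  apply: measurable_inv_ge0; first exact: mdiv.
  by move=> x; rewrite divr_ge0// class_mass_ge0.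
- by move=> x _; rewrite lee_fin !mulr_ge0// ?invr_ge0 ?mulr_ge0 ?invr_ge0 ?class_mass_ge0.
have posC1 : {ae mu, forall x, 0 < m C1 x}.
  apply: filterS (pos1 0 0) => x; rewrite /V1 window00.
  rewrite (_ : C1 `&` X = C1)//.
  by apply/seteqP; split => [w []//|w Xw]; split => //; exact: (fX Xw.2).
have pp : {ae mu, forall x, 0 < m C1 x /\ m X x = 1}.
  by move: posC1 massX; apply: filterS2 => x; split.
move: pp posX1 posA; apply: filterS3 => x [c0 x1] x0 a0 _; congr (_%:E).
rewrite mul1r x1 divr1 /u invf_div.
rewrite opprD !opprK !expRD expRN !lnK ?posrE// -/C1 -/X1.
by ring.
Qed.

Let fin1 : (\int[mu]_x (cond_info k V1 C1 0 0 x)%:E < +oo)%E.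
Proof.
apply: le_lt_trans finAX1; apply: ae_le_integral_EFin.
- by apply: measurable_cond_info => // s t; exact: per_window.
- by apply: measurable_class_info; exact: per_measurable.
- by move=> x; apply: (@cond_info_ge0 _ _ _ k V1 C1) => // s t; exact: per_window.
- by move=> x; apply: class_info_ge0; exact: per_measurable.
apply: filterS massX => x m1; rewrite /cond_info /cond_prob /V1 window00 m1 divr1.
rewrite (_ : C1 `&` X = C1)//.
by apply/seteqP; split => [w []//|w Xw]; split => //; exact: (fX Xw.2).
Qed.

(** The information of the [n] names given [X] is that of the names and of
    the class of [X] at time [n], minus that of the latter given the names.
    Both are sums along the orbit: with one step [A `&` pull f X] given past
    names, and with one step [pull f X] given past and future names. *)
Theorem window_smb : exists b : R,
  [/\ {ae mu, forall x, n%:R^-1 * - ln (m (W 0 n) x) @[n --> \oo] --> b},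
      (forall n, (\int[mu]_x (- ln (m (W 0 n) x))%:E < +oo)%E) &
      n%:R^-1 * fine (\int[mu]_x (- ln (m (W 0 n) x))%:E)%E @[n --> \oo] --> b].
Proof.
have smb := @relation_smb _ _ _ mu k dis X pX kX concX f finv mf mfinv fK finvK
  inv erg fX.
have teleE := @ae_array_sumE _ _ _ mu k dis X pX kX concX f finv mf mfinv fK finvK
  inv fX.
have pV1 s t : is_per (V1 s t) by exact: per_window.
have V1X s t : V1 s t `<=` X by exact: window_sub.
have V1m s t s' t' : (s <= s')%N -> (t <= t')%N -> V1 s' t' `<=` V1 s t.
  by move=> ss _; exact: window_mono.
have V1s s t : pull f (V1 s.+1 t) = C1 `&` V1 s t.+1 by exact: window_shift0.
have [b1 [ae1 f1 c1]] := smb V1 C1 pV1 pC1 V1X V1m V1s pos1 posX fin1.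
have e1 := teleE V1 C1 pV1 pC1 V1X V1s pos1 posX.
have [b2 [ae2 f2 c2]] := smb W X1 per_window pX1 window_sub window_mono
  window_shift window_mass_gt0 posX fin2.
have e2 := teleE W X1 per_window pX1 window_sub window_shift window_mass_gt0 posX.
have diff n : {ae mu, forall x, - ln (m (W 0 n) x) =
    relation_info k f V1 n x - relation_info k f W n x}.
  apply: filterS massX => x m1.
  by rewrite /relation_info /V1 window00 m1 ln1; ring.
have intE n : (\int[mu]_x (- ln (m (W 0 n) x))%:E +
    \int[mu]_x (array_sum f (cond_info k W X1) n x)%:E =
    \int[mu]_x (array_sum f (cond_info k V1 C1) n x)%:E)%E.
  have mW : measurable (W 0 n) by apply: per_measurable; exact: per_window.
  have mas (V : nat -> nat -> set (T * T)) C : (forall s t, is_per (V s t)) -> is_per C ->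
     measurable_fun setT (array_sum f (cond_info k V C) n).
    move=> pV pC; apply: measurable_sum => i.
    apply: measurableT_comp; last exact: measurable_iter.
    exact: measurable_cond_info.
  have as0 (V : nat -> nat -> set (T * T)) C x : (forall s t, is_per (V s t)) -> is_per C ->
     0 <= array_sum f (cond_info k V C) n x.
    by move=> pV pC; apply: sumr_ge0 => i _; exact: cond_info_ge0.
  rewrite -ge0_integralD_EFin.
  - apply: ge0_ae_eq_integral => //.
    + apply/measurable_EFinP; apply: measurable_funD; first exact: measurable_class_info.
      by apply: mas => //; exact: per_window.
    + by apply/measurable_EFinP; exact: mas.
    + move=> x _; rewrite lee_fin addr_ge0//; first exact: class_info_ge0.
      by apply: as0 => //; exact: per_window.
    + by move=> x _; rewrite lee_fin; exact: as0.
    move: (diff n) (e1 n) (e2 n); apply: filterS3 => x -> -> -> _.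
    by rewrite /relation_info subrK.
  - exact: measurable_class_info.
  - by apply: mas => //; exact: per_window.
  - by move=> x; exact: class_info_ge0.
  - by move=> x; apply: as0 => //; exact: per_window.
have finW n : (\int[mu]_x (- ln (m (W 0 n) x))%:E < +oo)%E.
  apply: le_lt_trans (f1 n); rewrite -intE leeDl//.
  apply: integral_EFin_ge0 => x; apply: sumr_ge0 => i _.
  by apply: (@cond_info_ge0 _ _ _ k W X1) => //; exact: per_window.
exists (b1 - b2); split => //.
- move: ae1 ae2 (ae_foralln diff); apply: filterS3 => x h1 h2 dx.
  under eq_fun do rewrite dx mulrBr.
  exact: cvgB.
- have fineE n : fine (\int[mu]_x (- ln (m (W 0 n) x))%:E)%E =
      fine (\int[mu]_x (array_sum f (cond_info k V1 C1) n x)%:E)%E -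
      fine (\int[mu]_x (array_sum f (cond_info k W X1) n x)%:E)%E.
    have ge0W : (0 <= \int[mu]_x (- ln (m (W 0 n) x))%:E)%E.
      apply: integral_EFin_ge0 => x; apply: class_info_ge0.
      by apply: per_measurable; exact: per_window.
    have ge02 : (0 <= \int[mu]_x (array_sum f (cond_info k W X1) n x)%:E)%E.
      apply: integral_EFin_ge0 => x; apply: sumr_ge0 => i _.
      by apply: (@cond_info_ge0 _ _ _ k W X1) => //; exact: per_window.
    have w1 : (\int[mu]_x (- ln (m (W 0 n) x))%:E)%E \is a fin_num.
      by rewrite (ge0_fin_numE ge0W).
    have w2 : (\int[mu]_x (array_sum f (cond_info k W X1) n x)%:E)%E \is a fin_num.
      by rewrite (ge0_fin_numE ge02).
    by rewrite -intE (fineD w1 w2) addrK.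
  under eq_fun do rewrite fineE mulrBr.
  exact: cvgB.
Qed.

End windows.

(** * Entropy bound from a coding with bounded memory *)

Lemma measurable_membership d (T : measurableType d) (I : finType)
    (U : I -> set T) (v : {ffun I -> bool}) : (forall i, measurable (U i)) ->
  measurable ((fun x => [ffun i => `[< U i x >]] : {ffun I -> bool}) @^-1` [set v]).
Proof.
move=> mU; rewrite (_ : _ @^-1` _ =
    \bigcap_(i in [set: I]) [set x | `[< U i x >] = v i]).
  apply: fin_bigcap_measurable; first exact: finite_finset.
  move=> i _; case: (v i).
    rewrite (_ : [set x | _] = U i)//.
    by apply/seteqP; split => x /= /asboolP.
  rewrite (_ : [set x | _] = ~` U i); first exact: measurableC.
  by apply/seteqP; split => x /= => [/negbT/asboolPn//|/asboolPn/negbTE].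
apply/seteqP; split => x /=; first by move=> <- i _ /=; rewrite ffunE.
by move=> h; apply/ffunP => i; rewrite ffunE; exact: (h i).
Qed.

Section finite_entropy.
Context d (T : measurableType d) (R : realType) (mu : probability T R).
Variable k : R.-pker T ~> T.
Hypothesis dis : forall A : set T, measurable A ->
  mu A = (\int[mu]_x k x A)%E.
Variable X : set (T * T).
Hypothesis pX : is_per X.
Hypothesis kX : forall x y, X (x, y) ->
  forall A : set T, measurable A -> k x A = k y A.
Hypothesis concX : {ae mu, forall x, k x (~` xsection X x) = 0%E}.
Let mX := per_measurable pX.
Local Notation m := (class_mass k).
Variables f finv : T -> T.
Hypotheses (mf : measurable_fun setT f) (mfinv : measurable_fun setT finv).
Hypotheses (fK : cancel f finv) (finvK : cancel finv f).
Hypothesis inv : forall A : set T, measurable A -> mu (f @^-1` A) = mu A.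
Hypothesis fX : pull f X `<=` X.

Definition fiber_rel (G : finType) (gam : T -> G) : set (T * T) :=
  [set w | gam w.1 = gam w.2].

Section finite_partition.
Variables (G : finType) (gam : T -> G).
Hypothesis mgam : forall c, measurable (gam @^-1` [set c]).
Hypothesis gamX : forall x y, X (x, y) -> gam (finv x) = gam (finv y).
Local Notation Gam := (fiber_rel gam).

Lemma per_fiber_rel : is_per Gam.
Proof.
split.
- rewrite (_ : Gam = \bigcup_(c in [set: G])
      (gam @^-1` [set c] `*` gam @^-1` [set c])).
    by apply: fin_bigcup_measurable => // c _; exact: measurableX.
  apply/seteqP; split => -[x y] /=; first by move=> e; exists (gam x).
  by move=> [c _ [/= ex ey]]; rewrite /fiber_rel/= ex ey.
- by move=> x y; rewrite /fiber_rel/=; exact: esym.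
- by move=> x y z; rewrite /fiber_rel/=; exact: etrans.
Qed.

Let mGam := per_measurable per_fiber_rel.

Lemma measurable_fin_fun (u : G -> R) : measurable_fun setT (u \o gam).
Proof.
rewrite (_ : _ \o _ = fun x => \sum_(c : G) u c * \1_(gam @^-1` [set c]) x).
  apply: measurable_sum => c; apply: measurable_funM => //.
have gx x : (gam @^-1` [set gam x]) x by [].
apply/funext => x /=; rewrite (bigD1 (gam x))//= (indic_in _ (gx x)) mulr1.
rewrite big1 ?addr0// => c cx.
rewrite (indic_notin) ?mulr0//= => e.
by rewrite e eqxx in cx.
Qed.

Lemma fiber_massE x y : X (x, y) ->
  (m Gam y)%:E = k x (gam @^-1` [set gam y]).
Proof.
move=> Xxy; rewrite class_massE// (kX Xxy)//; congr (k y _).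
apply/seteqP; split => z; first by move=> /xsectionP.
by move=> e; apply/xsectionP; rewrite /fiber_rel/=.
Qed.

Lemma fiber_mass_gt0 : {ae mu, forall x, 0 < m Gam x}.
Proof.
pose Z := [set x | m Gam x = 0].
have mZ : measurable Z.
  rewrite (_ : Z = m Gam @^-1` [set 0])//.
  by rewrite -[X in measurable X]setTI; exact: measurable_class_mass.
have Z0 : mu Z = 0%E.
  rewrite dis// (@ge0_ae_eq_integral _ _ _ mu setT _ (cst 0%E)) ?integral0//.
    exact: measurable_kernel.
  apply: filterS concX => x kx _.
  pose U := \bigcup_(c in [set c : G | k x (gam @^-1` [set c]) = 0%E])
    gam @^-1` [set c].
  have mU : measurable U by exact: fin_bigcup_measurable.
  have U0 : k x U = 0%E.
    rewrite /U measure_fin_bigcup//; last first.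
      by move=> c c' _ _ [z [/= <- <-]].
      exact: finite_finset.
    by rewrite fsbig1.
  have mXx : measurable (xsection X x) by exact: measurable_xsection.
  apply: (@subset_measure0 _ _ _ (k x) Z (U `|` ~` xsection X x)) => //.
  - by apply: measurableU => //; exact: measurableC.
  - move=> y Zy; have [/xsectionP Xxy|nX] := pselect (xsection X x y); last by right.
    left; exists (gam y) => //=.
    by rewrite -(fiber_massE Xxy) Zy.
  - apply/eqP; rewrite eq_le measure_ge0 andbT.
    apply: (le_trans (measureU2 _ _ _)) => //; first exact: measurableC.
    have : (k x U + k x (~` xsection X x) <= 0)%E by rewrite U0 kx adde0.
    exact.
exists Z; split => // x /= /negP; rewrite -leNgt => h.
by apply/eqP; rewrite eq_le h class_mass_ge0.
Qed.

(** [Y i] is a subprobability on the values of [gam], that is, a guess of the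
    value of [gam] at time [i]. *)
Variable Y : (nat -> G -> R).
Hypothesis Y0 : forall i c, 0 <= Y i c.
Hypothesis Y1 : forall i, \sum_(c : G) Y i c <= 1.

Let phi i x := Y i (gam x) / m Gam x.
Let phi0 i x : 0 <= phi i x.
Proof. by rewrite divr_ge0// class_mass_ge0. Qed.

Let mphi i : measurable_fun setT (phi i).
Proof.
apply: measurable_funM; first exact: (measurable_fin_fun (Y i)).
apply: measurable_inv_ge0; first exact: measurable_class_mass.
by move=> x; exact: class_mass_ge0.
Qed.

Let Xfinv x y : X (x, y) -> X (finv x, finv y).
Proof. by move=> Xxy; apply: fX; rewrite /pull/= !finvK. Qed.

Let Xfinv_iter j x y : X (x, y) -> X (iter j finv x, iter j finv y).
Proof. by elim: j => // j ih /ih; exact: Xfinv. Qed.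

Let phi_finv i j x y : X (x, y) ->
  phi i (iter j.+1 finv x) = phi i (iter j.+1 finv y).
Proof.
move=> Xxy; rewrite /phi; have Xj := Xfinv_iter j Xxy.
have e : gam (iter j.+1 finv x) = gam (iter j.+1 finv y) by exact: gamX.
rewrite e; congr (_ / _); apply: EFin_inj; have X1 := Xfinv Xj.
by rewrite [RHS](fiber_massE X1) class_massE//; congr (k _ _);
  apply/seteqP; split => z => [/xsectionP|h]; rewrite /fiber_rel/= -?e//;
  apply/xsectionP; rewrite /fiber_rel/= e.
Qed.

(** Integrating over a class of [X] the quotient of the guess by the conditional
    probability sums the guesses. *)
Lemma step_integral_le (H : T -> R) i : measurable_fun setT H ->
  (forall x, 0 <= H x) -> (forall x y, X (x, y) -> H x = H y) ->
  (\int[mu]_x (H x * phi i x)%:E <= \int[mu]_x (H x)%:E)%E.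
Proof.
move=> mH H0 HX.
have mHp : measurable_fun setT (fun x => (H x * phi i x)%:E).
  by apply/measurable_EFinP; exact: measurable_funM.
rewrite (disintegration dis mHp) => [|x]; last by rewrite lee_fin mulr_ge0.
apply: ae_ge0_le_integral => //.
- by move=> x _; apply: integral_ge0 => y _; rewrite lee_fin mulr_ge0.
- apply: (measurable_fun_integral_kernel (measurable_kernel k)) => //.
  by move=> x; rewrite lee_fin mulr_ge0.
- by move=> x _; rewrite lee_fin.
- exact/measurable_EFinP.
apply: filterS concX => x kx _.
pose q c := fine (k x (gam @^-1` [set c])).
have q0 c : 0 <= q c by exact: fine_ge0.
have qE c : (q c)%:E = k x (gam @^-1` [set c]) by rewrite fineK// k_fin.
pose F c y := H x * (Y i c / q c) * \1_(gam @^-1` [set c]) y.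
have F0 c y : 0 <= F c y by rewrite !mulr_ge0// invr_ge0.
have mF c : measurable_fun setT (F c).
  by apply: measurable_funM => //; exact: measurable_indic.
have -> : (\int[k x]_y (H y * phi i y)%:E =
    \int[k x]_y (\sum_(c : G) (F c y)%:E))%E.
  apply: (ae_kernel_class mX) => //.
  - by apply: emeasurable_sum => c; exact/measurable_EFinP.
  - by move=> y; rewrite lee_fin mulr_ge0.
  - by move=> y; apply: sume_ge0 => c _; rewrite lee_fin.
  - move=> y Xxy; rewrite sumEFin; congr (_%:E).
    rewrite (bigD1 (gam y))//= big1 => [|c cy]; last first.
      rewrite /F indic_notin ?mulr0//= => e.
      by rewrite e eqxx in cy.
    rewrite addr0 /F (indic_in _ (erefl _ : (gam @^-1` [set gam y]) y)) mulr1.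
    rewrite (HX _ _ Xxy) /phi; congr (_ * (_ / _)).
    by apply: EFin_inj; rewrite qE (fiber_massE Xxy).
rewrite ge0_integral_sum//; last 2 first.
- by move=> c; exact/measurable_EFinP.
- by move=> c y _; rewrite lee_fin.
apply: (@le_trans _ _ (\sum_(c : G) (H x * Y i c)%:E)%E).
  apply: lee_sum => c _.
  rewrite kernel_integralZ ?mulr_ge0 ?invr_ge0//.
  rewrite integral_indic// setIT -qE -EFinM lee_fin -!mulrA.
  rewrite ler_wpM2l// ler_piMr// mulrC.
  by have [->|qn0] := eqVneq (q c) 0; rewrite ?mul0r ?mulfV.
rewrite sumEFin lee_fin -mulr_sumr ler_piMr//.
Qed.

(** The values of [gam] before time [n] are determined by the class of [X] at
    time [n], so that the last factor can be integrated first. *)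
Lemma word_integral_le n :
  (\int[mu]_x (\prod_(i < n) (Y i (gam (iter i f x)) / m Gam (iter i f x)))%:E
    <= 1)%E.
Proof.
apply: (orbit_product_integral_le (phi := phi) mf mfinv fK inv) => //.
move=> l G' ln mG' G'0 GE; apply: step_integral_le => // x y Xxy.
rewrite !GE; apply: eq_bigr => -[i il] _ /=.
by rewrite !(iter_back _ finvK il); exact: phi_finv.
Qed.

End finite_partition.

(** The codes of an orbit unfold from the first one with at most [ln K] of
    entropy per step, and the alphabet is the same at all precisions [e]. *)
Definition codable (K : nat) := forall (G : finType) (gam : T -> G),
  (forall c, measurable (gam @^-1` [set c])) -> forall e : R, 0 < e ->
  exists (Key : finType) (key : T -> Key) (dec : Key -> 'I_K -> Key)
    (pi : Key -> G),
  [/\ forall c, measurable (key @^-1` [set c]),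
      forall q, exists s, key (f q) = dec (key q) s &
      (mu [set x | pi (key x) != gam x] <= e%:E)%E].

Section entropy_bound.
Variable K : nat.
Hypothesis hK : codable K.
Variables (G : finType) (gam : T -> G).
Hypothesis mgam : forall c, measurable (gam @^-1` [set c]).
Hypothesis gamX : forall x y, X (x, y) -> gam (finv x) = gam (finv y).
Local Notation Gam := (fiber_rel gam).

Let mGam : measurable Gam := per_measurable (per_fiber_rel mgam).

Let mlnG : measurable_fun setT (fun x => - ln (m Gam x)).
Proof. exact: measurable_class_info. Qed.

Let lnG0 x : 0 <= - ln (m Gam x).
Proof. exact: class_info_ge0. Qed.

Let g : R := #|G|%:R.
(** The cost of a wrong guess. *)
Let L : R := ln (2 * g).

Let g1 : 1 <= g.
Proof.
have [x0 _] := probability_inhabited mu.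
by rewrite ler1n; apply/card_gt0P; exists (gam x0).
Qed.

Let L0 : 0 <= L.
Proof. by apply: ln_ge0; have := g1; lra. Qed.

Section code.
Variables (Key : finType) (key : T -> Key) (dec : Key -> 'I_K -> Key)
  (pi : Key -> G).
Hypothesis mkey : forall c, measurable (key @^-1` [set c]).
Hypothesis keyf : forall q, exists s, key (f q) = dec (key q) s.
(* at the cost [L] of a wrong guess, an expected cost of at most 1 *)
Hypothesis pi_gam : (mu [set x | pi (key x) != gam x] <= ((L + 1)^-1)%:E)%E.

Let Bad := [set x | pi (key x) != gam x].

Let mBad : measurable Bad.
Proof.
rewrite (_ : Bad = \bigcup_(w in [set w : Key * G | pi w.1 != w.2])
    (key @^-1` [set w.1] `&` gam @^-1` [set w.2])).
  apply: fin_bigcup_measurable; first exact: finite_finset.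
  by move=> w _; exact: measurableI.
apply/seteqP; split => x; first by move=> xB; exists (key x, gam x).
by move=> [[c c'] /= cc' [/= ec ec']]; rewrite /Bad/= ec ec'.
Qed.

(* half of the mass on the predicted symbol, the other half spread evenly *)
Let rho (w : Key) (c : G) : R := if c == pi w then 2^-1 else (2 * g)^-1.

Let rho_gt0 w c : 0 < rho w c.
Proof.
by rewrite /rho; case: ifP => _; rewrite invr_gt0; have := g1; lra.
Qed.

Let rho_sum w : \sum_c rho w c <= 1.
Proof.
apply: (@le_trans _ _ (\sum_c ((if c == pi w then 2^-1 else 0) + (2 * g)^-1))).
  have gp : 0 <= (2 * g)^-1 by rewrite invr_ge0; have := g1; lra.
  apply: ler_sum => c _; rewrite /rho; case: ifP => _; lra.
have g0 : g != 0 by rewrite gt_eqF//; have := g1; lra.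
have e1 : \sum_(c : G) (2 * g)^-1 = 2^-1.
  rewrite sumr_const -mulr_natl -/g; field.
  by rewrite g0.
have e2 : \sum_(c : G) (if c == pi w then 2^-1 else 0) = 2^-1 :> R.
  by rewrite -big_mkcond/= big_pred1_eq.
by rewrite big_split/= e1 e2; lra.
Qed.

Let cost x := - ln (rho (key x) (gam x)).

Let costE x : cost x <= ln 2 + L * \1_Bad x.
Proof.
have l2 : 0 <= ln 2 :> R by apply: ln_ge0; rewrite ler1n.
rewrite /cost /rho; case: ifP => [/eqP e|/negbT ne].
  rewrite indic_notin ?mulr0 ?addr0; last first.
    by rewrite /Bad/= e eqxx.
  by rewrite lnV ?posrE ?opprK.
rewrite (indic_in _ (_ : Bad x)); last by rewrite /Bad/= eq_sym.
rewrite lnV ?posrE; last by have := g1; lra.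
by rewrite opprK mulr1 lerDr.
Qed.

Let cost0 x : 0 <= cost x.
Proof.
rewrite oppr_ge0 ln_le0// /rho.
case: ifP => _; first by rewrite invf_le1 ?ler1n.
have := g1 => g1'; rewrite invf_le1; lra.
Qed.

Let mpair (u : Key -> G -> R) : measurable_fun setT (fun x => u (key x) (gam x)).
Proof.
have mkg (c : Key * G) : measurable ((fun x => (key x, gam x)) @^-1` [set c]).
  rewrite (_ : _ @^-1` _ = key @^-1` [set c.1] `&` gam @^-1` [set c.2]).
    exact: measurableI.
  by apply/seteqP; split => x; case: c => c c' /= [-> ->].
exact: (measurable_fin_fun mkg (fun c => u c.1 c.2)).
Qed.

Let mcost : measurable_fun setT cost.
Proof. exact: (mpair (fun w c => - ln (rho w c))). Qed.

Let int_cost : (\int[mu]_x (cost x)%:E <= (ln 2 + 1)%:E)%E.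
Proof.
have l2 : 0 <= ln 2 :> R by apply: ln_ge0; rewrite ler1n.
apply: (@le_trans _ _ (\int[mu]_x (ln 2 + L * \1_Bad x)%:E)%E).
  apply: le_integral_EFin => //.
  by apply: measurable_funD => //; apply: measurable_funM.
have mI : measurable_fun setT (\1_Bad : T -> R) by exact: measurable_indic.
rewrite ge0_integralD_EFin; last 4 first.
- exact: measurable_cst.
- exact: measurable_funM.
- by [].
- by move=> x; rewrite mulr_ge0.
rewrite integral_cst_probability (ge0_integralZ_EFin mu mI)//.
rewrite integral_indic// setIT EFinD leeD2l//.
apply: (@le_trans _ _ (L%:E * ((L + 1)^-1)%:E)%E).
  by rewrite lee_wpmul2l// lee_fin.
by rewrite -EFinM lee_fin ler_pdivrMr; have := L0; lra.
Qed.

Variable n : nat.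

(** The codes along an orbit are read off from the first code and a word of
    symbols; [PP] guesses the values of [gam] from them. *)
Let om (t : Key * n.-tuple 'I_K) i := foldl dec t.1 (take i t.2).

Let PP (t : Key * n.-tuple 'I_K) x :=
  \prod_(i < n) (rho (om t i) (gam (iter i f x)) / m Gam (iter i f x)).

Let PP_int t : (\int[mu]_x (PP t x)%:E <= 1)%E.
Proof.
exact: (word_integral_le mgam gamX (fun i c => ltW (rho_gt0 (om t i) c))
  (fun i => rho_sum (om t i)) n).
Qed.

Let mPP t : measurable_fun setT (PP t).
Proof.
apply: measurable_prod => i _.
apply: measurable_funM.
  apply: (measurableT_comp (measurable_fin_fun mgam (rho (om t i)))).
  exact: measurable_iter.
apply: measurable_inv_ge0; last by move=> x; exact: class_mass_ge0.
apply: (measurableT_comp (measurable_class_mass k mGam)).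
exact: measurable_iter.
Qed.

Let PP0 t x : 0 <= PP t x.
Proof.
by apply: prodr_ge0 => i _; rewrite divr_ge0 ?class_mass_ge0// ltW.
Qed.

Let N0 : R := (#|Key| * K ^ n)%:R.

Let N0E : #|{: Key * n.-tuple 'I_K}|%:R = N0.
Proof. by rewrite card_prod card_tuple card_ord. Qed.

Let N0_ge1 : 1 <= N0.
Proof.
have [x0 _] := probability_inhabited mu.
rewrite /N0 ler1n muln_gt0; apply/andP; split.
  by apply/card_gt0P; exists (key x0).
have [s _] := keyf x0.
by rewrite expn_gt0 (leq_ltn_trans (leq0n s) (ltn_ord s)).
Qed.

Let Ytot x := \sum_t PP t x.

Let mYtot : measurable_fun setT Ytot.
Proof. exact: measurable_sum. Qed.

Let Ytot0 x : 0 <= Ytot x. Proof. exact: sumr_ge0. Qed.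

Let Ytot_int : (\int[mu]_x (Ytot x)%:E <= N0%:E)%E.
Proof.
rewrite /Ytot; under eq_integral do rewrite -sumEFin.
rewrite ge0_integral_sum//; last 2 first.
- by move=> t; exact/measurable_EFinP.
- by move=> t x _; rewrite lee_fin.
apply: (@le_trans _ _ (\sum_(t : Key * n.-tuple 'I_K) 1%:E)%E).
  by apply: lee_sum => t _; exact: PP_int.
by rewrite sumEFin sumr_const N0E.
Qed.

(** The orbit of [x] itself is described by one of the [#|Key| * K ^ n] words. *)
Let Ytot_ge x : \prod_(i < n) (rho (key (iter i f x)) (gam (iter i f x)) /
  m Gam (iter i f x)) <= Ytot x.
Proof.
have /choice[sel hsel] := keyf.
pose t : Key * n.-tuple 'I_K := (key x, [tuple sel (iter i f x) | i < n]).
have tE i : (i <= n)%N -> om t i = key (iter i f x).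
  elim: i => [|i ih] ni; first by rewrite /om take0.
  have sz : (i < size t.2)%N by rewrite size_tuple.
  rewrite /om (take_nth (sel x) sz) foldl_rcons.
  rewrite -[foldl _ _ _]/(om t i) (ih (ltnW ni)).
  have -> : nth (sel x) t.2 i = sel (iter i f x).
    by rewrite -(tnth_nth _ _ (Ordinal ni)) tnth_mktuple.
  by rewrite -hsel.
rewrite /Ytot (bigD1 t)//= [X in X <= _](_ : _ = PP t x).
  by rewrite lerDl sumr_ge0.
by apply: eq_bigr => i _; rewrite tE// ltnW.
Qed.

Let ae_pointwise : {ae mu, forall x,
  \sum_(i < n) (- ln (m Gam (iter i f x))) <=
  Ytot x / N0 + (ln N0 + \sum_(i < n) cost (iter i f x))}.
Proof.
have A i : {ae mu, forall x, 0 < m Gam (iter i f x)}.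
  exact: (ae_iter mf inv i (fiber_mass_gt0 mgam)).
move: (ae_foralln A); apply: filterS => x {}A.
have N00 : 0 < N0 by rewrite (lt_le_trans _ N0_ge1).
have e : \prod_(i < n) (rho (key (iter i f x)) (gam (iter i f x)) /
    m Gam (iter i f x)) =
    expR (\sum_(i < n) (- ln (m Gam (iter i f x))) - \sum_(i < n) cost (iter i f x)).
  rewrite -sumrB expR_sum; apply: eq_bigr => i _.
  by rewrite /cost opprK addrC expRB !lnK// posrE.
have Y0 : 0 < Ytot x by rewrite (lt_le_trans _ (Ytot_ge x))// e expR_gt0.
have h1 : \sum_(i < n) (- ln (m Gam (iter i f x))) -
    \sum_(i < n) cost (iter i f x) <= ln (Ytot x).
  by rewrite -ler_expR lnK ?posrE// -e; exact: Ytot_ge.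
have h2 : ln (Ytot x / N0) < Ytot x / N0 by apply: ln_sublinear; rewrite divr_gt0.
move: h2; rewrite ln_div ?posrE// => h2.
by lra.
Qed.

(** The sum over all words of the quotients of guessed and conditional
    probabilities has integral at most the number of words; taking logarithms,
    the information of [n] steps is at most the logarithm of that number plus
    the cost of the guesses. *)
Lemma coded_entropy_le :
  (\sum_(i < n) \int[mu]_x (- ln (m Gam x))%:E <=
   (1 + ln N0 + n%:R * (ln 2 + 1))%:E)%E.
Proof.
have lN0 : 0 <= ln N0 by exact: ln_ge0.
have N00 : 0 < N0 by rewrite (lt_le_trans _ N0_ge1).
have mci i : measurable_fun setT (fun x => cost (iter i f x)).
  by apply: (measurableT_comp mcost); exact: measurable_iter.
have mli i : measurable_fun setT (fun x => - ln (m Gam (iter i f x))).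
  by apply: (measurableT_comp mlnG); exact: measurable_iter.
have sumc0 x : 0 <= \sum_(i < n) cost (iter i f x) by exact: sumr_ge0.
have msumc : measurable_fun setT (fun x => \sum_(i < n) cost (iter i f x)).
  exact: measurable_sum.
have -> : (\sum_(i < n) \int[mu]_x (- ln (m Gam x))%:E =
    \int[mu]_x (\sum_(i < n) (- ln (m Gam (iter i f x))))%:E)%E.
  rewrite (@ge0_integral_sum_EFin _ _ _ mu n (fun i x => - ln (m Gam (iter i f x))))//.
  apply: eq_bigr => i _.
  rewrite (@integral_iter _ _ _ mu f mf inv (fun x => (- ln (m Gam x))%:E))//.
  exact/measurable_EFinP.
apply: (@le_trans _ _ (\int[mu]_x (Ytot x / N0 +
    (ln N0 + \sum_(i < n) cost (iter i f x)))%:E)%E).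
  apply: ae_le_integral_EFin => //.
  - exact: measurable_sum.
  - by apply: measurable_funD; [exact: measurable_funM|exact: measurable_funD].
  - by move=> x; exact: sumr_ge0.
  - by move=> x; rewrite !addr_ge0// divr_ge0// ltW.
rewrite ge0_integralD_EFin; last 4 first.
- exact: measurable_funM.
- exact: measurable_funD.
- by move=> x; rewrite divr_ge0// ltW.
- by move=> x; rewrite addr_ge0.
rewrite ge0_integralD_EFin// integral_cst_probability.
have b1 : (\int[mu]_x (Ytot x / N0)%:E <= 1)%E.
  under eq_integral do rewrite mulrC.
  rewrite (ge0_integralZ_EFin mu mYtot Ytot0); last by rewrite invr_ge0 ltW.
  apply: (@le_trans _ _ ((N0^-1)%:E * N0%:E)%E).
    by rewrite lee_wpmul2l// lee_fin invr_ge0 ltW.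
  by rewrite -EFinM mulVf// gt_eqF.
have b2 : (\int[mu]_x (\sum_(i < n) cost (iter i f x))%:E <=
    (n%:R * (ln 2 + 1))%:E)%E.
  rewrite (@ge0_integral_sum_EFin _ _ _ mu n (fun i x => cost (iter i f x)))//.
  rewrite mulr_natl -[n in leRHS](card_ord n) -sumr_const -sumEFin.
  apply: lee_sum => i _.
  rewrite (@integral_iter _ _ _ mu f mf inv (fun x => (cost x)%:E))//.
  exact/measurable_EFinP.
by rewrite addeA !EFinD leeD// leeD.
Qed.

End code.

(** Divide [coded_entropy_le] by [n]: the number of codes, which depends on
    the precision, disappears. *)
Lemma finite_entropy_le :
  (\int[mu]_x (- ln (m Gam x))%:E <= (ln K%:R + (ln 2 + 1))%:E)%E.
Proof.
have L1 : 0 < (L + 1)^-1 by rewrite invr_gt0; have := L0; lra.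
have [Key [key [dec [pi [mkey keyf pig]]]]] := hK mgam L1.
have bound := coded_entropy_le mkey keyf pig.
have [x0 _] := probability_inhabited mu.
have Key0 : (0 < #|Key|)%N by apply/card_gt0P; exists (key x0).
have K0 : (0 < K)%N.
  by have [s _] := keyf x0; exact: leq_ltn_trans (leq0n s) (ltn_ord s).
have Hge0 : (0 <= \int[mu]_x (- ln (m Gam x))%:E)%E by exact: integral_EFin_ge0.
have Hfin : (\int[mu]_x (- ln (m Gam x))%:E)%E \is a fin_num.
  have := bound 1; rewrite big_ord1 => b1.
  by rewrite ge0_fin_numE// (le_lt_trans b1)// ltry.
move: bound; rewrite -(fineK Hfin); set h := fine _ => bound.
rewrite lee_fin leNgt; apply/negP => hlt.
set D := ln K%:R + (ln 2 + 1) in hlt.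
pose a := 1 + ln (#|Key|%:R : R).
(* so large that the linear term outweighs the constant one *)
pose n := (Num.truncn (a / (h - D))).+1.
have hD : 0 < h - D by rewrite subr_gt0.
have := bound n.
have -> : ln (#|Key| * K ^ n)%:R = ln #|Key|%:R + n%:R * ln K%:R :> R.
  rewrite natrM natrX lnM ?posrE ?exprn_gt0 ?ltr0n//.
  by rewrite lnXn ?ltr0n// mulr_natl.
rewrite sumEFin lee_fin sumr_const card_ord -[h *+ n]mulr_natl.
have : a < n%:R * (h - D) by rewrite -ltr_pdivrMr// truncnS_gt.
rewrite /a /D; move: (n%:R : R) => r; nra.
Qed.

End entropy_bound.
End finite_entropy.

(** * Entropy of one step of the increasing relation *)

Section kernel_null.
Context d (T : measurableType d) (R : realType) (mu : probability T R).
Variable k : R.-pker T ~> T.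
Hypothesis dis : forall A : set T, measurable A ->
  mu A = (\int[mu]_x k x A)%E.

Lemma ae_kernel_null (N : set T) : mu.-negligible N ->
  {ae mu, forall x, (k x).-negligible N}.
Proof.
move=> [N' [mN' N'0 NN']].
have mk : measurable_fun setT (fun x => k x N') by exact: measurable_kernel.
have /(ae_eq_integral_abs mu measurableT mk) :
    (\int[mu]_(x in setT) `|k x N'| = 0)%E.
  by rewrite -N'0 dis//; apply: eq_integral => x _; rewrite gee0_abs.
by apply: filterS => x /(_ I) kx; exists N'.
Qed.

End kernel_null.

Section step_entropy.
Context d (T : measurableType d) (R : realType) (mu : probability T R).
Variable k : R.-pker T ~> T.
Hypothesis dis : forall A : set T, measurable A ->
  mu A = (\int[mu]_x k x A)%E.
Variable X : set (T * T).
Hypothesis pX : is_per X.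
Hypothesis kX : forall x y, X (x, y) ->
  forall A : set T, measurable A -> k x A = k y A.
Hypothesis concX : {ae mu, forall x, k x (~` xsection X x) = 0%E}.
Local Notation m := (class_mass k).
Variables f finv : T -> T.
Hypotheses (mf : measurable_fun setT f) (mfinv : measurable_fun setT finv).
Hypotheses (fK : cancel f finv) (finvK : cancel finv f).
Hypothesis inv : forall A : set T, measurable A -> mu (f @^-1` A) = mu A.
Hypothesis fX : pull f X `<=` X.
Variable K : nat.
Hypothesis hK : codable mu f K.
Variables (B : nat -> set T) (T0 : set T).
Hypothesis mB : forall n, measurable (B n).
Hypothesis T0_full : mu.-negligible (~` T0).
Hypothesis XB : forall x y, X (x, y) -> forall n, B n x <-> B n y.
Hypothesis BX : forall x y, T0 x -> T0 y -> (forall n, B n x <-> B n y) -> X (x, y).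

(** Finite partitions that increase to the relation [pull f X]. *)
Let gam N x : {ffun 'I_N -> bool} := [ffun i : 'I_N => `[< B i (f x) >]].

Let mgam N c : measurable (@gam N @^-1` [set c]).
Proof.
apply: (measurable_membership (U := fun i : 'I_N => f @^-1` B i)) => i.
by rewrite -[X in measurable X]setTI; exact: mf.
Qed.

Let gamP N x y : gam N x = gam N y <->
  forall n, (n < N)%N -> (B n (f x) <-> B n (f y)).
Proof.
split=> [/ffunP e n nN|h].
  by have := e (Ordinal nN); rewrite !ffunE/=; exact: asbool_eq_equiv.
by apply/ffunP => i; rewrite !ffunE; apply: asbool_equiv_eq; exact: h.
Qed.

Let gamX N x y : X (x, y) -> gam N (finv x) = gam N (finv y).
Proof. by move=> Xxy; apply/gamP => n _; rewrite !finvK; exact: XB. Qed.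

Let q N := m (fiber_rel (gam N)).
Let p := m (pull f X).

Let mP : measurable (pull f X).
Proof. by apply: measurable_pull => //; exact: per_measurable. Qed.

Let mG N : measurable (fiber_rel (gam N)).
Proof. exact: per_measurable (per_fiber_rel (@mgam N)). Qed.

Let cvg_mass : {ae mu, forall x, q N x @[N --> \oo] --> p x}.
Proof.
have nul : mu.-negligible (f @^-1` (~` T0)).
  have [N [mN N0 TN]] := T0_full.
  exists (f @^-1` N); split.
  - by rewrite -[X in measurable X]setTI; exact: mf.
  - by rewrite inv.
  - by move=> x; exact: TN.
have h1 : {ae mu, forall x, T0 (f x)} by exact: nul.
move: (ae_kernel_null dis nul) h1; apply: filterS2 => x [N [mN N0 TN]] T0fx.
pose F n := xsection (fiber_rel (gam n)) x.
have mF n : measurable (F n) by exact: measurable_xsection.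
have mI : measurable (\bigcap_n F n) by exact: bigcapT_measurable.
have kE : k x (\bigcap_n F n) = k x (xsection (pull f X) x).
  apply/eqP; rewrite eq_le; apply/andP; split.
    have mU : measurable (xsection (pull f X) x `|` N).
      by apply: measurableU => //; exact: measurable_xsection.
    apply: (@le_trans _ _ (k x (xsection (pull f X) x `|` N))).
      apply: le_measure; rewrite ?inE// => y Fy.
      have [/= T0fy|/TN] := pselect (T0 (f y)); last by right.
      left; apply/xsectionP; apply: BX => //= n.
      have /xsectionP/gamP := Fy n.+1 I; exact.
    apply: (le_trans (measureU2 _ _ _)) => //; first exact: measurable_xsection.
    have : (k x (xsection (pull f X) x) + k x N <=
      k x (xsection (pull f X) x))%E by rewrite N0 adde0.
    exact.
  apply: le_measure; rewrite ?inE//; first exact: measurable_xsection.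
  move=> y /xsectionP Xxy n _; apply/xsectionP; apply/gamP => i _.
  exact: XB.
have : k x (F n) @[n --> \oo] --> k x (\bigcap_n F n).
  apply: nonincreasing_cvg_mu => //.
    by rewrite -ge0_fin_numE//; exact: k_fin.
  apply/nonincreasing_seqP => n; apply/subsetPset => y /xsectionP/gamP h.
  by apply/xsectionP/gamP => i ni; apply: h; exact: leqW.
rewrite kE -class_massE// => h.
have /fine_cvgP[_] : (q N x)%:E @[N --> \oo] --> (p x)%:E.
  by rewrite (_ : (fun N => _) = (fun N => k x (F N)))//; apply/funext => N';
    rewrite class_massE.
exact.
Qed.

Let C : R := ln K%:R + (ln 2 + 1).

Let int_q N : (\int[mu]_x (- ln (q N x))%:E <= C%:E)%E.
Proof.
exact: (finite_entropy_le dis pX kX concX mf mfinv fK finvK inv fX hK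
  (@mgam N) (@gamX N)).
Qed.

Let q0 N x : 0 <= - ln (q N x).
Proof. exact: class_info_ge0. Qed.

Let mlnq N : measurable_fun setT (fun x => - ln (q N x)).
Proof. exact: measurable_class_info. Qed.

Let ae_q_gt0 : {ae mu, forall x, forall N, 0 < q N x}.
Proof.
apply: ae_foralln => N.
exact: (fiber_mass_gt0 dis pX kX concX (@mgam N)).
Qed.

(** Fatou's lemma: where the limit mass vanishes the informations of the finite
    partitions tend to infinity, while their integrals are bounded. *)
Lemma step_mass_gt0 : {ae mu, forall x, 0 < m (pull f X) x}.
Proof.
pose Z := [set x | p x = 0].
have mZ : measurable Z.
  rewrite (_ : Z = p @^-1` [set 0])//.
  by rewrite -[X in measurable X]setTI; exact: measurable_class_mass.
have mI : measurable_fun setT (\1_Z : T -> R) by exact: measurable_indic.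
(* on [Z] the informations grow past any level [j]; truncated there, they
   converge to a real function, as [ae_fatou] requires *)
have bound j : ((j%:R)%:E * mu Z <= C%:E)%E.
  have -> : ((j%:R)%:E * mu Z = \int[mu]_x (j%:R * \1_Z x)%:E)%E.
    by rewrite (ge0_integralZ_EFin mu mI)// integral_indic// setIT.
  apply: (@ae_fatou _ _ _ mu
    (fun N x => Num.min (- ln (q N x)) (j%:R * \1_Z x))).
  - by move=> N; apply: measurable_minr => //; exact: measurable_funM.
  - by move=> N x; rewrite le_min q0 mulr_ge0.
  - exact: measurable_funM.
  - by move=> x; rewrite mulr_ge0.
  - move: cvg_mass ae_q_gt0; apply: filterS2 => x qp qpos.
    have [Zx|Zx] := pselect (Z x); last first.
      rewrite indic_notin// mulr0.
      by under eq_fun do rewrite (min_r (q0 _ _)); exact: cvg_cst.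
    move: qp; rewrite Zx => qp; rewrite indic_in// mulr1.
    apply: cvg_near_cst; near=> N.
    rewrite min_r// lerNr -[leRHS]expRK ler_ln ?posrE ?expR_gt0//.
    by apply: ltW; near: N; apply: (cvgr_lt 0) => //; exact: expR_gt0.
  - move=> N; apply: le_trans (int_q N); apply: le_integral_EFin => //.
    + by apply: measurable_minr => //; exact: measurable_funM.
    + by move=> x; rewrite le_min q0 mulr_ge0.
    + by move=> x; rewrite ge_min lexx.
have Zfin : mu Z \is a fin_num.
  by rewrite ge0_fin_numE// (le_lt_trans (probability_le1 mu mZ))// ltry.
have Z0 : mu Z = 0%E.
  move: bound; rewrite -(fineK Zfin); set z := fine _ => bound.
  have z0 : 0 <= z by exact: fine_ge0.
  congr EFin; apply/eqP; rewrite eq_le z0 andbT leNgt; apply/negP => zp.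
  have := bound (Num.truncn (C / z)).+1; rewrite -EFinM lee_fin leNgt.
  by rewrite -ltr_pdivrMr// truncnS_gt.
exists Z; split => // x /= /negP; rewrite -leNgt => h.
by apply/eqP; rewrite eq_le h class_mass_ge0.
Unshelve. all: by end_near. Qed.

Lemma step_entropy_fin : (\int[mu]_x (- ln (m (pull f X) x))%:E < +oo)%E.
Proof.
apply: (@le_lt_trans _ _ C%:E); last exact: ltry.
apply: (@ae_fatou _ _ _ mu (fun N x => - ln (q N x))) => //.
- exact: measurable_class_info.
- by move=> x; exact: class_info_ge0.
- move: cvg_mass step_mass_gt0; apply: filterS2 => x qp p0.
  by apply: cvgN; apply: (cvg_comp _ _ qp); exact: continuous_ln.
Qed.

End step_entropy.

(** * Approximation of measurable partitions by codes *)

Section approximation.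
Context d (T : measurableType d) (R : realType) (mu : probability T R).
Variables (Key : nat -> finType) (key : forall j, T -> Key j).
Hypothesis mkey : forall j c, measurable (key j @^-1` [set c]).

Let cells j (S : {set Key j}) : set T := [set x | key j x \in S].

Let mcells j S : measurable (@cells j S).
Proof.
rewrite (_ : cells S = \bigcup_(c in [set c | c \in S]) key j @^-1` [set c]).
  by apply: fin_bigcup_measurable => //; exact: finite_finset.
by apply/seteqP; split => x /=; [move=> h; exists (key j x)|move=> [c /= cS e]; rewrite /cells/= e].
Qed.

(** Approximation at all large precisions, rather than at some: successive
    codes need not refine each other. *)
Definition approximable (A : set T) := measurable A /\
  forall e : R, 0 < e -> exists j0, forall j, (j0 <= j)%N ->
    exists S : {set Key j},
      (mu ((A `\` cells S) `|` (cells S `\` A)) <= e%:E)%E.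

Let le_mu (A B : set T) (e : \bar R) : measurable A -> measurable B -> A `<=` B ->
  (mu B <= e -> mu A <= e)%E.
Proof. by move=> mA mB AB; apply: le_trans; rewrite le_measure ?inE. Qed.

Let fin (A : set T) : measurable A -> mu A \is a fin_num.
Proof. exact: fin_num_measure. Qed.

Let le_muD (A B : set T) (e : R) : measurable A -> measurable B -> B `<=` A ->
  fine (mu A) - e < fine (mu B) -> (mu (A `\` B) <= e%:E)%E.
Proof.
move=> mA mB BA h.
have -> : mu (A `\` B) = (fine (mu A) - fine (mu B))%:E.
  rewrite EFinB !fineK ?fin//.
  have {2}-> : B = A `&` B by apply/esym/setIidr.
  by apply: measureD => //; rewrite -ge0_fin_numE// fin.
by rewrite lee_fin; lra.
Qed.

Lemma approximable0 : approximable set0.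
Proof.
split=> // e e0; exists 0%N => j _; exists finset.set0.
rewrite (_ : _ `|` _ = set0) ?measure0 ?lee_fin ?ltW//.
by apply/seteqP; split => // x [[]|[]] //=; rewrite /cells/= inE.
Qed.

Lemma approximableC A : approximable A -> approximable (~` A).
Proof.
move=> [mA hA]; split; first exact: measurableC.
move=> e /hA[j0 h]; exists j0 => j /h[S hS]; exists (~: S)%SET.
move: hS; congr (mu _ <= _)%E; apply/seteqP; split => x.
  move=> [[Ax nS]|[Sx nA]]; first by right; split => [|/(_ Ax)//]; rewrite /cells/= inE; exact/negP.
  by left; split => //; rewrite /cells/= inE; apply/negP/negPn.
move=> [[nA nS]|[Sx nA]].
  by right; split => //; move: nS; rewrite /cells/= inE => /negP/negPn.
by left; split; [exact: contrapT|move: Sx; rewrite /cells/= inE => /negP].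
Qed.

Lemma approximableU A B : approximable A -> approximable B -> approximable (A `|` B).
Proof.
move=> [mA hA] [mB hB]; split; first exact: measurableU.
move=> e e0; have e2 : 0 < e / 2 by rewrite divr_gt0.
have [jA {}hA] := hA _ e2; have [jB {}hB] := hB _ e2.
exists (maxn jA jB) => j; rewrite geq_max => /andP[/hA[S hS] /hB[S' hS']].
exists (S :|: S')%SET.
have m1 (C D : set T) : measurable C -> measurable D -> measurable ((C `\` D) `|` (D `\` C)).
  by move=> mC mD; apply: measurableU; exact: measurableD.
have c1 : (mu (((A `\` cells S) `|` (cells S `\` A)) `|`
    ((B `\` cells S') `|` (cells S' `\` B))) <= e%:E)%E.
  apply: (le_trans (measureU2 _ _ _)); try exact: m1.
  by rewrite (splitr e) EFinD leeD.
apply: le_mu c1; first by apply: m1 => //; exact: measurableU.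
  by apply: measurableU; exact: m1.
move=> x; rewrite /cells/= !inE => -[[[Ax|Bx] /negP]|[/orP[Sx|Sx]]].
- by rewrite negb_or => /andP[/negP nS _]; left; left.
- by rewrite negb_or => /andP[_ /negP nS]; right; left.
- by move=> nAB; left; right; split => // ?; apply: nAB; left.
- by move=> nAB; right; right; split => // ?; apply: nAB; right.
Qed.

Lemma approximable_bigcup (F : (set T)^nat) :
  (forall i, approximable (F i)) -> approximable (\bigcup_i F i).
Proof.
move=> hF; have mF i : measurable (F i) by case: (hF i).
have mUF : measurable (\bigcup_i F i) by exact: bigcupT_measurable.
split=> // e e0; have e2 : 0 < e / 2 by rewrite divr_gt0.
pose G n := \big[setU/set0]_(i < n) F i.
have hG n : approximable (G n).
  rewrite /G; elim: n => [|n ih]; first by rewrite big_ord0; exact: approximable0.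
  by rewrite big_ord_recr/=; exact: approximableU.
have mG n : measurable (G n) by case: (hG n).
have GF n : G n `<=` \bigcup_i F i.
  by rewrite /G -bigcup_mkord => x [i _ Fx]; exists i.
have GE : \bigcup_n G n = \bigcup_i F i.
  apply/seteqP; split; first by move=> x [n _ /GF].
  by move=> x [i _ Fx]; exists i.+1 => //; rewrite /G big_ord_recr/=; right.
have cG : mu (G n) @[n --> \oo] --> mu (\bigcup_i F i).
  rewrite -GE; apply: nondecreasing_cvg_mu => //; first by rewrite GE.
  apply/nondecreasing_seqP => n; apply/subsetPset.
  by rewrite /G big_ord_recr/=; left.
have [n hn] : exists n, (mu (\bigcup_i F i `\` G n) <= (e / 2)%:E)%E.
  have fG : fine (mu (G n)) @[n --> \oo] --> fine (mu (\bigcup_i F i)).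
    by apply: fine_cvg; rewrite fineK// fin.
  have : \forall n \near \oo, fine (mu (\bigcup_i F i)) - e / 2 < fine (mu (G n)).
    by apply: (cvgr_gt _ fG); rewrite ltrBlDr ltrDl.
  move=> [n _ /(_ _ (leqnn n))] h; exists n.
  exact: le_muD.
have [_ /(_ _ e2)[j0 h]] := hG n.
exists j0 => j /h[S hS]; exists S.
have m1 (C D : set T) : measurable C -> measurable D -> measurable ((C `\` D) `|` (D `\` C)).
  by move=> mC mD; apply: measurableU; exact: measurableD.
have c1 : (mu ((\bigcup_i F i `\` G n) `|`
    ((G n `\` cells S) `|` (cells S `\` G n))) <= e%:E)%E.
  apply: (le_trans (measureU2 _ _ _)); [exact: measurableD|exact: m1|].
  by rewrite (splitr e) EFinD leeD.
apply: le_mu c1; first exact: m1.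
  by apply: measurableU; [exact: measurableD|exact: m1].
move=> x [[Fx nS]|[Sx nF]]; last by right; right; split => // /GF.
by have [Gx|nG] := pselect (G n x); [right; left|left].
Qed.

(** The cells contained in [A] exhaust it pointwise. *)
Lemma approximable_refined (A : set T) : measurable A ->
  (forall x, A x -> exists j0, forall j y, (j0 <= j)%N -> key j y = key j x -> A y) ->
  approximable A.
Proof.
move=> mA hA; split=> // e e0.
pose S j : {set Key j} := finset (fun c => `[< forall y, key j y = c -> A y >]).
have SA j : cells (S j) `<=` A.
  by move=> x; rewrite /cells/= inE => /asboolP; exact.
pose E j := \bigcap_(i in [set i | (j <= i)%N]) cells (S i).
have mE j : measurable (E j) by apply: bigcap_measurable => //; exists j => /=.
have EA j : E j `<=` A by move=> x /(_ j (leqnn j)) /SA.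
have UE : \bigcup_j E j = A.
  apply/seteqP; split; first by move=> x [j _ /EA].
  move=> x Ax; have [j0 h] := hA _ Ax; exists j0 => // j /= j0j.
  by rewrite /cells/= inE; apply/asboolP => y; exact: h.
have cE : mu (E n) @[n --> \oo] --> mu A.
  rewrite -UE; apply: nondecreasing_cvg_mu => //; first by rewrite UE.
  apply/nondecreasing_seqP => n; apply/subsetPset => x h i /= ni.
  by apply: h => /=; exact: ltnW.
have fE : fine (mu (E n)) @[n --> \oo] --> fine (mu A).
  by apply: fine_cvg; rewrite fineK// fin.
have : \forall n \near \oo, fine (mu A) - e < fine (mu (E n)).
  by apply: (cvgr_gt _ fE); rewrite ltrBlDr ltrDl.
move=> [n _ /(_ _ (leqnn n))] h; exists n => j nj; exists (S j).
have c1 : (mu (A `\` E n) <= e%:E)%E.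
  exact: le_muD.
apply: le_mu c1; last first.
- move=> x [[Ax nS]|[/SA//]]; split => // Ex; apply: nS; exact: Ex.
- exact: measurableD.
by apply: measurableU; exact: measurableD.
Qed.

Variable G : set (set T).
Hypothesis genG : forall A : set T, measurable A -> <<s G >> A.
Hypothesis mG : forall A, G A -> measurable A.
Hypothesis refG : forall (A : set T) x, G A -> A x ->
  exists j0, forall j y, (j0 <= j)%N -> key j y = key j x -> A y.

Lemma measurable_approximable A : measurable A -> approximable A.
Proof.
move=> /genG; apply: smallest_sub => [|B GB]; last first.
  by apply: approximable_refined; [exact: mG|move=> x; exact: refG].
split; first exact: approximable0.
  by move=> B aB; rewrite setTD; exact: approximableC.
exact: approximable_bigcup.
Qed.

Variables (f : T -> T) (K : nat).
Hypothesis codef : forall j, exists dec : Key j -> 'I_K -> Key j,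
  forall q, exists s, key j (f q) = dec (key j q) s.

(** Approximate each class of [gam] by a union of cells, and predict [gam] by
    one of the unions to which the cell belongs. *)
Lemma codable_of_keys : codable mu f K.
Proof.
move=> C gam mgam e e0.
have [x0 _] := probability_inhabited mu.
have C0 : 0 < #|C|%:R :> R by rewrite ltr0n; apply/card_gt0P; exists (gam x0).
have eC : 0 < e / #|C|%:R by rewrite divr_gt0.
have /choice[j1 hj1] c := (measurable_approximable (mgam c)).2 _ eC.
pose j := \max_(c : C) j1 c.
have /choice[S hS] c := hj1 c j (leq_bigmax c).
have [dec hdec] := codef j.
pose pi (w : Key j) : C := odflt (gam x0) [pick c | w \in S c].
exists (Key j), (key j), dec, pi; split => //.
pose D c := (gam @^-1` [set c] `\` cells (S c)) `|` (cells (S c) `\` gam @^-1` [set c]).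
have mD c : measurable (D c) by apply: measurableU; exact: measurableD.
have mU (r : seq C) : measurable (\big[setU/set0]_(c <- r) D c).
  exact: bigsetU_measurable.
have Dle (r : seq C) : (mu (\big[setU/set0]_(c <- r) D c) <=
    \sum_(c <- r) (e / #|C|%:R)%:E)%E.
  elim: r => [|c r ih]; first by rewrite !big_nil measure0.
  rewrite !big_cons; apply: (le_trans (measureU2 _ _ _)) => //.
  by apply: leeD => //; exact: hS.
have sub x : pi (key j x) != gam x -> exists c, D c x.
  move=> hx; apply: contrapT => no; move/eqP: hx; apply.
  have SE c : key j x \in S c -> c = gam x.
    by move=> Sx; apply: contrapT => cx; apply: no; exists c; right; split => // /esym.
  rewrite /pi; case: pickP => [c /SE//|/(_ (gam x)) nS] /=.
  by exfalso; apply: no; exists (gam x); left; split => //; rewrite /cells/= nS.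
have subU : [set x | pi (key j x) != gam x] `<=` \big[setU/set0]_(c <- enum C) D c.
  move=> x /sub[c Dx]; have : c \in enum C by rewrite mem_enum.
  elim: (enum C) => // c' r ih; rewrite in_cons big_cons => /orP[/eqP <-|/ih]; by [left|right].
apply: (@le_trans _ _ (mu (\big[setU/set0]_(c <- enum C) D c))); last first.
  apply: (le_trans (Dle _)); rewrite sumEFin lee_fin big_const_seq count_predT -cardE.
  by rewrite iter_addr_0 -[leLHS]mulr_natr divfK// gt_eqF.
apply: le_mu (lexx _) => //.
rewrite (_ : [set x | _] = \bigcup_(w in [set w : Key j * C | pi w.1 != w.2])
    (key j @^-1` [set w.1] `&` gam @^-1` [set w.2])).
  apply: fin_bigcup_measurable; first exact: finite_finset.
  by move=> w _; exact: measurableI.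
apply/seteqP; split => x; first by move=> xB; exists (key j x, gam x).
by move=> [[c c'] /= cc' [/= ec ec']]; rewrite /= ec ec'.
Qed.
End approximation.

(** * Local Lipschitz bounds for maps of class C1 *)

Section local_lipschitz.
Context {R : realType} {n m : nat}.
Implicit Types (h : 'rV[R]_n -> 'rV[R]_m) (p q z v : 'rV[R]_n).

Lemma mx_norm_le a b (A : 'M[R]_(a, b)) (r : R) : 0 <= r ->
  (forall i j, `|A i j| <= r) -> `|A| <= r.
Proof.
move=> r0 Ar; by rewrite /Num.Def.normr/= mx_normrE (bigmax_le _ r0).
Qed.

Lemma ler_coord_mx_norm a b (A : 'M[R]_(a, b)) i j : `|A i j| <= `|A|.
Proof.
rewrite [leRHS]/Num.Def.normr/= mx_normrE.
exact: (le_bigmax _ (fun i => `|A i.1 i.2|) (i, j)).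
Qed.

Lemma segment_lipschitz h z v (a b L : R) : a <= b -> 0 <= L ->
  (forall s, a <= s <= b -> derivable h (s *: v + z) v) ->
  (forall s, a <= s <= b -> `|'D_v h (s *: v + z)| <= L) ->
  `|h (b *: v + z) - h (a *: v + z)| <= L * (b - a).
Proof.
move=> ab L0 dh bh; apply: mx_norm_le; first by rewrite mulr_ge0 ?subr_ge0.
move=> i j; rewrite !mxE.
pose g s := h (s *: v + z) i j.
pose dg s := ('D_v h (s *: v + z)) i j.
have gd s : a <= s <= b -> is_derive s 1 g (dg s).
  move=> sab; have dhs := dh _ sab.
  have e : (fun t => t^-1 *: ((g \o shift s) (t *: 1) - g s)) =
      (fun t => t^-1 *: (((fun x => h x i j) \o shift (s *: v + z)) (t *: v) -
        h (s *: v + z) i j)).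
    apply/funext => t /=; rewrite /g scaler1 /shift/=.
    by rewrite scalerDl addrA.
  apply: DeriveDef; first by rewrite /derivable e; exact: ((derivable_mxP _ _ _).1 dhs i j).
  by rewrite /derive e /dg (derive_mx dhs) mxE.
have gd' s : s \in `]a, b[ -> is_derive s 1 g (dg s).
  by rewrite in_itv/= => /andP[as_ sb]; apply: gd; rewrite !ltW.
have cg : {within `[a, b], continuous g}.
  apply: derivable_within_continuous => s; rewrite in_itv/= => sab.
  by have [] := gd _ sab.
have [c cab ->] := MVT_segment ab gd' cg.
rewrite normrM (ger0_norm (_ : 0 <= b - a)) ?subr_ge0// ler_wpM2r ?subr_ge0//.
apply: le_trans (bh c _); first exact: ler_coord_mx_norm.
by move: cab; rewrite in_itv.
Qed.

(** Points of a ball are joined inside it by moving one coordinate at a time,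
    balls for the sup norm being products of intervals. *)
Lemma local_lipschitz h (U : set 'rV[R]_n) p0 : Ck 1 U h -> nbhs p0 U ->
  exists r L : R, [/\ 0 < r, 0 <= L, ball p0 r `<=` U & forall p q,
    ball p0 r p -> ball p0 r q -> `|h q - h p| <= L * `|q - p|].
Proof.
move=> [_ dU] Up0.
pose e (i : 'I_n) : 'rV[R]_n := delta_mx 0 i.
pose Li i := `|'D_(e i) h p0| + 1.
have nearL i : \forall p \near p0, `|'D_(e i) h p| < Li i.
  have [_ [cD _]] := dU (e i).
  have c0 := cD _ (nbhs_singleton Up0).
  have cn := @cvg_norm R 'rV[R]_m 'rV[R]_n (nbhs p0) (nbhs_filter p0) _ _ c0.
  by apply: (@cvgr_lt _ _ (nbhs p0) (nbhs_filter p0) _ _ cn); rewrite /Li ltrDl.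
have [r r0 rU] : exists2 r : R, 0 < r & ball p0 r `<=`
    U `&` [set p | forall i, `|'D_(e i) h p| < Li i].
  have : nbhs p0 (U `&` [set p | forall i, `|'D_(e i) h p| < Li i]).
    by apply: filterI => //; exact: (@filter_forall _ _ _ _ (nbhs_filter p0) nearL).
  by move=> /nbhs_ballP[r /= r0 rU]; exists r.
have Li0 i : 0 <= Li i by rewrite addr_ge0.
exists r, (\sum_i Li i); split => //.
- exact: sumr_ge0.
- by move=> p /rU[].
move=> p q pr qr.
(* the first [i] coordinates have been moved from [p] to [q] *)
pose P (i : nat) : 'rV[R]_n := \row_j (if (j < i)%N then q 0 j else p 0 j).
have P0 : P 0%N = p by apply/rowP => j; rewrite mxE ltn0.
have Pn : P n = q by apply/rowP => j; rewrite mxE ltn_ord.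
have step (i : 'I_n) : `|h (P i.+1) - h (P i)| <= Li i * `|q - p|.
  pose z : 'rV[R]_n := \row_j (if (j < i)%N then q 0 j else if j == i then 0 else p 0 j).
  have zE s : s *: e i + z =
      \row_j (if (j < i)%N then q 0 j else if j == i then s else p 0 j).
    apply/rowP => j; rewrite !mxE eqxx/=; case: (eqVneq j i) => [->|ji].
      by rewrite ltnn mulr1 addr0.
    by rewrite mulr0 add0r.
  have Pi : P i = p 0 i *: e i + z.
    by rewrite zE; apply/rowP => j; rewrite !mxE; case: eqP => [->|//]; rewrite ltnn.
  have PSi : P i.+1 = q 0 i *: e i + z.
    rewrite zE; apply/rowP => j; rewrite !mxE ltnS leq_eqVlt.
    by case: (eqVneq j i) => [->|ji]; [rewrite eqxx ltnn|rewrite (negbTE (ji : j != i :> nat))].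
  have zr (s : R) : Num.min (p 0 i) (q 0 i) <= s <= Num.max (p 0 i) (q 0 i) ->
      ball p0 r (s *: e i + z).
    move=> /andP[s1 s2]; case: pr qr => _ pr [_ qr]; split => // a j.
    rewrite zE !mxE !ord1; case: ifP => _; first exact: qr.
    case: eqP => [->|_]; last exact: pr.
    move: (pr 0 i) (qr 0 i); rewrite /ball/= !ltr_distl => /andP[p1 p2] /andP[q1 q2].
    move: s1 s2; rewrite ge_min le_max => /orP[] ? /orP[] ?; apply/andP; split; lra.
  have dist : `|q 0 i - p 0 i| <= `|q - p|.
    by have := ler_coord_mx_norm (q - p) 0 i; rewrite !mxE.
  have d1 s : Num.min (p 0 i) (q 0 i) <= s <= Num.max (p 0 i) (q 0 i) ->
      derivable h (s *: e i + z) (e i).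
    by move=> /zr/rU[Us _]; have [dd _] := dU (e i); exact: dd.
  have d2 s : Num.min (p 0 i) (q 0 i) <= s <= Num.max (p 0 i) (q 0 i) ->
      `|'D_(e i) h (s *: e i + z)| <= Li i.
    by move=> /zr/rU[_ /(_ i) /ltW].
  rewrite PSi Pi; have [pq|qp] := leP (p 0 i) (q 0 i).
    move: d1 d2; rewrite (min_l pq) (max_r pq) => d1 d2.
    apply: (le_trans (segment_lipschitz pq (Li0 i) d1 d2)).
    by rewrite ler_wpM2l// (le_trans (ler_norm _)).
  move: d1 d2; rewrite (min_r (ltW qp)) (max_l (ltW qp)) => d1 d2.
  rewrite distrC; apply: (le_trans (segment_lipschitz (ltW qp) (Li0 i) d1 d2)).
  by rewrite ler_wpM2l// (le_trans (ler_norm _))// distrC.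
rewrite -{1}Pn -{1}P0 -(telescope_sumr (fun i => h (P i)) (leq0n n)).
rewrite big_mkord; apply: (le_trans (ler_norm_sum _ _ _)).
by rewrite mulr_suml; apply: ler_sum => i _.
Qed.

End local_lipschitz.

(** * Finite covers of a compact manifold by charts *)

Lemma finite_cover (T : ptopologicalType) (P : T -> set T -> Prop) :
  compact [set: T] -> (forall x, exists U, [/\ open U, U x & P x U]) ->
  exists (A : finType) (pt : A -> T) (U : A -> set T),
    [/\ forall a, open (U a), forall x, exists a, U a x &
        forall a, P (pt a) (U a)].
Proof.
move=> cT /choice[U hU]; have := cT; rewrite compact_cover => /(_ T setT U)[].
- by move=> x _; case: (hU x).
- by move=> x _; exists x => //; case: (hU x).
move=> D _ cov; pose s := finmap.enum_fset D.
exists 'I_(size s), (fun a : 'I_(size s) => nth point s a),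
  (fun a : 'I_(size s) => U (nth point s a)); split.
- by move=> a; case: (hU (nth point s a)).
- move=> x; have [y /= yD Uyx] := cov x I.
  have ys : (index y s < size s)%N by rewrite index_mem.
  by exists (Ordinal ys); rewrite /= nth_index// -index_mem.
- by move=> a; case: (hU (nth point s a)).
Qed.

Section charted_cover.
Context {R : realType} {M : ptopologicalType} {d : nat}.
Variable S : smooth_structure R M d.
Hypotheses (M_hausdorff : hausdorff_space M) (M_compact : compact [set: M]).
Variable f : M -> M.
Hypothesis f_C1 : Ck_map S 1 f.

Lemma chart_shrink (x : M) : exists V, [/\ open V, V x &
  closure V `<=` dom (chart_at S x)].
Proof.
have ch := atlas_chart (chart_at_atlas S x).
have nx : nbhs x (dom (chart_at S x)).
  by apply: open_nbhs_nbhs; split; [exact: chart_dom_open ch|exact: chart_at_dom].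
have [V Vx VU] := compact_regular M_hausdorff M_compact (@filterT _ (nbhs x) _) nx.
exists V^°; split; [exact: open_interior|exact: Vx|].
by apply: subset_trans VU; apply: closure_subset; exact: interior_subset.
Qed.

(** A first cover, by sets whose closures stay inside their charts: the image
    of a point is either in the chart of [V j], or outside the closure of [V j]
    together with the images of nearby points. *)
Variables (J : finType) (pt : J -> M) (V : J -> set M).
Hypothesis V_open : forall j, open (V j).
Hypothesis V_cover : forall x, exists j, V j x.
Hypothesis V_dom : forall j, closure (V j) `<=` dom (chart_at S (pt j)).
Let phi j := cmap (chart_at S (pt j)).

Let chartP j := atlas_chart (chart_at_atlas S (pt j)).

Let chart_lipschitz i j x : V i x -> exists (L : R) (W : set M),
  [/\ 0 <= L, nbhs x W & forall y z, W y -> W z -> V j (f y) -> V j (f z) ->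
     `|phi j (f z) - phi j (f y)| <= L * `|phi i z - phi i y|].
Proof.
move=> Vx; have [fxV|fxV] := pselect (closure (V j) (f x)); last first.
  exists 0, (f @^-1` (~` closure (V j))); split => //.
    apply: (f_C1.1 x); apply: open_nbhs_nbhs; split => //.
    by apply: closed_openC; exact: closed_closure.
  by move=> y z Wy _ /subset_closure.
pose c := chart_at S (pt i); pose c' := chart_at S (pt j).
have cx : dom c x by apply: V_dom; exact: subset_closure.
pose O := dom c `&` f @^-1` dom c'.
have Ox : nbhs x O.
  apply: filterI.
    by apply: open_nbhs_nbhs; split => //; exact: chart_dom_open (chartP i).
  apply: (f_C1.1 x); apply: open_nbhs_nbhs; split; last exact: V_dom.
  exact: chart_dom_open (chartP j).
have cpx : chart_image c (cmap c x) by exists x.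
have nO : nbhs (cmap c x) (cmap c @` O).
  have : nbhs (cmap c x) (chart_image c `&` cinv c @^-1` O).
    apply: filterI.
      by apply: open_nbhs_nbhs; split => //; exact: chart_image_open (chartP i).
    apply: (chart_inv_continuous (chartP i) cpx).
    by rewrite (chart_cancel (chartP i) cx).
  apply: filterS => p [[y cy <-] /=]; rewrite (chart_cancel (chartP i) cy) => Oy.
  by exists y.
have [r [L [r0 L0 rO hL]]] := local_lipschitz
  (f_C1.2 _ _ (chart_at_atlas S (pt i)) (chart_at_atlas S (pt j))) nO.
exists L, (dom c `&` cmap c @^-1` ball (cmap c x) r); split => //.
  apply: filterI.
    by apply: open_nbhs_nbhs; split => //; exact: chart_dom_open (chartP i).
  by apply: (chart_continuous (chartP i) cx); exact: nbhsx_ballx.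
move=> y z [cy ry] [cz rz] _ _; have := hL _ _ ry rz.
by rewrite /= (chart_cancel (chartP i) cy) (chart_cancel (chartP i) cz).
Qed.

(** A neighbourhood of [x] small enough for [f] to be Lipschitz from one chart
    around [x] to every chart of the cover which its image meets. *)
Lemma chart_nbhd x : exists U, [/\ open U, U x & exists (i : J) (B L : R),
  [/\ U `<=` V i, 0 <= L, forall y, U y -> `|phi i y| <= B &
    forall j y z, U y -> U z -> V j (f y) -> V j (f z) ->
     `|phi j (f z) - phi j (f y)| <= L * `|phi i z - phi i y|]].
Proof.
have [i Vx] := V_cover x.
have /choice[L /choice[W hW]] j := chart_lipschitz j Vx.
have cx : dom (chart_at S (pt i)) x by apply: V_dom; exact: subset_closure.
pose Q := V i `&` [set y | forall j, W j y] `&` phi i @^-1` ball (phi i x) 1.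
have nQ : nbhs x Q.
  apply: filterI; first apply: filterI.
  - exact: open_nbhs_nbhs.
  - by apply: filter_forall => j; case: (hW j).
  - by apply: (chart_continuous (chartP i) cx); exact: nbhsx_ballx.
exists Q^°; split; [exact: open_interior|exact: nQ|].
exists i, (`|phi i x| + 1), (\sum_j L j); split.
- by move=> y /interior_subset[[]].
- by apply: sumr_ge0 => j _; case: (hW j).
- move=> y /interior_subset[_ /=]; rewrite -ball_normE/= => yx.
  have := ler_normB (phi i x) (phi i x - phi i y); rewrite subKr => h.
  by apply: (le_trans h); rewrite lerD2l ltW.
- move=> j y z /interior_subset[[_ Wy] _] /interior_subset[[_ Wz] _] Vy Vz.
  have [L0 _ h] := hW j.
  apply: (le_trans (h _ _ (Wy j) (Wz j) Vy Vz)).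
  rewrite ler_wpM2r// (bigD1 j)//= lerDl sumr_ge0// => j' _.
  by case: (hW j').
Qed.

End charted_cover.

(** The target charts have to be fixed before the source neighbourhoods are
    shrunk; keeping for each neighbourhood the chart of the set of the first
    cover that contains it makes one family serve both purposes. *)
Lemma charted_cover (R : realType) (M : ptopologicalType) (d : nat)
    (S : smooth_structure R M d) (f : M -> M) :
  hausdorff_space M -> compact [set: M] -> Ck_map S 1 f ->
  exists (A : finType) (c : A -> chart R M d) (U : A -> set M) (B L : R),
  [/\ forall a, is_chart (c a) /\ open (U a), forall x, exists a, U a x,
      forall a, U a `<=` dom (c a), 0 <= L /\
      (forall a x, U a x -> `|cmap (c a) x| <= B) &
      forall a b x y, U a x -> U a y -> U b (f x) -> U b (f y) ->
        `|cmap (c b) (f y) - cmap (c b) (f x)| <=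
          L * `|cmap (c a) y - cmap (c a) x|].
Proof.
move=> M_hausdorff M_compact f_C1.
have [J [pt [V [oV cV dV]]]] := finite_cover (P := fun x V => closure V `<=`
  dom (chart_at S x)) M_compact (chart_shrink S M_hausdorff M_compact).
have nb := chart_nbhd f_C1 oV cV dV.
have [A [pA [U [oU cU]]]] := finite_cover M_compact nb.
move=> /choice[i /choice[B /choice[L h]]].
exists A, (fun a => chart_at S (pt (i a))), U, (\sum_a `|B a|), (\sum_a L a).
split=> //.
- by move=> a; split => //; exact: atlas_chart (chart_at_atlas S _).
- move=> a x Ux; apply: dV; apply: subset_closure.
  by have [UV _ _ _] := h a; exact: UV.
- split; first by apply: sumr_ge0 => a _; have [] := h a.
  move=> a x Ux; have [_ _ bB _] := h a.
  apply: (le_trans (bB x Ux)); apply: (le_trans (ler_norm _)).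
  by rewrite (bigD1 a)//= lerDl sumr_ge0.
move=> a b x y Ux Uy Ufx Ufy; have [_ L0 _ hL] := h a; have [UV _ _ _] := h b.
apply: (le_trans (hL (i b) x y Ux Uy (UV _ Ufx) (UV _ Ufy))).
rewrite ler_wpM2r// (bigD1 a)//= lerDl sumr_ge0// => a' _.
by have [] := h a'.
Qed.

(** * Dyadic grids in charts *)

Lemma measurable_selection d (T : measurableType d) (A : finType)
    (U : A -> set T) : (forall a, measurable (U a)) ->
  (forall x, exists a, U a x) ->
  exists idx : T -> A, (forall a, measurable (idx @^-1` [set a])) /\
    forall x, U (idx x) x.
Proof.
move=> mU cU.
have [[x0 [a0 _]]|noT] := pselect (exists x0, exists a, U a x0); last first.
  have no (x : T) : False by have [a Ux] := cU x; apply: noT; exists x, a.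
  exists (fun x => False_rect A (no x)); split=> [a|x]; last by have := no x.
  rewrite (_ : _ @^-1` _ = set0)//.
  by apply/seteqP; split => // x; have := no x.
(* depends on [x] only through the finitely many values of [vec] *)
pose sel x := [pick a | `[< U a x >]].
exists (fun x => odflt a0 (sel x)); split; last first.
  move=> x; rewrite /sel; case: pickP => [a /asboolP//|h].
  by have [a /asboolP] := cU x; rewrite h.
pose vec x : {ffun A -> bool} := [ffun a => `[< U a x >]].
have mvec v : measurable (vec @^-1` [set v]) by exact: measurable_membership.
have selE x : sel x = [pick a | vec x a].
  by apply: eq_pick => a; rewrite ffunE.
move=> a; rewrite (_ : _ @^-1` _ = \bigcup_(v in
    [set v : {ffun A -> bool} | odflt a0 [pick a | v a] = a]) vec @^-1` [set v]).
  by apply: fin_bigcup_measurable => //; exact: finite_finset.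
apply/seteqP; split => x /=; rewrite selE; first by move=> <-; exists (vec x).
by move=> [v /= <- <-].
Qed.

Section grid.
Context {R : realType} {M : ptopologicalType} {d : nat}.
Variable f : M -> M.
Variables (A : finType) (c : A -> chart R M d) (U : A -> set M) (B L : R).
Hypothesis chartU : forall a, is_chart (c a) /\ open (U a).
Hypothesis domU : forall a, U a `<=` dom (c a).
Hypothesis L0 : 0 <= L.
Hypothesis bndU : forall a x, U a x -> `|cmap (c a) x| <= B.
Hypothesis lipU : forall a b x y, U a x -> U a y -> U b (f x) -> U b (f y) ->
  `|cmap (c b) (f y) - cmap (c b) (f x)| <= L * `|cmap (c a) y - cmap (c a) x|.
Variable idx : borel M -> A.
Hypothesis midx : forall a, measurable (idx @^-1` [set a]).
Hypothesis idxU : forall x, U (idx x) x.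

(** Position in the grid of mesh [2 ^- j], the origin being shifted so that all
    coordinates are nonnegative. *)
Let pos (a : A) (j : nat) (m : 'I_d) (x : M) : R :=
  2 ^+ j * (cmap (c a) x 0 m + B).
Let t (a : A) (j : nat) (m : 'I_d) (x : M) : nat := Num.truncn (pos a j m x).
Let N (j : nat) : nat := Num.truncn (2 ^+ j * (2 * B)).

Let coord_bnd a x m : U a x -> - B <= cmap (c a) x 0 m <= B.
Proof.
move=> /bndU; rewrite -ler_norml; apply: le_trans; exact: ler_coord_mx_norm.
Qed.

Let two_gt0 j : 0 < 2 ^+ j :> R. Proof. exact: exprn_gt0. Qed.

Let pos_ge0 a j m x : U a x -> 0 <= pos a j m x.
Proof.
move=> /(coord_bnd m) /andP[b1 b2]; rewrite mulr_ge0 ?exprn_ge0//.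
by lra.
Qed.

Let t_le a j m x : U a x -> (t a j m x < (N j).+1)%N.
Proof.
move=> /(coord_bnd m) /andP[b1 b2]; rewrite ltnS; apply: le_truncn.
by rewrite ler_wpM2l ?exprn_ge0//; lra.
Qed.

Definition grid_key j (x : borel M) : A * {ffun 'I_d -> 'I_(N j).+1} :=
  (idx x, [ffun m => inord (t (idx x) j m x)]).

Let keyP j x y : grid_key j x = grid_key j y <->
  idx x = idx y /\ forall m, t (idx x) j m x = t (idx x) j m y.
Proof.
split; last first.
  move=> [e h]; rewrite /grid_key -e; congr (_, _).
  by apply/ffunP => m; rewrite !ffunE h.
move=> e; have e1 : idx x = idx y := congr1 fst e.
split=> // m; have := congr1 (fun w : A * {ffun 'I_d -> 'I_(N j).+1} => nat_of_ord (w.2 m)) e.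
by rewrite /= !ffunE -e1 !inordK// t_le// e1.
Qed.

Let key_dist j x y m : grid_key j x = grid_key j y ->
  `|2 ^+ j * (cmap (c (idx x)) x 0 m - cmap (c (idx x)) y 0 m)| < 1.
Proof.
move=> /keyP[e /(_ m) ht].
have Uy : U (idx x) y by rewrite e.
have /andP[x1 x2] := truncn_itv (pos_ge0 j m (idxU x)).
have /andP[y1 y2] := truncn_itv (pos_ge0 j m Uy).
rewrite -/(t _ _ _ _) in x1 x2 y1 y2.
have -> : 2 ^+ j * (cmap (c (idx x)) x 0 m - cmap (c (idx x)) y 0 m) =
  pos (idx x) j m x - pos (idx x) j m y by rewrite /pos; ring.
rewrite ltr_norml; move: x1 x2 y1 y2; rewrite ht -natr1 => *; apply/andP; split; lra.
Qed.

Let key_norm j x y : grid_key j x = grid_key j y ->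
  `|cmap (c (idx x)) y - cmap (c (idx x)) x| <= (2 ^+ j)^-1.
Proof.
move=> e; apply: mx_norm_le; first by rewrite invr_ge0 ltW.
move=> i m; have := key_dist m e; rewrite normrM (gtr0_norm (two_gt0 j)).
rewrite mulrC -ltr_pdivlMr// div1r distrC !mxE !ord1; exact: ltW.
Qed.

Lemma measurable_grid_key j w : measurable (grid_key j @^-1` [set w]).
Proof.
case: w => a v.
have open_lt m n : open (dom (c a) `&` [set x | (t a j m x < n)%N]).
  case: n => [|n].
    rewrite (_ : _ `&` _ = set0); first exact: open0.
    by apply/seteqP; split => // x [].
  rewrite openE => x [dx xn].
  have n1 : nbhs x (dom (c a)).
    apply: open_nbhs_nbhs; split => //; exact: chart_dom_open (chartU a).1.
  apply: filterI => //.
  have xn' : cmap (c a) x 0 m < n.+1%:R / 2 ^+ j - B.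
    move: xn; rewrite /= ltnS truncn_le_nat /pos mulrC.
    by rewrite -ltr_pdivlMr// -ltrBrDr.
  have cc : cmap (c a) y 0 m @[y --> x] --> cmap (c a) x 0 m.
    exact: (@cvg_comp _ _ _ (cmap (c a)) (fun p : 'rV[R]_d => p 0 m) (nbhs x)
      (nbhs (cmap (c a) x)) (nbhs (cmap (c a) x 0 m))
      (chart_continuous (chartU a).1 dx) (@coord_continuous _ _ _ 0 m (cmap (c a) x))).
  have := cvgr_lt _ cc _ xn' => /(_ (nbhs_filter x)); apply: filterS => y /= yn.
  by rewrite ltnS truncn_le_nat /pos mulrC -ltr_pdivlMr// -ltrBrDr.
have mlt m n : measurable (dom (c a) `&` [set x | (t a j m x < n)%N] : set (borel M)).
  by apply: sub_sigma_algebra; exact: open_lt.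
rewrite (_ : _ @^-1` _ = idx @^-1` [set a] `&` \bigcap_(m in [set: 'I_d])
   ((dom (c a) `&` [set x | (t a j m x < (v m).+1)%N]) `\`
    (dom (c a) `&` [set x | (t a j m x < v m)%N]))).
  apply: measurableI => //; apply: fin_bigcap_measurable; first exact: finite_finset.
  by move=> m _; apply: measurableD; exact: mlt.
apply/seteqP; split => x.
  rewrite /= /grid_key => -[ia vE]; split => // m _; have Ux := idxU x; rewrite ia in Ux.
  have tv : t a j m x = v m by rewrite -vE ffunE inordK ?ia ?t_le.
  split; first by split; [exact: domU|rewrite /= tv].
  by move=> [_ /=]; rewrite tv ltnn.
move=> [/= ia h]; rewrite /grid_key ia; congr (_, _).
apply/ffunP => m; rewrite ffunE; apply/val_inj => /=.
have [[dx h1] h2] := h m I; have Ux := idxU x; rewrite ia in Ux.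
have tv : t a j m x = v m.
  apply/eqP; rewrite eqn_leq -ltnS h1/= leqNgt; apply/negP => lt; exact: h2.
by rewrite tv inordK// ltn_ord.
Qed.

Lemma grid_key_refine (O : set M) x : open O -> O x ->
  exists j0, forall j y, (j0 <= j)%N -> grid_key j y = grid_key j x -> O y.
Proof.
move=> oO Ox; have Ux := idxU x; have [ch _] := chartU (idx x).
have dx := domU Ux.
have px : chart_image (c (idx x)) (cmap (c (idx x)) x) by exists x.
have : nbhs (cmap (c (idx x)) x) (cinv (c (idx x)) @^-1` O).
  apply: (chart_inv_continuous ch px).
  by rewrite (chart_cancel ch dx); exact: open_nbhs_nbhs.
move=> /nbhs_ballP[e /= e0 eO].
have [j0 hj0] : exists j0, forall j, (j0 <= j)%N -> (2 ^+ j)^-1 < e.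
  have : (1 / 2) ^+ j @[j --> \oo] --> (0 : R).
    by apply: cvg_expr; rewrite ger0_norm ?divr_ge0// ltr_pdivrMr// mul1r ltr1n.
  move=> /cvgr_lt /(_ _ e0)[j0 _ h]; exists j0 => j /h.
  by rewrite /= expr_div_n expr1n div1r.
exists j0 => j y /hj0 je /esym k.
have iy := congr1 fst k; rewrite /= in iy.
have dy : dom (c (idx x)) y by apply: domU; rewrite iy.
rewrite -(chart_cancel ch dy); apply: eO; rewrite -ball_normE/= distrC.
by apply: le_lt_trans je; exact: key_norm.
Qed.

(* points at distance [L] meshes lie in cells at most this far apart *)
Let Lam : nat := (Num.truncn L).+1.
Definition grid_symbol := (A * {ffun 'I_d -> 'I_(2 * Lam).+1})%type.

(** A symbol tells the chart of [f q] and the offset of its cell from the cell of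
    [f q0], where [q0] is any chosen point of the cell of [q] whose image uses
    the same chart. *)
Lemma grid_key_code j : exists dec : A * {ffun 'I_d -> 'I_(N j).+1} ->
    'I_#|{: grid_symbol}| -> A * {ffun 'I_d -> 'I_(N j).+1},
  forall q, exists s, grid_key j (f q) = dec (grid_key j q) s.
Proof.
pose base w b : borel M := xget point [set q | grid_key j q = w /\ idx (f q) = b].
(* offsets between cells are shifted by [Lam] to be natural numbers *)
exists (fun w s => let bo : grid_symbol := enum_val s in
  (bo.1, [ffun m => inord (bo.2 m + t bo.1 j m (f (base w bo.1)) - Lam)])).
move=> q; pose b := idx (f q); pose q0 := base (grid_key j q) b.
have [k0 b0] : grid_key j q0 = grid_key j q /\ idx (f q0) = b.
  by rewrite /q0 /base; case: xgetP => // /(_ q) h; exfalso; apply: h.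
have near (q1 q2 : borel M) m : grid_key j q1 = grid_key j q2 ->
    idx (f q1) = b -> idx (f q2) = b ->
    (t b j m (f q1) <= t b j m (f q2) + Lam)%N.
  move=> e i1 i2; have iE := congr1 fst e; rewrite /= in iE.
  have U1 : U b (f q1) by rewrite -i1.
  have U2 : U b (f q2) by rewrite -i2.
  have Uq2 : U (idx q1) q2 by rewrite iE.
  have h := lipU (idxU q1) Uq2 U1 U2.
  have {}h : `|cmap (c b) (f q2) 0 m - cmap (c b) (f q1) 0 m| <= L * (2 ^+ j)^-1.
    apply: (le_trans _ (le_trans h _)).
      by have := ler_coord_mx_norm (cmap (c b) (f q2) - cmap (c b) (f q1)) 0 m; rewrite !mxE.
    by rewrite ler_wpM2l//; exact: key_norm.
  have p12 : pos b j m (f q1) <= pos b j m (f q2) + L.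
    move: h; rewrite ler_norml => /andP[h _].
    have : 2 ^+ j * (cmap (c b) (f q1) 0 m - cmap (c b) (f q2) 0 m) <= L.
      rewrite mulrC -ler_pdivlMr//; lra.
    rewrite /pos; lra.
  have /andP[_ x2] := truncn_itv (pos_ge0 j m U2); rewrite -/(t _ _ _ _) in x2.
  have l2 := truncnS_gt L.
  rewrite /t truncn_le_nat (le_lt_trans p12)// -/(t _ _ _ _).
  move: x2 l2; rewrite /Lam -addnS natrD -[(t _ _ _ _).+1%:R]natr1 -[_.+2%:R]natr1.
  move=> x2 l2; lra.
pose o : {ffun 'I_d -> 'I_(2 * Lam).+1} :=
  [ffun m => inord (t b j m (f q) + Lam - t b j m (f q0))].
exists (enum_rank ((b, o) : grid_symbol)); rewrite enum_rankK/= /grid_key.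
congr (_, _); apply/ffunP => m; rewrite !ffunE -/b -/q0.
have n1 := near q q0 m (esym k0) erefl b0.
have n2 := near q0 q m k0 b0 erefl.
rewrite inordK; last by move: n1 n2; rewrite /Lam; lia.
by congr inord; move: n1 n2; lia.
Qed.

End grid.

(** A Lipschitz map sends a cell into boundedly many cells of the same mesh,
    whatever the mesh. *)
Theorem codable_Ck_map (R : realType) (M : ptopologicalType) (d : nat)
    (S : smooth_structure R M d) (f : M -> M) (mu : probability (borel M) R) :
  hausdorff_space M -> compact [set: M] -> Ck_map S 1 f ->
  exists K, codable mu (f : borel M -> borel M) K.
Proof.
move=> M_hausdorff M_compact f_C1.
have [A [c [U [B [L [chU cU dU [L0 bU] lU]]]]]] :=
  charted_cover M_hausdorff M_compact f_C1.
have mU a : measurable (U a : set (borel M)).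
  by apply: sub_sigma_algebra; exact: (chU a).2.
have [idx [midx idxU]] := measurable_selection mU cU.
exists #|{: @grid_symbol R d A L}|.
apply: (@codable_of_keys _ _ _ mu _ (grid_key c B idx) _ (@open M)) => //.
- exact: (measurable_grid_key chU dU bU midx idxU).
- by move=> O; exact: sub_sigma_algebra.
- move=> O x; exact: (grid_key_refine chU dU bU idxU).
- exact: (grid_key_code L0 bU lU idxU).
Qed.

(** * Outer measures and lower integrals up to null sets *)

Import HBNNSimple.

(** The integral of a nonnegative function is a supremum over simple functions
    below it, also when it is not measurable; an information function may fail
    to be measurable on a null set. *)
Lemma ge0_ae_eq_integral_of d (T : measurableType d) (R : realType)
    (mu : {measure set T -> \bar R}) (F G : T -> \bar R) :
  (forall x, 0 <= F x)%E -> (forall x, 0 <= G x)%E -> measurable_fun setT G ->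
  {ae mu, forall x, F x = G x} -> (\int[mu]_x F x = \int[mu]_x G x)%E.
Proof.
move=> F0 G0 mG [Z [mZ Z0 FG]].
have {}FG x : ~ Z x -> F x = G x.
  by move=> nZ; apply: contrapT => ne; apply: nZ; exact: FG.
apply/eqP; rewrite eq_le; apply/andP; split.
  rewrite [leLHS]ge0_integralTE//; apply: ge_ereal_sup => _ [s sF <-].
  rewrite -integralT_nnsfun; apply: ae_ge0_le_integral => //.
  - by move=> x _; rewrite lee_fin; exact: fun_ge0.
  - exact/measurable_EFinP.
  exists Z; split => // x /= /not_implyP[_ sG]; apply: contrapT => nZ.
  by apply: sG; rewrite -FG//; exact: sF.
rewrite (ge0_negligible_integral mZ _ _ _ Z0)//.
rewrite integral_mkcond/= setTD [leRHS]ge0_integralTE// ge0_integralTE; last first.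
  by move=> x; rewrite patchE; case: ifP.
apply: ereal_sup_le => _ [s sG <-]; exists s => // x.
apply: (le_trans (sG x)); rewrite patchE; case: ifP => // /[!inE] nZ.
by rewrite FG.
Qed.

Section mu_ext.
Context d (T : measurableType d) (R : realType) (mu : {measure set T -> \bar R}).

Lemma mu_ext_ae (C D : set T) (N : set T) : measurable D -> mu.-negligible N ->
  (forall y, ~ N y -> C y <-> D y) -> mu_ext mu C = mu D.
Proof.
move=> mD [Z [mZ Z0 NZ]] CD.
have mDZ : measurable (D `|` Z) by exact: measurableU.
have mDdZ : measurable (D `\` Z) by exact: measurableD.
have DZ : (mu (D `|` Z) <= mu D)%E.
  apply: (le_trans (measureU2 _ mD mZ)).
  have : (mu D + mu Z <= mu D)%E by rewrite Z0 adde0.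
  exact.
have DdZ : (mu D <= mu (D `\` Z))%E.
  apply: (@le_trans _ _ (mu ((D `\` Z) `|` Z))).
    apply: le_measure; rewrite ?inE//; first exact: measurableU.
    by move=> y Dy; have [|] := pselect (Z y); [right|left].
  apply: (le_trans (measureU2 _ mDdZ mZ)).
  have : (mu (D `\` Z) + mu Z <= mu (D `\` Z))%E by rewrite Z0 adde0.
  exact.
apply/eqP; rewrite eq_le; apply/andP; split.
  apply: le_trans DZ; rewrite -(measurable_mu_extE mu mDZ).
  apply: le_mu_ext => y Cy.
  by have [/NZ|/CD[h _]] := pselect (N y); [right|left; exact: h].
apply: (le_trans DdZ); rewrite -(measurable_mu_extE mu mDdZ).
by apply: le_mu_ext => y [Dy nZ]; apply/CD => // /NZ.
Qed.

Lemma mu_ext_le1 (C : set T) : mu setT = 1%E -> (mu_ext mu C <= 1)%E.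
Proof.
move=> <-; rewrite -(measurable_mu_extE mu measurableT).
exact: le_mu_ext.
Qed.

End mu_ext.

(** * From measurable partitions to measurable relations *)

Definition separation d (T : measurableType d) (B : nat -> set T) : set (T * T) :=
  [set w | forall n, B n w.1 <-> B n w.2].

Lemma per_separation d (T : measurableType d) (B : nat -> set T) :
  (forall n, measurable (B n)) -> is_per (separation B).
Proof.
move=> mB; split.
- rewrite (_ : separation B = \bigcap_n ((B n `*` B n) `|` (~` B n `*` ~` B n))).
    apply: bigcapT_measurable => n.
    have mBC : measurable (~` B n) by exact: measurableC.
    by apply: measurableU; exact: measurableX.
  apply/seteqP; split => -[x y] /=.
    move=> h n _; have [Bx|Bx] := pselect (B n x); [left|right]; split => //=.
      by apply/(h n).
    by move=> By; apply: Bx; apply/(h n).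
  move=> h n; have [[Bx By]|[Bx By]] := h n I; first by split.
  by split => [/Bx|/By].
- by move=> x y h n; split => ?; apply/(h n).
- by move=> x y z h h' n; apply: iff_trans (h n) (h' n).
Qed.

Section partitions.
Context {R : realType} {M : ptopologicalType}.
Variable mu : probability (borel M) R.
Variables f finv : borel M -> borel M.
Hypotheses (mf : measurable_fun setT f) (mfinv : measurable_fun setT finv).
Hypotheses (fK : cancel f finv) (finvK : cancel finv f).
Hypothesis ergf : ergodic_measure mu f.
Variable xi : M -> set M.
Hypothesis xi_meas : measurable_partition mu xi.
Hypothesis xi_incr : finer (pullback_partition f xi) xi.
Variable mux : R.-pker (borel M) ~> (borel M).
Hypothesis mux_xi : conditional_system mu xi mux.
Variable K : nat.
Hypothesis f_codable : codable mu f K.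
Variable alpha : M -> set M.
Hypothesis alpha_meas : measurable_partition mu alpha.
Hypothesis alpha_fin : (cond_entropy mu mux alpha < +oo)%E.

Let inv : forall A : set (borel M), measurable A -> mu (f @^-1` A) = mu A.
Proof. exact: ergf.1. Qed.

Let erg : forall A : set (borel M), measurable A -> f @^-1` A = A ->
  mu A = 0%E \/ mu A = 1%E.
Proof. exact: ergf.2. Qed.

Let dis : forall A : set (borel M), measurable A -> mu A = (\int[mu]_x mux x A)%E.
Proof. by have [_ _] := mux_xi. Qed.

Let inv_finv (A : set (borel M)) : measurable A -> mu (finv @^-1` A) = mu A.
Proof. exact: (invariant_inverse mfinv fK inv). Qed.

(** Leave out all images and preimages of [N]. *)
Lemma invariant_conull (N : set (borel M)) : mu.-negligible N ->
  exists T0 : set (borel M), [/\ measurable T0, mu.-negligible (~` T0),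
    forall x, T0 x <-> T0 (f x) & forall x, T0 x -> ~ N x].
Proof.
move=> [Z [mZ Z0 NZ]].
pose O := (\bigcup_i iter i f @^-1` Z) `|` (\bigcup_i iter i finv @^-1` Z).
have mif i : measurable (iter i f @^-1` Z).
  by rewrite -[X in measurable X]setTI; exact: (measurable_iter mf i).
have mifinv i : measurable (iter i finv @^-1` Z).
  by rewrite -[X in measurable X]setTI; exact: (measurable_iter mfinv i).
have mO : measurable O.
  by apply: measurableU; exact: bigcupT_measurable.
have nO : mu.-negligible O.
  apply: negligibleU; apply: negligible_bigcup => i.
    exists (iter i f @^-1` Z); split => //.
    elim: i => // i ih; apply: etrans ih; apply: etrans (inv (mif i)); congr (mu _).
    by apply/seteqP; split => x /=; rewrite -iterSr.
  exists (iter i finv @^-1` Z); split => //.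
  elim: i => // i ih; apply: etrans ih; apply: etrans (inv_finv (mifinv i)); congr (mu _).
  by apply/seteqP; split => x /=; rewrite -iterSr.
exists (~` O); split.
- exact: measurableC.
- by rewrite setCK.
- move=> x; split=> nOx; apply: contra_not nOx => -[[i _ /= h]|[i _ /= h]].
  + by left; exists i.+1 => //=; rewrite -iterS iterSr.
  + case: i h => [|i] /=; first by left; exists 1%N.
    by rewrite -iterS iterSr fK => h; right; exists i.
  + case: i h => [|i] /=; last by rewrite -iterS iterSr => h; left; exists i.
    by move=> Zx; right; exists 1%N => //=; rewrite fK.
  + by right; exists i.+1 => //=; rewrite -iterS iterSr fK.
- by move=> x nOx /NZ Zx; apply: nOx; left; exists 0%N.
Qed.

(** Outside an invariant null set, the class of a point under [xi] or [alpha]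
    is the set of points that a countable family of measurable sets does not
    separate from it.  So both are replaced by measurable relations, with the
    same information almost everywhere, and [window_smb] applies. *)
Theorem partition_smb : {ae mu, forall x,
  (((n%:R^-1)%:E * information mux (iterated_join f alpha n) x)%E
     @[n --> \oo]) --> dyn_cond_entropy mu f mux alpha}.
Proof.
have [[N1 N10 eqmux] conc _] := mux_xi.
have [_ [N2 [B [N20 mB xiB]]]] := xi_meas.
have [_ [Na [Ba [Na0 mBa alphaB]]]] := alpha_meas.
have [T0 [mT0 T00 fT0 nT0]] := invariant_conull (negligibleU N10 N20).
have [Ta [mTa Ta0 fTa nTa]] := invariant_conull Na0.
(* on [T0], the relation of [xi]; the other points belong to no class *)
pose X : set (borel M * borel M) := [set w | T0 w.1 /\ T0 w.2] `&` separation B.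
pose A : set (borel M * borel M) := separation Ba.
have pA : is_per A by exact: per_separation.
have pX : is_per X.
  apply: perI; last exact: per_separation.
  split; first by rewrite (_ : [set w | _] = T0 `*` T0)//; exact: measurableX.
    by move=> x y [].
  by move=> x y z [? ?] [].
have xiX x y : T0 x -> T0 y -> xi x y <-> X (x, y).
  move=> Tx Ty; have e : xi x y <-> forall n, B n x <-> B n y.
    by apply: xiB => Nx; [apply: (nT0 x Tx)|apply: (nT0 y Ty)]; right.
  by split=> [/e h|[_ h]]; [split|apply/e].
have kX x y : X (x, y) ->
    forall E : set (borel M), measurable E -> mux x E = mux y E.
  move=> Xxy; have [[/= Tx Ty] _] := Xxy.
  apply: eqmux => [Nx|Nx|]; [apply: (nT0 x Tx); by left|apply: (nT0 y Ty); by left|].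
  exact/xiX.
have mX := per_measurable pX.
have concX : {ae mu, forall x, mux x (~` xsection X x) = 0%E}.
  have T0x : {ae mu, forall x, T0 x} by exact: T00.
  move: conc T0x (ae_kernel_null dis T00); apply: filterS3 => x h1 Tx h2.
  have [Z [mZ Z0 XZ]] := negligibleU h1 h2.
  apply: (@subset_measure0 _ _ _ (mux x) _ Z) => //.
    by apply: measurableC; exact: measurable_xsection.
  apply: subset_trans XZ => y nX.
  have [Ty|] := pselect (T0 y); last by right.
  by left => /(xiX _ _ Tx Ty) h; apply: nX; apply/xsectionP.
have fX : pull f X `<=` X.
  move=> [x y] Xf; have [[/= Tfx Tfy] _] := Xf.
  have [Tx Ty] := ((fT0 x).2 Tfx, (fT0 y).2 Tfy).
  by apply/xiX => //; apply: xi_incr; exact/xiX.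
have BX x y : T0 x -> T0 y -> (forall n, B n x <-> B n y) -> X (x, y).
  by move=> Tx Ty h; split.
have XB x y : X (x, y) -> forall n, B n x <-> B n y by case.
have posX1 := step_mass_gt0 dis pX kX concX mf mfinv fK finvK inv fX f_codable
  mB T00 XB BX.
have finX1 := step_entropy_fin dis pX kX concX mf mfinv fK finvK inv fX f_codable
  mB T00 XB BX.
pose m := class_mass mux.
pose W := window X f finv A.
have pW n : is_per (W 0 n) by exact: per_window.
have mW n : measurable (W 0 n) := per_measurable (pW n).
have ext : {ae mu, forall x, forall n,
    mu_ext (mux x) (iterated_join f alpha n x) = (m (W 0 n) x)%:E}.
  have Tax : {ae mu, forall x, Ta x} by exact: Ta0.
  have h : {ae mu, forall x, Ta x /\ (mux x).-negligible (~` Ta `|` ~` xsection X x)}.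
    move: Tax concX (ae_kernel_null dis Ta0); apply: filterS3 => x Tx h1 h2.
    split => //; apply: negligibleU => //.
    exists (~` xsection X x); split => //.
    by apply: measurableC; exact: measurable_xsection.
  apply: filterS h => x [Tx nx] n; rewrite class_massE//.
  apply: (mu_ext_ae _ nx); first exact: measurable_xsection.
  move=> y /not_orP[/contrapT Ty /contrapT/xsectionP Xxy].
  have Taf i z : Ta z -> Ta (iter i f z) by elim: i => // i ih /ih /fTa.
  have aA i : alpha (iter i f x) (iter i f y) <-> A (iter i f x, iter i f y).
    by apply: alphaB; apply: nTa; exact: Taf.
  split=> [h|/xsectionP[_ [_ h]] i /= ni].
    apply/xsectionP; split => //; split => // i ni; apply/aA; exact: h.
  by apply/aA; exact: (h i ni).
have info_ge0 C x : (0 <= information mux C x)%E.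
  have mE := @mu_ext_le1 _ _ _ (mux x) (C x) (prob_kernel (x : borel M)).
  rewrite /information oppe_ge0 -lne1.
  have [h|h] := leP (mu_ext (mux x) (C x)) 0%E; first by rewrite (le0_lneNy h) leNye.
  by rewrite lee_lne// in_itv/= leey ?(ltW h)// lee01.
pose info (r : R) : \bar R := if r == 0 then +oo%E else (- ln r)%:E.
have infoE n : {ae mu, forall x,
    information mux (iterated_join f alpha n) x = info (m (W 0 n) x)}.
  apply: filterS ext => x /(_ n) e; rewrite /information e /info.
  case: eqVneq => [->|m0]; first by rewrite le0_lneNy.
  by rewrite lne_EFin// lt_neqAle eq_sym m0 class_mass_ge0.
have minfo (E : set (borel M * borel M)) : measurable E ->
    measurable_fun setT (fun x => info (m E x)).
  move=> mE; have mm := measurable_class_mass mux mE.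
  apply: measurable_fun_ifT => //; first exact: measurable_fun_eqr.
  by apply/measurable_EFinP; exact: measurable_class_info.
have info0 (E : set (borel M * borel M)) x : measurable E -> (0 <= info (m E x))%E.
  move=> mE; rewrite /info; case: ifP => // _.
  by rewrite lee_fin class_info_ge0.
have intE n : (cond_entropy mu mux (iterated_join f alpha n) =
    \int[mu]_x info (m (W 0%N n) x))%E.
  apply: ge0_ae_eq_integral_of => //; [by move=> x; exact: info0|exact: minfo|exact: infoE].
have W1 : W 0 1%N = A `&` X.
  apply/seteqP; split => [[x y] [Xxy [_ h]]|[x y] [Axy Xxy]].
    by split => //; exact: (h 0%N).
  by split => //; split => // -[|].
have join1 : iterated_join f alpha 1 = alpha.
  apply/funext => x; apply/seteqP; split => [y /(_ 0%N)|y axy [|]//]; exact.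
have fin1 : (\int[mu]_x info (m (A `&` X) x) < +oo)%E.
  by rewrite -W1 -intE join1.
have mAX : measurable (A `&` X) by rewrite -W1.
have posA : {ae mu, forall x, 0 < m (A `&` X) x}.
  have itg : mu.-integrable setT (fun x => info (m (A `&` X) x)).
    apply/integrableP; split; first exact: minfo.
    by under eq_integral do rewrite gee0_abs ?info0//.
  apply: filterS (integrable_ae measurableT itg) => x /(_ I).
  rewrite /info; case: eqVneq => // m0 _.
  by rewrite lt_neqAle eq_sym m0 class_mass_ge0.
have finA : (\int[mu]_x (- ln (m (A `&` X) x))%:E < +oo)%E.
  apply: le_lt_trans fin1; apply: ge0_le_integral => //.
  - by move=> x _; rewrite lee_fin class_info_ge0.
  - by apply/measurable_EFinP; exact: measurable_class_info.
  - exact: minfo.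
  - by move=> x _; rewrite /info; case: ifP => // _; rewrite leey.
have [b [cvgb finb intb]] := window_smb dis pX kX concX mf mfinv fK finvK inv erg fX
  pA posX1 posA finX1 finA.
have posW : {ae mu, forall x, forall n, 0 < m (W 0 n) x}.
  apply: ae_foralln => n.
  have := window_mass_gt0 dis pX kX concX mf mfinv fK finvK inv fX pA posX1 posA 0 n.
  apply: filterS => x /lt_le_trans; apply; apply: le_class_mass => //.
  by apply: measurableI => //; exact: measurable_pull.
have entE n : cond_entropy mu mux (iterated_join f alpha n) =
    (fine (\int[mu]_x (- ln (m (W 0 n) x))%:E)%E)%:E.
  rewrite fineK; last first.
    rewrite ge0_fin_numE//; apply: integral_ge0 => x _.
    by rewrite lee_fin class_info_ge0.
  rewrite intE; apply: ge0_ae_eq_integral_of => //.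
  - by move=> x; exact: info0.
  - by move=> x; rewrite lee_fin class_info_ge0.
  - by apply/measurable_EFinP; exact: measurable_class_info.
  - by apply: filterS posW => x /(_ n) m0; rewrite /info gt_eqF.
have -> : dyn_cond_entropy mu f mux alpha = b%:E.
  have cb : ((n%:R^-1)%:E * cond_entropy mu mux (iterated_join f alpha n))%E
      @[n --> \oo] --> b%:E.
    under eq_fun do rewrite entE -EFinM.
    by apply: cvg_EFin; [exact: nearW|].

  by have [_ e] := cvg_limn_einf_sup cb.
have infoA : {ae mu, forall x : borel M, forall n,
    information mux (iterated_join f alpha n) x = info (m (W 0 n) x)}.
  exact: ae_foralln.
have goal : {ae mu, forall x : borel M,
    ((n%:R^-1)%:E * information mux (iterated_join f alpha n) x)%E
      @[n --> \oo] --> b%:E}.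
  move: infoA posW cvgb; apply: filterS3 => x ix px cx.
  rewrite (_ : (fun n => _) = (fun n => (n%:R^-1 * - ln (m (W 0 n) x))%:E)).
    by apply: cvg_EFin; [exact: nearW|].
  by apply/funext => n; rewrite ix /info gt_eqF// -EFinM.
exact: goal.
Qed.

End partitions.

(** * The pointwise limit of conditional information *)

Lemma continuous_borel_measurable (M : ptopologicalType) (f : M -> M) :
  continuous f -> measurable_fun setT (f : borel M -> borel M).
Proof.
move=> /continuousP cf; apply: measurability.
  by [].
move=> _ [V oV <-]; rewrite setTI.
by apply: sub_sigma_algebra; exact: cf.
Qed.

Theorem corollaryB1 (R : realType) (M : ptopologicalType) (d : nat)
    (S : smooth_structure R M d) (g0 : M -> 'M[R]_d)
    (M_hausdorff : hausdorff_space M) (M_compact : compact [set: M])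
    (M_connected : connected [set: M]) (M_riemannian : riemannian_metric S g0)
    (f finv : M -> M) (f_diffeo : C1_diffeomorphism S f finv)
    (Es Ec Eu : M -> 'M[R]_d) (f_ph : partially_hyperbolic S f finv Es Ec Eu)
    (k : nat) (Wu : set (flowbox R M k (d - k)))
    (Wu_unstable : foliation_tangent_to S Eu Wu)
    (mu : probability (borel M) R) (mu_ergodic : ergodic_measure mu f)
    (xi : M -> set M) (xi_Qu : Qu mu f Wu xi)
    (mux : R.-pker (borel M) ~> (borel M))
    (mux_xi : conditional_system mu xi mux)
    (alpha : M -> set M) (alpha_meas : measurable_partition mu alpha)
    (alpha_fin : (cond_entropy mu mux alpha < +oo)%E) :
  {ae mu, forall x,
    (((n%:R^-1)%:E * information mux (iterated_join f alpha n) x)%E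
       @[n --> \oo]) --> dyn_cond_entropy mu f mux alpha}.
Proof.
have [fK finvK f_C1 finv_C1] := f_diffeo.
have [xi_meas _ xi_incr _] := xi_Qu.
have [K f_codable] := codable_Ck_map mu M_hausdorff M_compact f_C1.
exact: (partition_smb (continuous_borel_measurable f_C1.1)
  (continuous_borel_measurable finv_C1.1) fK finvK mu_ergodic xi_meas xi_incr mux_xi
  f_codable alpha_meas alpha_fin).
Qed.
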